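(* Let $\psi$ be an admissible wavelet. For all $f\in L^2_\alpha(\mathbb R_+)$, $$\|x\,W_\psi f\|_{2,\nu_\alpha}^2+\|\xi\,\mathcal H_\alpha f\|_{2,\mu_\alpha}^2\ \ge\ (2\alpha+2)\|f\|_{2,\mu_\alpha}^2,$$ and $$\|x\,W_\psi f\|_{2,\nu_\alpha}\,\|\xi\,\mathcal H_\alpha f\|_{2,\mu_\alpha}\ \ge\ (\alpha+1)\|f\|_{2,\mu_\alpha}^2,$$ where $\|x\,W_\psi f\|_{2,\nu_\alpha}^2=\int_{\mathcal R}x^2|W_\psi f(a,x)|^2\,d\nu_\alpha(a,x)$ and $\|\xi\,\mathcal H_\alpha f\|_{2,\mu_\alpha}^2=\int_0^\infty\xi^2|\mathcal H_\alpha f(\xi)|^2\,d\mu_\alpha(\xi)$ (possibly infinite).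
   Context: Fix a real number $\alpha>-1/2$. Let $\mu_\alpha$ be the measure on $\mathbb{R}_+=[0,\infty)$ given by $d\mu_\alpha(x)=\frac{x^{2\alpha+1}}{2^\alpha\Gamma(\alpha+1)}\,dx$; for $1\le p<\infty$ let $L^p_\alpha(\mathbb R_+)=L^p(\mathbb R_+,\mu_\alpha)$ with norm $\|f\|_{p,\mu_\alpha}=\left(\int_0^\infty|f|^p\,d\mu_\alpha\right)^{1/p}$, and let $L^\infty_\alpha(\mathbb R_+)$ be the essentially bounded functions. Let $j_\alpha(z)=\Gamma(\alpha+1)\sum_{n\ge0}\frac{(-1)^n}{n!\,\Gamma(n+\alpha+1)}(z/2)^{2n}$. The Hankel transform is $\mathcal H_\alpha f(\xi)=\int_0^\infty f(x)\,j_\alpha(x\xi)\,d\mu_\alpha(x)$ for $f\in L^1_\alpha(\mathbb R_+)$, extended to a unitary operator on $L^2_\alpha(\mathbb R_+)$. For $x\ge0$ the Hankel translation is $\tau_x^\alpha f(y)=\frac{\Gamma(\alpha+1)}{\Gamma(1/2)\Gamma(\alpha+1/2)}\int_0^\pi f\big(\sqrt{x^2+y^2+2xy\cos\theta}\big)\sin^{2\alpha}\theta\,d\theta$, and for $a>0$ the dilation is $D_af(x)=a^{\alpha+1}f(ax)$. A nonzero $\psi\in L^1_\alpha(\mathbb R_+)\cap L^\infty_\alpha(\mathbb R_+)$ is an admissible wavelet if $0<c_\psi:=\int_0^\infty|\mathcal H_\alpha\psi(a)|^2\,\frac{da}{a}<\infty$. For such $\psi$ and $f\in L^2_\alpha(\mathbb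 R_+)$, the Hankel wavelet transform is $W_\psi f(a,x)=c_\psi^{-1/2}\int_0^\infty f(t)\,\overline{\tau_x^\alpha(D_a\psi)(t)}\,d\mu_\alpha(t)$ for $(a,x)\in\mathcal R:=(0,\infty)\times[0,\infty)$. On $\mathcal R$ let $d\nu_\alpha(a,x)=a^{2\alpha+1}\,da\,d\mu_\alpha(x)$, $L^p_\alpha(\mathcal R)=L^p(\mathcal R,\nu_\alpha)$, with norm $\|F\|_{p,\nu_\alpha}$ (and $\|F\|_\infty$ the essential supremum). *)

(* Defs.v *)
From HB Require Import structures.
From mathcomp Require Import all_boot all_order all_algebra.
From mathcomp Require Import all_classical all_reals all_analysis.
Set Implicit Arguments. Unset Strict Implicit. Unset Printing Implicit Defensive.
Import Order.TTheory GRing.Theory Num.Theory.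
Import numFieldNormedType.Exports.
Local Open Scope classical_set_scope.
Local Open Scope ring_scope.

(* Complex numbers are represented as pairs (real part, imaginary part). *)
Definition cplx (R : realType) := (R * R)%type.
Definition csq (R : realType) (z : cplx R) : R := z.1 ^+ 2 + z.2 ^+ 2.
Definition cabs (R : realType) (z : cplx R) : R := Num.sqrt (csq z).


Definition Rp (R : realType) : set R := `[0, +oo[%classic.
Definition Rpos (R : realType) : set R := `]0, +oo[%classic.

Definition Gamma (R : realType) (s : R) : R :=
  Rintegral (@lebesgue_measure R) (@Rpos R) (fun t => t `^ (s - 1) * expR (- t)).

(* density of mu_alpha with respect to Lebesgue measure on R_+ *)
Definition wmu (R : realType) (al x : R) : R :=
  x `^ (2 * al + 1) / (2 `^ al * Gamma (al + 1)).

Definition intmuD (R : realType) (al : R) (D : set R) (F : R -> \bar R) : \bar R :=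
  (\int[@lebesgue_measure R]_(x in D) ((wmu al x)%:E * F x))%E.
Definition intmu (R : realType) (al : R) (F : R -> \bar R) : \bar R :=
  intmuD al (@Rp R) F.

Definition Rintmu (R : realType) (al : R) (g : R -> R) : R :=
  Rintegral (@lebesgue_measure R) (@Rp R) (fun x => wmu al x * g x).

Definition Cintmu (R : realType) (al : R) (g : R -> cplx R) : cplx R :=
  (Rintmu al (fun x => (g x).1), Rintmu al (fun x => (g x).2)).

Definition cmeasurable (R : realType) (D : set R) (f : R -> cplx R) : Prop :=
  measurable_fun D (fun x => (f x).1) /\ measurable_fun D (fun x => (f x).2).

Definition L1a (R : realType) (al : R) (f : R -> cplx R) : Prop :=
  cmeasurable (@Rp R) f /\ (intmu al (fun x => (cabs (f x))%:E) < +oo)%E.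
Definition L2a (R : realType) (al : R) (f : R -> cplx R) : Prop :=
  cmeasurable (@Rp R) f /\ (intmu al (fun x => (csq (f x))%:E) < +oo)%E.
Definition Linfa (R : realType) (al : R) (f : R -> cplx R) : Prop :=
  cmeasurable (@Rp R) f /\
  exists M : R, intmuD al (@Rp R `&` [set x | M < cabs (f x)]) (fun=> 1%E) = 0%E.

Definition norm2mu (R : realType) (al : R) (f : R -> cplx R) : \bar R :=
  intmu al (fun x => (csq (f x))%:E).

Definition jal (R : realType) (al z : R) : R :=
  Gamma (al + 1) *
  limn (series (fun n : nat =>
    (-1) ^+ n / ((n`!)%:R * Gamma (n%:R + al + 1)) * (z / 2) ^+ (2 * n))).

Definition hankel (R : realType) (al : R) (f : R -> cplx R) (xi : R) : cplx R :=
  Cintmu al (fun x => (jal al (x * xi) * (f x).1, jal al (x * xi) * (f x).2)).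

Definition trunc (R : realType) (f : R -> cplx R) (n : nat) (x : R) : cplx R :=
  if x <= n%:R then f x else (0, 0).

(* g is the (unitary, L^2) Hankel transform of f in L^2_alpha:
   g in L^2_alpha and H_alpha(f 1_[0,n]) -> g in L^2_alpha. *)
Definition hankelL2 (R : realType) (al : R) (f g : R -> cplx R) : Prop :=
  L2a al g /\
  ((fun n : nat => norm2mu al (fun xi =>
       ((hankel al (trunc f n) xi).1 - (g xi).1,
        (hankel al (trunc f n) xi).2 - (g xi).2))) @ \oo --> 0%E).

Definition htrans (R : realType) (al x : R) (f : R -> cplx R) (y : R) : cplx R :=
  let c := Gamma (al + 1) / (Gamma (2^-1) * Gamma (al + 2^-1)) in
  let F := fun th : R => f (Num.sqrt (x ^+ 2 + y ^+ 2 + 2 * x * y * cos th)) in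
  (c * Rintegral (@lebesgue_measure R) `[0, pi]%classic (fun th => (F th).1 * (sin th) `^ (2 * al)),
   c * Rintegral (@lebesgue_measure R) `[0, pi]%classic (fun th => (F th).2 * (sin th) `^ (2 * al))).

Definition dil (R : realType) (al a : R) (f : R -> cplx R) (x : R) : cplx R :=
  (a `^ (al + 1) * (f (a * x)).1, a `^ (al + 1) * (f (a * x)).2).

Definition cpsi (R : realType) (al : R) (psi : R -> cplx R) : \bar R :=
  (\int[@lebesgue_measure R]_(a in @Rpos R) (csq (hankel al psi a) / a)%:E)%E.

Definition admissible (R : realType) (al : R) (psi : R -> cplx R) : Prop :=
  [/\ L1a al psi, Linfa al psi,
      intmu al (fun x => (cabs (psi x))%:E) <> 0%E
    & (0 < cpsi al psi < +oo)%E].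

(* Hankel wavelet transform W_psi f (a, x) = c_psi^(-1/2) int f(t) conj(tau_x(D_a psi)(t)) dmu(t) *)
Definition hwt (R : realType) (al : R) (psi f : R -> cplx R) (p : R * R) : cplx R :=
  let k := (Num.sqrt (fine (cpsi al psi)))^-1 in
  let g := htrans al p.2 (dil al p.1 psi) in
  (k * Rintmu al (fun t => (f t).1 * (g t).1 + (f t).2 * (g t).2),
   k * Rintmu al (fun t => (f t).2 * (g t).1 - (f t).1 * (g t).2)).

Definition calR (R : realType) : set (R * R) := @Rpos R `*` @Rp R.

Definition intnu (R : realType) (al : R) (F : R * R -> \bar R) : \bar R :=
  (\int[(@lebesgue_measure R \x @lebesgue_measure R)%E]_(p in @calR R)
      ((p.1 `^ (2 * al + 1) * wmu al p.2)%:E * F p))%E.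

(* Main.v *)
Require Import Defs.
From HB Require Import structures.
From mathcomp Require Import all_boot all_order all_algebra.
From mathcomp Require Import all_classical all_reals all_analysis.
From mathcomp Require Import measurable_realfun measurable_fun_approximation.
From mathcomp Require Import ring lra zify.
Set Implicit Arguments. Unset Strict Implicit. Unset Printing Implicit Defensive.
Import Order.TTheory GRing.Theory Num.Theory.
Import numFieldNormedType.Exports.
Local Open Scope classical_set_scope.
Local Open Scope ring_scope.

(** The heat semigroup [P_s] of the Bessel operator replaces derivatives: its
    kernel [p_s] is the Hankel translate of a Gaussian, and
    [En s F = \iint (F x - F y)^2 p_s(x, y) = 2 \int (1 - exp (- s xi^2)) |H F|^2].
    Since the Hankel transform of [W_psi f(a, .)] is
    [c_psi^(-1/2) Hf(xi) conj (H (D_a psi)(xi))] up to the dilation factor,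
    integrating over [a] gives, by the definition of [c_psi],
    [\int En s (W_psi f(a, .)) <= 2 s ||xi Hf||^2] and
    [||W_psi f|| = ||f||].  Conversely [P_s] maps Gaussians to Gaussians, so the ground
    state representation of [En] with respect to [w = exp (- lam x^2 / 2) + eps],
    [En s F + 2 \int F^2 (P_s w) / w >= 2 \int F^2], expanded to first order in [s], gives
    [4 lam (al+1) s \int F^2 (w - eps) / w <= En s F + 2 s lam^2 \int x^2 F^2 + O(s^2 / eps)].
    With [F = W_psi f(a, .)], integration over [a], then [s -> 0] and [eps -> 0] yield
    [2 lam (al+1) ||f||^2 <= ||xi Hf||^2 + lam^2 ||x W_psi f||^2] for every [lam > 0]:
    take [lam = 1] for the sum, and the optimal [lam] for the product. *)

(** * Image measures and measures with a density *)

Section change.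
Local Open Scope ereal_scope.

(** For [f] merely in L2 no smoothness of the wavelet transform in [x] is at hand. [En] makes sense
    for every measurable function and has a nonnegative integrand, so it passes through Tonelli and
    Fatou, and the ground state inequality rests on a pointwise square. The floor [eps] is forced:
    for a pure Gaussian the quotient of [P_s w] by [w] grows like the exponential of a multiple of
    [s * x^2], so no first-order expansion in [s] is uniform in [x]; with the floor every remainder
    is divided by at least [eps]. Plancherel's theorem comes from the same energy, which tends to 0
    with [s] on L2. Spectral identities are proved for functions in L1 and L2 only. The given
    transform [g] of [f] is a limit along truncations, so the energy bound is carried over by Fatou;
    the norm identity also needs the lower bound, obtained by reflecting [f] in its truncations. In
    the product inequality a vanishing factor is treated apart, since the other may be infinite and
    0 times infinity is 0. *)

Lemma ge0_integral_change d1 d2 (X : measurableType d1) (Y : measurableType d2)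
    (R : realType) (phi : X -> Y) (mu : {measure set X -> \bar R})
    (nu : {measure set Y -> \bar R}) (f : Y -> \bar R) :
  measurable_fun setT phi ->
  (forall A, measurable A -> mu (phi @^-1` A) = nu A) ->
  measurable_fun setT f -> (forall y, 0 <= f y) ->
  \int[nu]_y f y = \int[mu]_x f (phi x).
Proof.
move=> mphi H mf f0.
rewrite -(@ge0_integral_pushforward _ _ _ _ _ _ mphi mu setT f)//.
by apply: eq_measure_integral => A mA _; rewrite -H.
Qed.

Lemma integral_change d1 d2 (X : measurableType d1) (Y : measurableType d2)
    (R : realType) (phi : X -> Y) (mu : {measure set X -> \bar R})
    (nu : {measure set Y -> \bar R}) (f : Y -> \bar R) :
  measurable_fun setT phi ->
  (forall A, measurable A -> mu (phi @^-1` A) = nu A) ->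
  measurable_fun setT f ->
  \int[nu]_y f y = \int[mu]_x f (phi x).
Proof.
move=> mphi H mf; rewrite integralE [RHS]integralE.
rewrite !(ge0_integral_change mphi H)//; [|exact: measurable_funeneg|exact: measurable_funepos].
by congr (_ - _); apply: eq_integral => x _; rewrite ?funeposE ?funenegE.
Qed.

End change.

Section lebR.
Context {R : realType}.
Local Open Scope ereal_scope.
Local Notation leb := (@lebesgue_measure R).

(* The library's Lebesgue measure lives on [measurableTypeR R], whose measurable
   structure is not the canonical one of [R]; [lebR] is its copy on [R]. *)
Definition lebR : set R -> \bar R := leb.

HB.instance Definition _ := isMeasure.Build _ R R lebR
  (measure0 leb) (measure_ge0 leb) (@measure_semi_sigma_additive _ _ _ leb).

Let lebR_sigma_finite : sigma_finite [set: R] lebR.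
Proof. exact: (@sigma_finiteT _ _ _ leb). Qed.

HB.instance Definition _ := @Measure_isSigmaFinite.Build _ R R lebR lebR_sigma_finite.

Lemma integral_lebR (f : R -> \bar R) : measurable_fun [set: R] f ->
  \int[lebR]_x f x = \int[leb]_x f x.
Proof.
move=> mf.
have mid : measurable_fun [set: measurableTypeR R] (idfun : measurableTypeR R -> R).
  by move=> _ Y mY; rewrite setTI; exact: mY.
by rewrite (@integral_change _ _ (measurableTypeR R) R R idfun leb lebR f mid).
Qed.

Lemma integral_lebR_in (D : set R) (f : R -> \bar R) : measurable D ->
  measurable_fun D f -> \int[lebR]_(x in D) f x = \int[leb]_(x in D) f x.
Proof.
move=> mD mf; rewrite integral_mkcond [RHS]integral_mkcond integral_lebR//.
exact/(measurable_restrictT f mD).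
Qed.

End lebR.

Section mdens.
Context {R : realType}.
Variables (w : R -> R) (mw : measurable_fun [set: R] w).
Local Open Scope ereal_scope.

(** The absolute value makes this a measure for every measurable [w], so the measure instances below
    depend on measurability alone; it disappears later, where the densities are nonnegative. *)
Definition mdens of measurable_fun [set: R] w :=
  fun A : set R => \int[lebR]_(x in A) (`|w x|%R)%:E.

Let mw' : measurable_fun [set: R] (fun x : R => (`|w x|%R)%:E : \bar R).
Proof. by apply/measurable_EFinP; exact: measurableT_comp. Qed.

Let mdens0 : mdens mw set0 = 0.
Proof. exact: integral_set0. Qed.

Let mdens_ge0 A : 0 <= mdens mw A.
Proof. by apply: integral_ge0 => x _; rewrite lee_fin. Qed.

Let mdens_sigma_additive : semi_sigma_additive (mdens mw).
Proof.
move=> F mF tF mUF; rewrite /mdens ge0_integral_bigcup//; last first.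
  exact: measurable_funTS.
by apply: is_cvg_ereal_nneg_natsum_cond => n _ _; exact: mdens_ge0.
Qed.

HB.instance Definition _ := isMeasure.Build _ _ _ (mdens mw)
  mdens0 mdens_ge0 mdens_sigma_additive.

Let mdens_sigma_finite : sigma_finite [set: R] (mdens mw).
Proof.
(* Bounding the density as well as the point keeps the mass of each set finite; a point [x] enters
   as soon as [n] exceeds both [|x|] and [|w x|]. *)
exists (fun n : nat => `[(- n%:R)%R, n%:R]%classic `&` [set x | `|w x| <= n%:R]%R).
  apply/esym; rewrite -subTset => x _ /=.
  have [n nx] : exists n : nat, (Num.max `|x| `|w x| <= n%:R)%R.
    exists (Num.truncn (Num.max `|x| `|w x|)%R).+1; apply/ltW/truncnS_gt.
  exists n => //=; move: nx; rewrite ge_max => /andP[xn wn]; split => //.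
  by rewrite in_itv/= -ler_norml.
move=> n.
have mS : measurable ([set x | `|w x| <= n%:R]%R : set R).
  rewrite [X in measurable X](_ : _ = [set: R] `&`
    (fun x => `|w x|%R) @^-1` `]-oo, n%:R]%classic); last first.
    by rewrite setTI; apply/seteqP; split => x /=; rewrite in_itv.
  exact: measurableT_comp.
split; first exact: measurableI.
rewrite /mdens.
apply: (@le_lt_trans _ _ (\int[lebR]_(x in `[(- n%:R)%R, n%:R]%classic) (n%:R)%:E)).
  apply: (@le_trans _ _ (\int[lebR]_(x in `[(- n%:R)%R, n%:R]%classic `&` [set x | `|w x| <= n%:R]%R) (n%:R)%:E)).
    apply: ge0_le_integral => //=; first exact: measurableI.
    - exact: measurable_funTS.
    - by move=> x [_ /= h]; rewrite lee_fin.
  apply: ge0_subset_integral => //=; first exact: measurableI.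
rewrite integral_cst//= [lebR _]lebesgue_measure_itv/=; case: ifP => _.
  by rewrite -EFinB -EFinM ltry.
by rewrite mule0 ltry.
Qed.

HB.instance Definition _ := @Measure_isSigmaFinite.Build _ R R (mdens mw)
  mdens_sigma_finite.

End mdens.

Section mdens_integral.
Context {R : realType}.
Variables (w : R -> R) (mw : measurable_fun [set: R] w).
Local Open Scope ereal_scope.
Import HBNNSimple.

Lemma ge0_integral_mdens (f : R -> \bar R) : measurable_fun [set: R] f ->
  (forall x, 0 <= f x) ->
  \int[mdens mw]_x f x = \int[lebR]_x ((`|w x|%R)%:E * f x).
Proof.
move=> mf f0.
have mw' : measurable_fun [set: R] (fun x : R => (`|w x|%R)%:E : \bar R).
  by apply/measurable_EFinP; exact: measurableT_comp.
pose f_ := nnsfun_approx measurableT mf.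
have mf_ n : measurable_fun [set: R] (EFin \o f_ n : R -> \bar R).
  by apply/measurable_EFinP; exact: measurable_funPT.
have f_nd (x : R) : {homo (fun n => (f_ n x)%:E) : n m / (n <= m)%N >-> n <= m}.
  by move=> n m nm; rewrite lee_fin; exact/lefP/(nd_nnsfun_approx measurableT mf nm).
transitivity (limn (fun n => \int[mdens mw]_x (f_ n x)%:E)).
  rewrite -monotone_convergence//.
  - apply: eq_integral => y _; apply/esym/cvg_lim => //.
    by apply: cvg_nnsfun_approx => // *; exact: f0.
  - by move=> n y _; rewrite lee_fin.
transitivity (limn (fun n => \int[lebR]_x ((`|w x|%R)%:E * (f_ n x)%:E))); last first.
  rewrite -monotone_convergence//.
  - apply: eq_integral => y _; apply/cvg_lim => //; apply: cvgeZl => //.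
    by apply: cvg_nnsfun_approx => // *; exact: f0.
  - by move=> n; apply: emeasurable_funM => //; exact: mf_.
  - by move=> n y _; rewrite mule_ge0// lee_fin.
  - by move=> y _ m n mn; rewrite lee_pmul// ?lee_fin//; exact: f_nd.
congr (limn _); apply/funext => n.
have mr (r : R) : measurable_fun [set: R]
    (fun x : R => (r * \1_(f_ n @^-1` [set r]) x)%:E : \bar R).
  apply/measurable_EFinP; apply: measurable_funM; first exact: measurable_cst.
  by apply: measurable_indic; exact: measurable_sfunP.
have r0 (r x : R) : 0 <= (r * \1_(f_ n @^-1` [set r]) x)%:E.
  exact: nnfun_muleindic_ge0.
under eq_integral do rewrite fimfunE -fsumEFin//.
rewrite ge0_integral_fsum//.
transitivity (\sum_(r \in range (f_ n)) \int[lebR]_x ((`|w x|%R)%:E * (r * \1_(f_ n @^-1` [set r]) x)%:E)); last first.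
  rewrite -ge0_integral_fsum//; last 2 first.
  - by move=> r; apply: emeasurable_funM => //; exact: mr.
  - by move=> r x _; rewrite mule_ge0// ?lee_fin//; exact: r0.
  apply: eq_integral => x _; rewrite -ge0_mule_fsumr//.
  by rewrite fsumEFin// -fimfunE.
apply: eq_fsbigr => r /set_mem [y _ ry].
have rge0 : (0 <= r)%R by rewrite -ry.
set A := f_ n @^-1` [set r].
have mA : measurable (A : set R) by exact: measurable_sfunP.
have m1A : measurable_fun [set: R] (fun x : R => (\1_A x)%:E : \bar R).
  by apply/measurable_EFinP; exact: measurable_indic.
under eq_integral do rewrite EFinM.
rewrite ge0_integralZl_EFin//.
rewrite (integral_indic (mdens mw) measurableT mA) setIT.
transitivity (r%:E * \int[lebR]_(x in A) (`|w x|%R)%:E); first by [].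
rewrite integral_mkcond -ge0_integralZl_EFin//.
- by apply: eq_integral => x _; rewrite patchE indicE EFinM muleCA; case: ifP => _; rewrite ?mule1 ?mule0.
- by move=> x _; rewrite patchE; case: ifP.
- by apply/(measurable_restrict _ mA measurableT); rewrite setTI; exact: measurable_funS mw'.
Qed.

Lemma integral_mdens (f : R -> \bar R) : measurable_fun [set: R] f ->
  \int[mdens mw]_x f x = \int[lebR]_x ((`|w x|%R)%:E * f x).
Proof.
move=> mf; rewrite integralE [RHS]integralE.
rewrite !ge0_integral_mdens//; [|exact: measurable_funeneg|exact: measurable_funepos].
congr (_ - _); apply: eq_integral => x _.
  by rewrite !funeposE maxe_pMr// mule0.
by rewrite !funenegE -muleN maxe_pMr// mule0.
Qed.

Lemma integrable_mdens (f : R -> \bar R) : measurable_fun [set: R] f ->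
  (mdens mw).-integrable setT f <-> lebR.-integrable setT (fun x => (`|w x|%R)%:E * f x : \bar R).
Proof.
move=> mf.
have mwf : measurable_fun [set: R] (fun x => (`|w x|%R)%:E * f x : \bar R).
  by apply: emeasurable_funM => //; exact/measurable_EFinP/measurableT_comp.
have E : \int[mdens mw]_x `|f x| = \int[lebR]_x `|(`|w x|%R)%:E * f x|.
  rewrite ge0_integral_mdens//; last exact: measurableT_comp.
  by apply: eq_integral => x _; rewrite abseM/= normr_id.
by split=> /integrableP[_ h]; apply/integrableP; split => //; rewrite ?E// -E.
Qed.

End mdens_integral.

(** * Measurability of elementary functions *)

Section measurability.
Context {R : realType}.

(** Inversion is discontinuous at 0, so continuity is of no use: on each half line it is written as
    a power of exponent -1, and the inverse of 0 is 0 by convention. *)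
Lemma measurable_inv : measurable_fun [set: R] (fun x : R => x^-1).
Proof.
rewrite (_ : (fun x : R => x^-1) = (fun x : R => if 0 < x then x `^ (- 1) else
  if x < 0 then - ((- x) `^ (- 1)) else 0)); last first.
  apply/funext => x; case: ifPn => [x0|]; first by rewrite powR_inv1// ltW.
  rewrite -leNgt le_eqVlt => /predU1P[->|x0]; first by rewrite ltxx invr0.
  by rewrite x0 powR_inv1 ?oppr_ge0 ?ltW// invrN opprK.
apply: measurable_fun_ifT => //=.
- exact: measurable_fun_ltr.
- apply: measurable_fun_ifT => //=; first exact: measurable_fun_ltr.
  apply: measurable_funN; apply: (measurableT_comp (measurable_powR (- 1))).
  exact: measurable_funN.
Qed.

Lemma measurable_sin : measurable_fun [set: R] (@sin R).
Proof. by apply: continuous_measurable_fun; exact: continuous_sin. Qed.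

Lemma measurable_cos : measurable_fun [set: R] (@cos R).
Proof. by apply: continuous_measurable_fun; exact: continuous_cos. Qed.

Lemma measurable_sqrt : measurable_fun [set: R] (@Num.sqrt R).
Proof. by apply: continuous_measurable_fun; exact: sqrt_continuous. Qed.


Lemma measurable_tan : measurable_fun [set: R] (@tan R).
Proof.
apply: measurable_funM; first exact: measurable_sin.
by apply: (measurableT_comp measurable_inv); exact: measurable_cos.
Qed.

Lemma measurable_fun_inv d (T : measurableType d) (f : T -> R) :
  measurable_fun setT f -> measurable_fun setT (fun x => (f x)^-1).
Proof. by move=> mf; exact: (measurableT_comp measurable_inv). Qed.

Lemma measurable_fun_sqrt d (T : measurableType d) (f : T -> R) :
  measurable_fun setT f -> measurable_fun setT (fun x => Num.sqrt (f x)).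
Proof. by move=> mf; exact: (measurableT_comp measurable_sqrt). Qed.

Lemma measurable_fun_cos d (T : measurableType d) (f : T -> R) :
  measurable_fun setT f -> measurable_fun setT (fun x => cos (f x)).
Proof. by move=> mf; exact: (measurableT_comp measurable_cos). Qed.

Lemma measurable_fun_sin d (T : measurableType d) (f : T -> R) :
  measurable_fun setT f -> measurable_fun setT (fun x => sin (f x)).
Proof. by move=> mf; exact: (measurableT_comp measurable_sin). Qed.

Lemma measurable_fun_expR d (T : measurableType d) (f : T -> R) :
  measurable_fun setT f -> measurable_fun setT (fun x => expR (f x)).
Proof. by move=> mf; exact: (measurableT_comp (@measurable_expR R)). Qed.

Lemma measurable_fun_powR d (T : measurableType d) (f : T -> R) p :
  measurable_fun setT f -> measurable_fun setT (fun x => f x `^ p).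
Proof. by move=> mf; exact: (measurableT_comp (measurable_powR p)). Qed.

End measurability.

Ltac meas1 :=
  lazymatch goal with
  | |- measurable_fun _ (fun x => (@?f x)%:E) => apply/measurable_EFinP
  | |- measurable_fun _ (EFin \o _) => apply/measurable_EFinP
  | |- measurable_fun _ (fun x => (@?f x + @?g x)%R) => apply: measurable_funD
  | |- measurable_fun _ (fun x => (@?f x * @?g x)%R) => apply: measurable_funM
  | |- measurable_fun _ (fun x => (- @?f x)%R) => apply: measurable_funN
  | |- measurable_fun _ (fun x => (@?f x ^+ _)%R) => apply: measurable_funX
  | |- measurable_fun _ (fun x => ((@?f x)^-1)%R) => apply: measurable_fun_inv
  | |- measurable_fun _ (fun x => Num.sqrt (@?f x)) => apply: measurable_fun_sqrt
  | |- measurable_fun _ (fun x => cos (@?f x)) => apply: measurable_fun_cos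
  | |- measurable_fun _ (fun x => sin (@?f x)) => apply: measurable_fun_sin
  | |- measurable_fun _ (fun x => expR (@?f x)) => apply: measurable_fun_expR
  | |- measurable_fun _ (fun x => powR (@?f x) _) => apply: measurable_fun_powR
  | |- measurable_fun _ (fun x => `|@?f x|%R) => apply: (measurableT_comp (@normr_measurable _ setT))
  | |- measurable_fun _ (fun x => (@?f x * @?g x)%E) => apply: emeasurable_funM
  | |- measurable_fun _ (fun x => (@?f x + @?g x)%E) => apply: emeasurable_funD
  | |- measurable_fun _ (fun x => (@?f x < @?g x)%R) => apply: measurable_fun_ltr
  | |- measurable_fun _ (fun x => (@?f x <= @?g x)%R) => apply: measurable_fun_ler
  | |- measurable_fun _ (fun x => @?f x && @?g x) => apply: measurable_and
  | |- measurable_fun _ (fun x => (@?f x, @?g x)) => apply: measurable_fun_pair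
  end.

Ltac meas0 :=
  match goal with
  | H : measurable_fun _ ?f |- measurable_fun _ ?f => exact: H
  | |- measurable_fun _ (fun _ => ?c) => exact: measurable_cst
  | |- measurable_fun _ (fun x => x) => exact: measurable_id
  | |- measurable_fun _ fst => exact: measurable_fst
  | |- measurable_fun _ (fun x => (@?f x).1) => apply: (measurableT_comp measurable_fst)
  | |- measurable_fun _ (fun x => (@?f x).2) => apply: (measurableT_comp measurable_snd)
  | |- measurable_fun _ snd => exact: measurable_snd
  | |- measurable_fun _ (@expR _) => exact: measurable_expR
  | |- measurable_fun _ (@cos _) => exact: measurable_cos
  | |- measurable_fun _ (@sin _) => exact: measurable_sin
  | |- measurable_fun _ (Order.lt _) => apply: measurable_fun_ltr
  | |- measurable_fun _ (Order.le _) => apply: measurable_fun_ler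
  | H : measurable_fun setT ?g |- measurable_fun setT (fun x => ?g _) =>
      apply: (measurableT_comp H)
  | |- measurable_fun _ (fun x => if _ then _ else _) => apply: measurable_fun_ifT
  end.

Ltac meas := repeat first [ meas0 | meas1 ].

(** * Substitutions on the line for measurable integrands *)

Section change_of_variables.
Local Open Scope ereal_scope.
Context {R : realType}.

(** The hypothesis says that the image under [phi] of the measure with density [|w|] gives half-open
    intervals their length, and this determines Lebesgue measure. *)
Lemma lebesgue_change (w phi : R -> R) (f : R -> \bar R) :
  measurable_fun setT w -> measurable_fun setT phi ->
  (forall a b : R, (a <= b)%R ->
    \int[lebR]_(x in phi @^-1` `]a, b]%classic) (`|w x|%R)%:E = (b - a)%:E) ->
  measurable_fun setT f ->
  \int[lebR]_x f x = \int[lebR]_x ((`|w x|%R)%:E * f (phi x)).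
Proof.
move=> mw mphi H mf.
rewrite -(integral_mdens mw (f := f \o phi)); last exact: measurableT_comp.
apply: (integral_change mphi) => // A mA.
have mphi' : measurable_fun [set: R] (phi : R -> measurableTypeR R) by [].
pose phi' : {mfun R >-> measurableTypeR R} := HB.pack phi (isMeasurableFun.Build _ _ _ _ _ mphi').
suff H' : forall B, measurable B -> lebesgue_measure B = pushforward (mdens mw) phi' B.
  by apply/esym; exact: H'.
apply: lebesgue_measure_unique => _ [[a b]] _ <- /=.
rewrite /pushforward /mdens lebesgue_measure_itv/= lte_fin.
case: ifPn => [ab|ba]; first by rewrite H ?ltW// EFinB.
by rewrite set_itv_ge ?bnd_simp// preimage_set0 integral_set0.
Qed.


Lemma lebR_itv_FTC (F f : R -> R) (a b : R) : (a <= b)%R ->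
  (forall x : R, (a <= x <= b)%R -> is_derive x 1%R F (f x) /\ {for x, continuous f}) ->
  \int[lebR]_(x in `]a, b]%classic) (f x)%:E = (F b - F a)%:E.
Proof.
rewrite le_eqVlt => /predU1P[->|ab] dcF.
  by rewrite set_itv_ge ?bnd_simp ?ltxx// integral_set0 subrr.
have dF x (h : (a <= x <= b)%R) := (dcF x h).1.
have cf x (h : (a <= x <= b)%R) := (dcF x h).2.
have cF x : (a <= x <= b)%R -> {for x, continuous F}.
  move=> xab; have := dF x xab => dFx.
  by apply/differentiable_continuous/derivable1_diffP.
have cfab : {within `[a, b], continuous f}.
  apply: continuous_in_subspaceT => x; rewrite inE/= in_itv/= => xab.
  exact: cf.
have mf : measurable_fun (`[a, b]%classic : set R) (EFin \o f).
  by apply/measurable_EFinP; apply: subspace_continuous_measurable_fun.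
rewrite integral_lebR_in//; last by apply: measurable_funS mf => //; exact: subset_itv_oc_cc.
rewrite integral_itv_obnd_cbnd; last by apply: measurable_funS mf => //; exact: subset_itv_oc_cc.
rewrite (continuous_FTC2 ab cfab (F := F)) ?EFinB//.
- split.
  + by move=> x /[!in_itv]/= /andP[ax xb]; have := dF x; rewrite !ltW// => /(_ isT) h.
  + by apply: cvg_at_right_filter; apply: cF; rewrite lexx ltW.
  + by apply: cvg_at_left_filter; apply: cF; rewrite lexx ltW.
- move=> x /[!in_itv]/= /andP[ax xb].
  have := dF x; rewrite !ltW// => /(_ isT) h.
  by rewrite derive1E; exact: derive_val.
Qed.

(* Substitution [y = phi x] along an increasing bijection [phi] from the
   interval [I] onto the line, with inverse [psi]; the integrand is only
   measurable, hence the detour through uniqueness of Lebesgue measure. *)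
Lemma lebesgue_subst (I : pred R) (phi dphi psi : R -> R) (g : R -> \bar R) :
  measurable_fun setT I -> measurable_fun setT phi -> measurable_fun setT dphi ->
  (forall x, I x -> 0 <= dphi x)%R ->
  (forall x, I x -> is_derive x 1%R phi (dphi x) /\ {for x, continuous dphi}) ->
  (forall y, phi (psi y) = y) ->
  (forall a b, a <= b -> psi a <= psi b)%R ->
  (forall a b x, psi a <= x <= psi b -> I x)%R ->
  (forall a b x, I x -> (a < phi x <= b) = (psi a < x <= psi b))%R ->
  measurable_fun setT g ->
  \int[lebR]_y g y = \int[lebR]_x (if I x then (dphi x)%:E * g (phi x) else 0).
Proof.
move=> mI mphi md d0 dphiP phiK psi_le psiI E mg.
pose w x := if I x then dphi x else 0%R.
have w0 x : (0 <= w x)%R by rewrite /w; case: ifPn => // /d0.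
rewrite (@lebesgue_change w phi)//; last first.
- move=> a b ab.
  transitivity (\int[lebR]_(x in `]psi a, psi b]%classic) (dphi x)%:E).
    rewrite integral_mkcond [RHS]integral_mkcond; apply: eq_integral => x _.
    rewrite !patchE ger0_norm//.
    have -> : (x \in phi @^-1` `]a, b]%classic) = (a < phi x <= b)%R.
      by apply/idP/idP => [|h]; rewrite inE/= in_itv.
    have -> : (x \in `]psi a, psi b]%classic) = (psi a < x <= psi b)%R.
      by rewrite mem_setE in_itv.
    rewrite /w; have [Ix|/negP Ix] := boolP (I x); first by rewrite E.
    have -> : (psi a < x <= psi b)%R = false.
      by apply/negP => /andP[h1 h2]; apply: Ix; apply: (psiI a b); rewrite (ltW h1).
    by case: ifP.
  rewrite (@lebR_itv_FTC phi)// ?phiK// ?psi_le//.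
  by move=> x /psiI; exact: dphiP.
- by apply: measurable_fun_ifT.
by apply: eq_integral => x _; rewrite ger0_norm// /w; case: ifP => // _; rewrite mul0e.
Qed.

Lemma lebR_itv (i : interval R) : lebR [set` i] =
  (if (i.1 < i.2)%E then ((i.2 : \bar R) - i.1)%E else 0).
Proof. exact: lebesgue_measure_itv. Qed.

Lemma lebesgue_reflect (g : R -> \bar R) : measurable_fun setT g ->
  \int[lebR]_x g x = \int[lebR]_x g (- x)%R.
Proof.
move=> mg.
have mN : measurable_fun [set: R] (fun x : R => - x)%R by exact: measurable_funN.
by apply: (integral_change mN) => // A mA; exact: lebesgue_measureN.
Qed.

Lemma lebesgue_affine (k c : R) (g : R -> \bar R) : (0 < k)%R ->
  measurable_fun setT g ->
  \int[lebR]_x g x = \int[lebR]_x (k%:E * g (k * x + c)%R).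
Proof.
move=> k0 mg.
rewrite (@lebesgue_subst xpredT (fun x => k * x + c)%R (fun=> k) (fun y => (y - c) / k)%R)//.
- by meas.
- by move=> x _; exact: ltW.
- move=> x _; split; last exact: cvg_cst.
  have -> : (fun x0 : R => k * x0 + c)%R = (k \*: (@idfun R : R -> R) + cst c)%R by [].
  by apply: is_derive_eq; rewrite addr0 scaler1.
- by move=> y; rewrite mulrC divfK ?gt_eqF// subrK.
- by move=> a b ab; rewrite ler_pM2r ?invr_gt0// lerD2r.
- by move=> a b x _; rewrite ltr_pdivrMr// ler_pdivlMr// ltrBlDr lerBrDr mulrC.
Qed.

Lemma lebesgue_shift (c : R) (g : R -> \bar R) : measurable_fun setT g ->
  \int[lebR]_x g x = \int[lebR]_x g (x + c)%R.
Proof.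
move=> mg; rewrite (@lebesgue_affine 1 c)//; apply: eq_integral => x _.
by rewrite mul1r mul1e.
Qed.

(** The general substitution is applied to [ln], which maps the half line onto the whole line, and
    is then read backwards. *)
Lemma lebesgue_expR (g : R -> \bar R) : measurable_fun setT g ->
  \int[lebR]_x (if (0 < x)%R then g x else 0) =
  \int[lebR]_t ((expR t)%:E * g (expR t)).
Proof.
move=> mg; apply/esym.
rewrite (@lebesgue_subst (fun x => 0 < x)%R (@ln R) (fun x => x^-1)%R (@expR R))//.
- by apply: eq_integral => x _; case: ifPn => // x0; rewrite lnK// muleA -EFinM mulVf ?gt_eqF// mul1e.
- exact: measurable_fun_ltr.
- exact: measurable_inv.
- by move=> x x0; rewrite invr_ge0 ltW.
- move=> x x0; split; first exact: is_derive1_ln.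
  by apply: inv_continuous; rewrite gt_eqF.
- exact: expRK.
- by move=> a b; rewrite ler_expR.
- by move=> a b x /andP[+ _]; apply: lt_le_trans; exact: expR_gt0.
- by move=> a b x x0; rewrite -[in RHS](lnK x0) ltr_expR ler_expR.
- by meas; exact: (measurableT_comp mg (@measurable_expR R)).
Qed.

Lemma lebesgue_tan (g : R -> \bar R) : measurable_fun setT g ->
  \int[lebR]_y g y = \int[lebR]_x (if (- (pi / 2) < x < pi / 2)%R then
    ((cos x) ^- 2)%:E * g (tan x) else 0).
Proof.
move=> mg.
have cos0 (x : R) : (- (pi / 2) < x < pi / 2)%R -> (0 < cos x)%R by exact: cos_gt0_pihalf.
rewrite (@lebesgue_subst (fun x => - (pi / 2) < x < pi / 2)%R (@tan R) (fun x => (cos x) ^- 2)%R (@atan R))//.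
- by meas.
- exact: measurable_tan.
- by meas.
- by move=> x _; rewrite invr_ge0 sqr_ge0.
- move=> x /cos0 cx; split; first by apply: is_derive_tan; rewrite gt_eqF.
  apply: (@continuous_comp _ _ _ (fun x => cos x ^+ 2)%R GRing.inv).
    by apply: (@continuous_comp _ _ _ (@cos R) (fun y => y ^+ 2)%R); [exact: continuous_cos|exact: exprn_continuous].
  by apply: inv_continuous; rewrite expf_neq0// gt_eqF.
- exact: atanK.
- exact: le_atan.
- move=> a b x /andP[h1 h2]; rewrite (lt_le_trans (atan_gtNpi2 a) h1)/=.
  exact: (le_lt_trans h2 (atan_ltpi2 b)).
- move=> a b x xI; rewrite -[in LHS](atanK a) -[in LHS](atanK b).
  have I y : (atan y \in `](- (pi / 2)), (pi / 2)[)%R by rewrite in_itv/= atan_gtNpi2 atan_ltpi2.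
  have xI' : x \in `](- (pi / 2))%R, (pi / 2)%R[ by rewrite in_itv.
  congr andb; first by rewrite (ltr_tan (I _ a) xI').
  by rewrite !leNgt (ltr_tan (I _ b) xI').
Qed.

End change_of_variables.

Section tonelli.
Local Open Scope ereal_scope.
Context d1 d2 (T1 : measurableType d1) (T2 : measurableType d2) (R : realType).
Variables (m1 : {sigma_finite_measure set T1 -> \bar R})
  (m2 : {sigma_finite_measure set T2 -> \bar R}).

Lemma tonelli (f : T1 -> T2 -> \bar R) :
  measurable_fun setT (fun p => f p.1 p.2) -> (forall x y, 0 <= f x y) ->
  \int[m1]_x \int[m2]_y f x y = \int[m2]_y \int[m1]_x f x y.
Proof.
by move=> mf f0; exact: (fubini_tonelli (fun p => f p.1 p.2) mf (fun p => f0 p.1 p.2)).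
Qed.

Lemma measurable_tonelli (f : T1 -> T2 -> \bar R) :
  measurable_fun setT (fun p => f p.1 p.2) -> (forall x y, 0 <= f x y) ->
  measurable_fun setT (fun x => \int[m2]_y f x y).
Proof.
by move=> mf f0; exact: (measurable_fun_fubini_tonelli_F (fun p => f p.1 p.2) mf (fun p => f0 p.1 p.2)).
Qed.

Lemma ge0_integral_sep (f : T1 -> R) (g : T2 -> R) :
  measurable_fun setT f -> measurable_fun setT g ->
  (forall x, 0 <= f x)%R -> (forall y, 0 <= g y)%R ->
  \int[m1]_x \int[m2]_y (f x * g y)%:E =
  (\int[m1]_x (f x)%:E) * (\int[m2]_y (g y)%:E).
Proof.
move=> mf mg f0 g0.
have I0 : 0 <= \int[m2]_y (g y)%:E by apply: integral_ge0 => y _; rewrite lee_fin.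
transitivity (\int[m1]_x ((f x)%:E * \int[m2]_y (g y)%:E)).
  apply: eq_integral => x _; under eq_integral do rewrite EFinM.
  rewrite ge0_integralZl_EFin//; first by move=> y _; rewrite lee_fin.
  exact/measurable_EFinP.
rewrite ge0_integralZr//; first exact/measurable_EFinP.
by move=> x _; rewrite lee_fin.
Qed.

End tonelli.

(** * The Gamma function and polar coordinates *)

Section gamma.
Context {R : realType}.
Implicit Types s t u : R.

(** The integrand of Gamma in the variable [u = ln t]. The endpoint [t = 0], singular for [s < 1],
    becomes exponential decay at minus infinity. *)
Let hG s u := expR (s * u) * expR (- expR u).

Let mhG s : measurable_fun setT (hG s).
Proof. by rewrite /hG; meas. Qed.

Lemma integral_inv1Dsqr :
  (\int[lebR]_x ((1 + x ^+ 2)^-1)%:E = (pi : R)%:E)%E.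
Proof.
rewrite lebesgue_tan; last by meas.
transitivity (\int[lebR]_(x in (`](- (pi / 2))%R, (pi / 2)%R[%classic : set R)) (cst 1%E x))%E.
  rewrite [RHS]integral_mkcond; apply: eq_integral => x _; rewrite patchE mem_setE in_itv/=.
  case: ifPn => // xI; rewrite -EFinM -cos2_tan2 ?invrK ?mulVf//.
    by rewrite expf_neq0// gt_eqF// cos_gt0_pihalf.
  by rewrite gt_eqF// cos_gt0_pihalf.
rewrite integral_cst// mul1e; apply: etrans (lebR_itv _) _; rewrite /= lte_fin.
have h : 0 < pi / 2 :> R by rewrite divr_gt0// pi_gt0.
by rewrite (lt_trans _ h) ?oppr_lt0// -EFinB opprK -splitr.
Qed.

(** One majorant serves twice: it is integrable, whence Gamma is finite, and it vanishes at both
    ends of the line, which kills the boundary terms in the functional equation. *)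
Lemma hG_bound s : 0 < s -> exists2 C, 0 < C & forall u, hG s u <= C * (1 + u ^+ 2)^-1.
Proof.
move=> s0.
have key2 (x : R) : 0 <= x -> 1 + x ^+ 2 / 2 <= expR x.
  by move=> x0; have := @expR_ge1Dxn R x 1 x0.
(* For [u >= 0] the factor [expR (- expR u)] is at most n! times [expR (- (n * u))]; with
   [n >= s + 1] this absorbs [expR (s * u)] and still leaves [expR (- u)]. *)
pose k := Num.truncn (s + 1); pose n := k.+1.
have nP : s + 1 <= n%:R by apply/ltW/truncnS_gt.
(* The part with [s] serves [u < 0], through [1 + x^2 / 2 <= expR x] at [x = - (s * u)]; the
   factorial part serves [u >= 0]. *)
exists (1 + 2 / s ^+ 2 + n`!%:R * 2).
  by rewrite addr_gt0// ?addr_gt0 ?divr_gt0 ?exprn_gt0// mulr_gt0// ltr0n fact_gt0.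
move=> u; have u2 : 0 < 1 + u ^+ 2 by rewrite ltr_pwDl// sqr_ge0.
rewrite ler_pdivlMr//.
have [u0|u0] := leP 0 u.
  apply: (@le_trans _ _ (n`!%:R * 2)); last first.
    by rewrite lerDr addr_ge0// divr_ge0// sqr_ge0.
  have h1 : expR (- expR u) <= n`!%:R * expR (- (n%:R * u)).
    have A : expR u ^+ n / n`!%:R <= expR (expR u).
      by apply: le_trans (expR_ge1Dxn k (expR_ge0 u)); rewrite lerDr.
    rewrite !expRN expRM_natl -[X in _ <= X]invf_div lef_pV2// posrE ?expR_gt0//.
    by rewrite divr_gt0 ?exprn_gt0 ?expR_gt0// ltr0n fact_gt0.
  have h2 : expR (- u) * (1 + u ^+ 2) <= 2.
    rewrite expRN ler_pdivrMl ?expR_gt0//.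
    by have := key2 u u0; lra.
  have h3 : expR (s * u) * expR (- (n%:R * u)) <= expR (- u).
    rewrite -expRD ler_expR -subr_ge0.
    rewrite (_ : _ - _ = (n%:R - (s + 1)) * u); last by ring.
    by rewrite mulr_ge0// subr_ge0.
  apply: (@le_trans _ _ (n`!%:R * (expR (- u) * (1 + u ^+ 2)))); last first.
    by rewrite ler_wpM2l.
  rewrite /hG mulrA ler_wpM2r ?(ltW u2)//.
  apply: (@le_trans _ _ (expR (s * u) * (n`!%:R * expR (- (n%:R * u))))).
    by rewrite ler_wpM2l ?expR_ge0.
  by rewrite mulrCA ler_wpM2l.
apply: (@le_trans _ _ (1 + 2 / s ^+ 2)); last first.
  by rewrite lerDl mulr_ge0.
have h1 : expR (s * u) * (1 + u ^+ 2) <= 1 + 2 / s ^+ 2.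
  have su : 0 <= - (s * u) by rewrite -mulrN mulr_ge0 ?(ltW s0)// oppr_ge0 ltW.
  have := key2 _ su; rewrite sqrrN => h.
  rewrite -[s * u]opprK expRN ler_pdivrMl ?expR_gt0//.
  apply: (@le_trans _ _ ((1 + (s * u) ^+ 2 / 2) * (1 + 2 / s ^+ 2))); last first.
    by rewrite ler_wpM2r// addr_ge0// divr_ge0// sqr_ge0.
  rewrite -subr_ge0 (_ : _ - _ = (s * u) ^+ 2 / 2 + 2 / s ^+ 2); last by field; rewrite gt_eqF.
  by rewrite addr_ge0// divr_ge0// ?sqr_ge0.
apply: le_trans h1; rewrite ler_wpM2r ?(ltW u2)//.
by rewrite /hG -[leRHS]mulr1 ler_wpM2l ?expR_ge0// expR_le1 oppr_le0 expR_ge0.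
Qed.

Definition gammaE s : \bar R :=
  (\int[lebR]_t (if (0 < t)%R then (t `^ (s - 1) * expR (- t))%:E else 0))%E.

Lemma gammaE_expR s : gammaE s = (\int[lebR]_u (hG s u)%:E)%E.
Proof.
rewrite /gammaE lebesgue_expR; last by meas.
apply: eq_integral => u _; rewrite -EFinM /hG mulrA; congr (_ * _)%:E.
by rewrite -expRM -expRD; congr expR; ring.
Qed.

Lemma integrable_hG s : 0 < s -> lebR.-integrable setT (fun u => (hG s u)%:E).
Proof.
move=> /hG_bound[C C0 HC].
apply: (@le_integrable _ _ _ lebR _ measurableT _ (fun u => C%:E * ((1 + u ^+ 2)^-1)%:E)%E).
- by apply/measurable_EFinP.
- move=> u _; rewrite -EFinM !abse_EFin lee_fin !ger0_norm ?HC//.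
    by rewrite mulr_ge0 ?(ltW C0)// invr_ge0 addr_ge0// sqr_ge0.
  by rewrite mulr_ge0 ?expR_ge0.
apply: integrableZl => //; apply/integrableP; split; first by meas.
under eq_integral => u _ do rewrite abse_EFin ger0_norm ?invr_ge0 ?addr_ge0 ?sqr_ge0//.
by rewrite integral_inv1Dsqr ltry.
Qed.

Lemma Gamma_gammaE s : 0 < s -> gammaE s = (Gamma s)%:E.
Proof.
move=> s0; rewrite /Gamma /Rintegral.
have mf : measurable_fun (@Rpos R) (fun t : R => (t `^ (s - 1) * expR (- t))%:E).
  by apply: measurable_funTS; meas.
rewrite -integral_lebR_in//; last exact: measurable_itv.
rewrite integral_mkcond -[X in (_ = (fine X)%:E)%E](_ : gammaE s = _); last first.
  by apply: eq_integral => t _; rewrite patchE mem_setE/= in_itv/= andbT.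
rewrite fineK// gammaE_expR; apply: integrable_fin_num => //.
exact: integrable_hG.
Qed.

Lemma Gamma_gt0 s : 0 < s -> 0 < Gamma s.
Proof.
move=> s0; rewrite -lte_fin -Gamma_gammaE// gammaE_expR.
apply: (@lt_le_trans _ _ (\int[lebR]_u ((expR (- expR 1)) * \1_(`[0, 1]%classic : set R) u)%:E)%E).
  under eq_integral do rewrite EFinM.
  rewrite ge0_integralZl_EFin ?expR_ge0//; last first.
    by apply/measurable_EFinP; exact: measurable_indic.
  rewrite integral_indic// setIT mule_gt0 ?lte_fin ?expR_gt0//.
  by rewrite [X in (_ < X)%E](lebR_itv `[0, 1])/= lte01 oppr0 adde0.
apply: ge0_le_integral => //.
- by apply/measurable_EFinP; apply: measurable_funM => //; exact: measurable_indic.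
- exact/measurable_EFinP.
- move=> u _; rewrite lee_fin indicE mem_setE in_itv/=.
  have [/andP[u0 u1]|_] := boolP (0 <= u <= 1); last by rewrite mulr0 mulr_ge0 ?expR_ge0.
  rewrite mulr1 -[leLHS]mul1r ler_pM ?expR_ge0//.
    by rewrite -expR0 ler_expR mulr_ge0 ?(ltW s0).
  by rewrite ler_expR lerN2 ler_expR.
Qed.

(** Integration by parts in the variable [u]: the derivative of [hG s] is [s * hG s - hG (s + 1)],
    its integral over a symmetric interval is a difference of boundary values, and these tend to
    0. *)
Lemma GammaS s : 0 < s -> Gamma (s + 1) = s * Gamma s.
Proof.
move=> s0; have s1 : 0 < s + 1 by rewrite addr_gt0.
have [C C0 HC] := hG_bound s0.
pose f u := s * hG s u - hG (s + 1) u.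
have mf : measurable_fun setT f by rewrite /f; meas.
have dF u : is_derive u 1 (hG s) (f u) /\ {for u, continuous f}.
  split.
    rewrite /hG; apply: is_derive_eq.
    rewrite /f /hG mulrDl expRD mul1r /GRing.scale/=; ring.
  by rewrite /f /hG; apply/differentiable_continuous/derivable1_diffP; apply: ex_derive.
have iH := integrable_hG s0; have iH1 := integrable_hG s1.
pose fn (n : nat) u := (f u * \1_(`](- n%:R)%R, n%:R]%classic : set R) u)%:E.
have Fn n : (\int[lebR]_u fn n u = (hG s n%:R - hG s (- n%:R))%:E)%E.
  rewrite -(@lebR_itv_FTC _ _ f)//; last by rewrite -subr_ge0 opprK addr_ge0.
  rewrite [RHS]integral_mkcond; apply: eq_integral => u _.
  by rewrite /fn patchE indicE; case: ifPn; rewrite ?mulr1 ?mulr0.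
have ig : lebR.-integrable setT (fun u => (s * hG s u + hG (s + 1) u)%:E).
  under eq_fun do rewrite EFinD EFinM.
  by apply: integrableD => //; exact: integrableZl.
have hG0 v u : 0 <= hG v u by rewrite mulr_ge0 ?expR_ge0.
have [_ _ L] : [/\ lebR.-integrable setT (EFin \o f),
   [sequence (\int[lebR]_u `|fn n u - (EFin \o f) u|)%E]_n @ \oo --> 0%E &
   [sequence (\int[lebR]_u fn n u)%E]_n @ \oo --> (\int[lebR]_u (EFin \o f) u)%E].
  apply: (@dominated_convergence _ _ _ lebR setT measurableT fn (EFin \o f) _ _ _ _ ig) => //.
  - by move=> n; apply/measurable_EFinP; apply: measurable_funM => //; exact: measurable_indic.
  - exact/measurable_EFinP.
  - apply: aeW => u _; apply: cvg_near_cst.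
    exists (Num.truncn `|u|).+1 => // n /= nu; rewrite /fn indicE mem_setE in_itv/=.
    have /lt_le_trans h : `|u| < (Num.truncn `|u|).+1%:R by exact: truncnS_gt.
    have {}h : `|u| < n%:R by apply: h; rewrite ler_nat.
    by move: h; rewrite ltr_norml => /andP[h1 h2]; rewrite h1 (ltW h2) mulr1.
  - apply: aeW => u n _; rewrite /fn abse_EFin lee_fin normrM.
    apply: (@le_trans _ _ `|f u|).
      by rewrite ler_piMr// indicE; case: (_ \in _); rewrite ?normr1 ?normr0.
    by rewrite (le_trans (ler_normB _ _))// normrM !ger0_norm// ltW.
have L2 : (\int[lebR]_u (EFin \o f) u = (s * Gamma s - Gamma (s + 1))%:E)%E.
  under eq_integral do rewrite /= EFinB EFinM.
  rewrite integralB//; last exact: integrableZl.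
  by rewrite integralZl// -!gammaE_expR !Gamma_gammaE.
have L0 : (fun n => (hG s n%:R - hG s (- n%:R))) @ \oo --> (0 : R).
  have b n : `|hG s n%:R - hG s (- n%:R)| <= C * harmonic n.
    have h : (1 + n%:R ^+ 2)^-1 <= harmonic n :> R.
      rewrite /harmonic lef_pV2 ?posrE// ?ltr_pwDl ?sqr_ge0//.
      rewrite -natr1 addrC lerD2l -natrX ler_nat; case: n => // n.
      by rewrite -[leqLHS]muln1 expnS expn1 leq_mul2l.
    have h1 := le_trans (HC n%:R) (ler_wpM2l (ltW C0) h).
    have := le_trans (HC (- n%:R)); rewrite sqrrN => /(_ _ (ler_wpM2l (ltW C0) h)) h2.
    by rewrite ler_norml; have := hG0 s n%:R; have := hG0 s (- n%:R); lra.
  have h0 : (fun n => C * harmonic n) @ \oo --> (0 : R).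
    by rewrite -[X in _ --> X](mulr0 C); apply: cvgMr; exact: cvg_harmonic.
  apply: norm_cvg0; apply: (squeeze_cvgr _ (cvg_cst 0) h0).
  by apply: nearW => n; rewrite normr_ge0 b.
have {}L0 : (fun n => (hG s n%:R - hG s (- n%:R))%:E) @ \oo --> (0 : R)%:E.
  by apply/fine_cvgP; split => //; exact: nearW.
move: L; rewrite L2 => L.
have LE : [sequence (\int[lebR]_u fn n u)%E]_n = (fun n => (hG s n%:R - hG s (- n%:R))%:E).
  by apply/funext => n; exact: Fn.
rewrite LE in L.
have : (s * Gamma s - Gamma (s + 1))%:E = 0%:E :> \bar R.
  transitivity (limn (fun n => (hG s n%:R - hG s (- n%:R))%:E)).
    by apply/esym; exact: (cvg_lim (@ereal_hausdorff R) L).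
  exact: (cvg_lim (@ereal_hausdorff R) L0).
by case=> /eqP; rewrite subr_eq0 => /eqP ->.
Qed.

(* substitution [v = t x^2] *)
Lemma gauss_moment (p t : R) : -1 < p -> 0 < t ->
  (\int[lebR]_x (if (0 < x)%R then (x `^ p * expR (- (t * x ^+ 2)))%:E else 0) =
  (2^-1 * t `^ (- ((p + 1) / 2)) * Gamma ((p + 1) / 2))%:E)%E.
Proof.
move=> p1 t0.
have s0 : 0 < (p + 1) / 2 by rewrite divr_gt0// -ltrBlDr sub0r.
rewrite EFinM -Gamma_gammaE// gammaE_expR.
rewrite lebesgue_expR; last by meas.
rewrite (@lebesgue_affine _ 2 (ln t) (fun u => (hG _ u)%:E)%E)//; last exact/measurable_EFinP.
rewrite -ge0_integralZl_EFin//; last 3 first.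
- by move=> u _; rewrite mule_ge0// lee_fin// mulr_ge0 ?expR_ge0.
- by rewrite /hG; meas.
- by rewrite mulr_ge0 ?invr_ge0 ?powR_ge0.
apply: eq_integral => u _; rewrite -!EFinM /hG; congr EFin.
have -> : t `^ (- ((p + 1) / 2)) = expR (- ((p + 1) / 2) * ln t).
  by rewrite -[in LHS](lnK t0) -expRM mulrC.
rewrite -expRM.
have -> : t * expR u ^+ 2 = expR (2 * u + ln t).
  by rewrite expRD lnK ?posrE// expRM_natl mulrC.
set E := expR (- expR _); set X := expR (- _ * _); set Y := expR (_ * (_ + _)).
rewrite (_ : 2^-1 * X * _ = X * Y * E); last by field.
by rewrite mulrA; congr (_ * E); rewrite /X /Y -!expRD; congr expR; field.
Qed.

End gamma.

Section half_plane.
Local Open Scope ereal_scope.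
Context {R : realType}.

(** Polar coordinates obtained from one-variable substitutions and Tonelli only: [Y = x * sin th] at
    fixed angle, then [c = - cot th] through a shift by [pi / 2] and the tangent, then
    [X = - (Y * c)] at fixed [Y]. *)
Lemma half_plane_polar (G : R * R -> \bar R) :
  measurable_fun setT G -> (forall p, 0 <= G p) ->
  \int[lebR]_x \int[lebR]_th (if ((0 < x) && (0 < th < pi))%R then
     x%:E * G (x * cos th, x * sin th)%R else 0) =
  \int[lebR]_X \int[lebR]_Y (if (0 < Y)%R then G (X, Y) else 0).
Proof.
move=> mG G0.
pose G3 (x th : R) := if ((0 < x) && (0 < th < pi))%R then
     x%:E * G (x * cos th, x * sin th)%R else 0.
have -> : \int[lebR]_x \int[lebR]_th G3 x th = \int[lebR]_th \int[lebR]_x G3 x th.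
  apply: tonelli; first by rewrite /G3; meas.
  by move=> x y; rewrite /G3; case: ifP => // /andP[x0 _]; rewrite mule_ge0// lee_fin ltW.
pose G1 (th Y : R) := if (0 < Y)%R then (Y * (sin th) ^- 2)%:E * G (Y * cos th / sin th, Y)%R else 0.
transitivity (\int[lebR]_th \int[lebR]_Y (if (0 < th < pi)%R then G1 th Y else 0)).
  apply: eq_integral => th _; rewrite ?/G3.
  have [thI|thI] := boolP (0 < th < pi)%R; last first.
    by apply: eq_integral => x _; rewrite andbF.
  have s0 : (0 < sin th)%R by exact: sin_gt0_pi.
  rewrite (@lebesgue_affine _ (sin th)^-1 0%R) ?invr_gt0//; last by meas.
  apply: eq_integral => Y _; rewrite /G1 addr0 andbT pmulr_rgt0 ?invr_gt0//.
  case: ifP => Y0; last by rewrite mule0.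
  rewrite muleA -EFinM; congr (_%:E * G (_, _)); last by rewrite mulrAC mulVf ?mul1r ?gt_eqF.
    by field; rewrite gt_eqF.
  by rewrite -mulrA mulrC.
pose G2 (c Y : R) := if (0 < Y)%R then Y%:E * G (- (Y * c), Y)%R else 0.
have mG2 : measurable_fun setT (fun p : R * R => G2 p.1 p.2) by rewrite /G2; meas.
have G20 c Y : 0 <= G2 c Y.
  by rewrite /G2; case: ifP => // Y0; rewrite mule_ge0// lee_fin ltW.
transitivity (\int[lebR]_c \int[lebR]_Y G2 c Y).
  rewrite (@lebesgue_shift _ (pi / 2)); last first.
    apply: (@measurable_tonelli _ _ R R R lebR (fun th Y => if (0 < th < pi)%R then G1 th Y else 0)).
      by rewrite /G1; meas.
    move=> th Y; rewrite /G1; case: ifP => // _; case: ifP => // Y0.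
    by rewrite mule_ge0// lee_fin mulr_ge0 ?(ltW Y0)// invr_ge0 sqr_ge0.
  rewrite [RHS]lebesgue_tan; last exact: measurable_tonelli.
  apply: eq_integral => th _; rewrite ?/G3.
  have -> : (0 < th + pi / 2 < pi)%R = (- (pi / 2) < th < pi / 2)%R.
    by apply/idP/idP => /andP[h1 h2]; apply/andP; split; lra.
  case: ifPn => thI; last by rewrite integral0.
  have c0 : (0 < cos th)%R by exact: cos_gt0_pihalf.
  rewrite -ge0_integralZl_EFin//; last 2 first.
  - exact: (measurableT_comp mG2 (measurable_pair1 (tan th))).
  - by rewrite invr_ge0 sqr_ge0.
  apply: eq_integral => Y _; rewrite /G1 /G2; case: ifP => Y0; last by rewrite mule0.
  rewrite sinDpihalf cosDpihalf muleA -EFinM; congr (_%:E * G (_, _)).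
    by rewrite mulrC.
  by rewrite /tan mulrN mulNr mulrA.
have -> : \int[lebR]_c \int[lebR]_Y G2 c Y = \int[lebR]_Y \int[lebR]_c G2 c Y by exact: tonelli.
pose G4 (X Y : R) := if (0 < Y)%R then G (X, Y) else 0.
have -> : \int[lebR]_X \int[lebR]_Y G4 X Y = \int[lebR]_Y \int[lebR]_X G4 X Y.
  by apply: tonelli; [rewrite /G4; meas|move=> X Y; rewrite /G4; case: ifP].
rewrite /G4.
apply: eq_integral => Y _; rewrite /G2; have [Y0|_] := ltP 0%R Y; last by rewrite !integral0.
rewrite [RHS]lebesgue_reflect; last by meas.
rewrite [RHS](@lebesgue_affine _ Y 0%R)//; last by meas.
by apply: eq_integral => c _; rewrite addr0.
Qed.

Lemma integral_even (f : R -> R) : measurable_fun setT f ->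
  (forall x, 0 <= f x)%R -> (forall x, f (- x) = f x)%R ->
  \int[lebR]_x (f x)%:E = 2%:E * \int[lebR]_x (if (0 < x)%R then (f x)%:E else 0).
Proof.
move=> mf f0 fN.
pose h (x : R) := if (0 < x)%R then (f x)%:E else 0.
have mh : measurable_fun setT h by rewrite /h; meas.
have h0 x : 0 <= h x by rewrite /h; case: ifP => // _; rewrite lee_fin.
have -> : 2%:E = 1 + 1 :> \bar R by rewrite -EFinD.
rewrite ge0_muleDl// mul1e [X in X + _]lebesgue_reflect//.
rewrite -ge0_integralD//; try (by apply: (measurableT_comp mh); meas); try (by move=> x _; case: ifP => // _; rewrite lee_fin).
apply: ae_eq_integral => //.
- exact/measurable_EFinP.
- by apply: emeasurable_funD => //; apply: (measurableT_comp mh); meas.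
exists [set 0%R]; split; first exact: measurable_set1.
  have := @lebesgue_measure_set1 R 0%R; apply.
move=> x /= /not_implyP[_ H] ; apply: contrapT => /eqP x0; apply: H.
rewrite /h oppr_gt0 fN; have [//|_|x00] := ltgtP x 0%R; rewrite ?adde0 ?add0e//.
by rewrite x00 eqxx in x0.
Qed.

(** Euler's argument for the Beta integral: [X^(2 n) Y^(2 al)] times a Gaussian is integrated over
    the half plane both in polar and in Cartesian coordinates, and the radial Gamma factor is
    divided out. *)
Lemma beta_moment (al : R) (n : nat) : (- 2^-1 < al)%R ->
  \int[lebR]_th (if (0 < th < pi)%R then ((cos th) ^+ (2 * n) * (sin th) `^ (2 * al))%:E else 0) =
  (Gamma (n%:R + 2^-1) * Gamma (al + 2^-1) / Gamma (n%:R + al + 1))%:E.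
Proof.
move=> al0.
pose g (p : R * R) := (p.1 ^+ (2 * n) * p.2 `^ (2 * al) * expR (- (p.1 ^+ 2 + p.2 ^+ 2)))%R.
have mg : measurable_fun setT (EFin \o g) by rewrite /g; meas.
have g0 p : (0 <= g p)%R.
  by rewrite /g !mulr_ge0 ?expR_ge0 ?powR_ge0// exprM exprn_ge0// sqr_ge0.
have := @half_plane_polar (EFin \o g) mg (fun p => g0 p).
pose fx (x : R) := (if 0 < x then x `^ (2 * n%:R + 2 * al + 1) * expR (- (1 * x ^+ 2)) else 0)%R.
pose ft (th : R) := (if 0 < th < pi then (cos th) ^+ (2 * n) * (sin th) `^ (2 * al) else 0)%R.
have mfx : measurable_fun setT fx by rewrite /fx; meas.
have mft : measurable_fun setT ft by rewrite /ft; meas.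
have fx0 x : (0 <= fx x)%R.
  by rewrite /fx; case: ifP => // _; rewrite mulr_ge0 ?powR_ge0 ?expR_ge0.
have ft0 x : (0 <= ft x)%R.
  by rewrite /ft; case: ifP => // _; rewrite mulr_ge0 ?powR_ge0// exprM exprn_ge0 ?sqr_ge0.
pose gx (x : R) := (x ^+ (2 * n) * expR (- x ^+ 2))%R.
pose gy (y : R) := (if 0 < y then y `^ (2 * al) * expR (- (1 * y ^+ 2)) else 0)%R.
have mgx : measurable_fun setT gx by rewrite /gx; meas.
have mgy : measurable_fun setT gy by rewrite /gy; meas.
have gx0 x : (0 <= gx x)%R.
  by rewrite /gx mulr_ge0 ?expR_ge0// exprM exprn_ge0 ?sqr_ge0.
have gy0 x : (0 <= gy x)%R.
  by rewrite /gy; case: ifP => // _; rewrite mulr_ge0 ?powR_ge0 ?expR_ge0.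
have -> : \int[lebR]_x \int[lebR]_th (if ((0 < x) && (0 < th < pi))%R then
     x%:E * (EFin \o g) (x * cos th, x * sin th)%R else 0) =
     \int[lebR]_x \int[lebR]_th (fx x * ft th)%:E.
  apply: eq_integral => x _; apply: eq_integral => th _; rewrite /fx /ft.
  have [x0|_] := ltP 0%R x; last by rewrite mul0r.
  have [thI|_] := boolP (0 < th < pi)%R; last by rewrite mulr0.
  rewrite /= -EFinM /g/= mul1r; congr EFin.
  rewrite (_ : (x * cos th) ^+ 2 + (x * sin th) ^+ 2 = x ^+ 2)%R; last first.
    by rewrite !exprMn -mulrDr cos2Dsin2 mulr1.
  rewrite powRM ?(ltW x0)//; last by apply/ltW/sin_gt0_pi.
  rewrite exprMn addrAC -addrA powRD; last by rewrite (gt_eqF x0) implybT.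
  rewrite powRD; last by rewrite (gt_eqF x0) implybT.
  rewrite powRr1 ?(ltW x0)// (_ : 2 * n%:R = (2 * n)%:R)%R ?powR_mulrn ?(ltW x0)// ?natrM//.
  by ring.
have -> : \int[lebR]_X \int[lebR]_Y (if (0 < Y)%R then (EFin \o g) (X, Y) else 0) =
    \int[lebR]_X \int[lebR]_Y (gx X * gy Y)%:E.
  apply: eq_integral => x _; apply: eq_integral => y _; rewrite /gx /gy.
  have [y0|_] := ltP 0%R y; last by rewrite mulr0.
  by rewrite /= /g/= opprD expRD mul1r; congr EFin; ring.
rewrite !ge0_integral_sep//.
have Efx : \int[lebR]_x (fx x)%:E = (2^-1 * Gamma (n%:R + al + 1))%:E.
  have p1 : (-1 < 2 * n%:R + 2 * al + 1)%R by have := ler0n R n; lra.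
  have := gauss_moment p1 ltr01; rewrite powR1 mulr1.
  rewrite (_ : (2 * n%:R + 2 * al + 1 + 1) / 2 = n%:R + al + 1)%R; last by field.
  by move=> <-; apply: eq_integral => x _; rewrite /fx; case: ifP.
have Egy : \int[lebR]_x (gy x)%:E = (2^-1 * Gamma (al + 2^-1))%:E.
  have p1 : (-1 < 2 * al)%R by lra.
  have := gauss_moment p1 ltr01; rewrite powR1 mulr1.
  rewrite (_ : (2 * al + 1) / 2 = al + 2^-1)%R; last by field.
  by move=> <-; apply: eq_integral => x _; rewrite /gy; case: ifP.
have Egx : \int[lebR]_x (gx x)%:E = (Gamma (n%:R + 2^-1))%:E.
  have p1 : (-1 < 2 * n%:R :> R)%R by have := ler0n R n; lra.
  have := gauss_moment p1 ltr01; rewrite powR1 mulr1.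
  rewrite (_ : (2 * n%:R + 1) / 2 = n%:R + 2^-1)%R; last by field.
  move=> E; rewrite integral_even//; last by move=> x; rewrite /gx sqrrN exprM sqrrN -exprM.
  transitivity (2%:E * (2^-1 * Gamma (n%:R + 2^-1) : R)%:E); last first.
    by move: (Gamma _) => A; rewrite -EFinM mulrA divff// mul1r.
  congr (_ * _); rewrite -E; apply: eq_integral => x _.
  case: ifPn => // x0; rewrite /gx mul1r (_ : 2 * n%:R = (2 * n)%:R)%R ?powR_mulrn ?(ltW x0)// natrM//.
rewrite Efx Egx Egy.
have G0 : (0 < Gamma (n%:R + al + 1))%R by apply: Gamma_gt0; have := ler0n R n; lra.
have -> : \int[lebR]_th (if (0 < th < pi)%R then ((cos th) ^+ (2 * n) * (sin th) `^ (2 * al))%:E else 0)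
   = \int[lebR]_th (ft th)%:E.
  by apply: eq_integral => x _; rewrite /ft; case: ifP.
move: G0; move: (Gamma (n%:R + al + 1)) (Gamma (n%:R + 2^-1)) (Gamma (al + 2^-1)) => A B C A0 E.
have : ((2 / A)%:E * ((2^-1 * A)%:E * \int[lebR]_y (ft y)%:E))%E =
   ((2 / A)%:E * (B%:E * (2^-1 * C)%:E))%E by rewrite E.
rewrite muleA -EFinM (_ : 2 / _ * _ = 1)%R; last by field; rewrite gt_eqF.
by rewrite mul1e => ->; rewrite -!EFinM; congr EFin; field; rewrite gt_eqF.
Qed.

End half_plane.

(** * Hankel translation and its exchange formula *)

Section measures.
Context {R : realType}.
Implicit Types al x y u th : R.

Definition dmu al x : R := if 0 < x then wmu al x else 0.

Lemma measurable_dmu al : measurable_fun [set: R] (dmu al).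
Proof. by rewrite /dmu /wmu; meas. Qed.

(* [hmu al] is mu_alpha and [hsig al] the probability measure on angles that
   defines the Hankel translation; both are measures on the whole of [R]. *)
Definition hmu al := mdens (measurable_dmu al).

Definition csig al : R := Gamma (al + 1) / (Gamma (2^-1) * Gamma (al + 2^-1)).

Definition dsig al th : R :=
  if 0 < th < pi then csig al * (sin th) `^ (2 * al) else 0.

Lemma measurable_dsig al : measurable_fun [set: R] (dsig al).
Proof. by rewrite /dsig; meas. Qed.

Definition hsig al := mdens (measurable_dsig al).

(* the radius of the point of the half plane with polar coordinates (y, th)
   translated by x along the axis *)
Definition rr x y th : R := Num.sqrt (x ^+ 2 + y ^+ 2 + 2 * x * y * cos th).

Lemma measurable_fun_rr d (T : measurableType d) (f g h : T -> R) :
  measurable_fun setT f -> measurable_fun setT g -> measurable_fun setT h ->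
  measurable_fun setT (fun p => rr (f p) (g p) (h p)).
Proof. by move=> mf mg mh; rewrite /rr; meas. Qed.

Lemma rr_ge0 x y th : 0 <= rr x y th.
Proof. exact: sqrtr_ge0. Qed.

Lemma rrC x y th : rr x y th = rr y x th.
Proof. by rewrite /rr; congr Num.sqrt; ring. Qed.

Lemma rr_sqr x y th : rr x y th ^+ 2 = x ^+ 2 + y ^+ 2 + 2 * x * y * cos th.
Proof.
rewrite /rr sqr_sqrtr//.
have := cos2Dsin2 th => h.
rewrite (_ : _ + _ = (x + y * cos th) ^+ 2 + (y * sin th) ^+ 2); last first.
  by rewrite exprMn (_ : sin th ^+ 2 = 1 - cos th ^+ 2)%R; [ring|rewrite -h addrC addKr].
by rewrite addr_ge0 ?sqr_ge0.
Qed.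

Variable al : R.
Hypothesis al_gt : - 2^-1 < al.

Lemma al1_gt0 : 0 < al + 1.
Proof. by have := al_gt; lra. Qed.

Lemma Gamma_al1_gt0 : 0 < Gamma (al + 1).
Proof. exact/Gamma_gt0/al1_gt0. Qed.

Lemma wmu_ge0 x : 0 <= wmu al x.
Proof.
by rewrite divr_ge0 ?powR_ge0// mulr_ge0 ?powR_ge0// ltW// Gamma_al1_gt0.
Qed.

Lemma dmu_ge0 x : 0 <= dmu al x.
Proof. by rewrite /dmu; case: ifP => // _; exact: wmu_ge0. Qed.

Lemma csig_gt0 : 0 < csig al.
Proof.
rewrite divr_gt0// ?Gamma_al1_gt0// mulr_gt0// Gamma_gt0//.
by have := al_gt; lra.
Qed.

Lemma dsig_ge0 th : 0 <= dsig al th.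
Proof.
rewrite /dsig; case: ifP => // _.
by rewrite mulr_ge0 ?powR_ge0// ltW// csig_gt0.
Qed.

Local Open Scope ereal_scope.

Lemma integral_hmu (f : R -> \bar R) : measurable_fun setT f ->
  \int[hmu al]_x f x = \int[lebR]_x ((dmu al x)%:E * f x).
Proof.
move=> mf; rewrite integral_mdens//.
by apply: eq_integral => x _; rewrite ger0_norm// dmu_ge0.
Qed.

Lemma integral_hsig (f : R -> \bar R) : measurable_fun setT f ->
  \int[hsig al]_x f x = \int[lebR]_x ((dsig al x)%:E * f x).
Proof.
move=> mf; rewrite integral_mdens//.
by apply: eq_integral => x _; rewrite ger0_norm// dsig_ge0.
Qed.

(** In Cartesian coordinates the product of [hmu] and [hsig] is the measure with density
    [kap * Y^(2 al)] on the upper half plane. *)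
Definition kap : R := (csig al / (2 `^ al * Gamma (al + 1)))%R.

Lemma cartesian (F : R -> R -> \bar R) (K : R * R -> \bar R) :
  measurable_fun setT (fun p : R * R => F p.1 p.2) -> (forall x th, 0 <= F x th) ->
  measurable_fun setT K -> (forall p, 0 <= K p) ->
  (forall x th, (0 < x)%R -> (0 < th < pi)%R -> F x th = K (x * cos th, x * sin th)%R) ->
  \int[hmu al]_x \int[hsig al]_th F x th =
  \int[lebR]_X \int[lebR]_Y (if (0 < Y)%R then (kap * Y `^ (2 * al))%:E * K (X, Y) else 0).
Proof.
move=> mF F0 mK K0 FK.
have kap0 : (0 <= kap)%R.
  rewrite divr_ge0 ?(ltW csig_gt0)// mulr_ge0 ?powR_ge0//.
  by rewrite ltW// Gamma_al1_gt0.
have mFx x : measurable_fun setT (F x).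
  exact: (measurableT_comp mF (measurable_pair1 x)).
have mds := measurable_dsig al. have mdm := measurable_dmu al.
pose G (p : R * R) := (kap * p.2 `^ (2 * al))%:E * K p.
have mG : measurable_fun setT G by rewrite /G; meas.
have G0 p : 0 <= G p by rewrite mule_ge0// lee_fin mulr_ge0 ?powR_ge0.
rewrite -(half_plane_polar mG G0).
rewrite integral_hmu; last exact: measurable_tonelli.
apply: eq_integral => x _.
rewrite integral_hsig// -ge0_integralZl_EFin ?dmu_ge0//; last 2 first.
- by move=> th _; rewrite mule_ge0// lee_fin dsig_ge0.
- by meas.
apply: eq_integral => th _; rewrite /dmu /dsig.
have [x0|_] := ltP 0%R x; last by rewrite mul0e.
have [thI|_] := boolP (0 < th < pi)%R; last by rewrite mul0e mule0.
have s0 : (0 < sin th)%R by exact: sin_gt0_pi.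
rewrite FK// /G/= !muleA -!EFinM; congr (_%:E * _).
rewrite /wmu /kap powRM ?(ltW x0) ?(ltW s0)// powRD; last by rewrite (gt_eqF x0) implybT.
rewrite powRr1 ?(ltW x0)//; field.
by rewrite gt_eqF ?Gamma_al1_gt0// gt_eqF// powR_gt0.
Qed.

(** In Cartesian coordinates [x] and [rr u x th] are the distances from [(X, Y)] to the origin and
    to [(-u, 0)]. The reflection sending [X] to [- X - u] swaps the two points and preserves the
    measure, whose density depends on [Y] only. Invariance of mass under translation and the
    transform of a translate both come from this symmetry. *)
Lemma translation_exchange (K : R * R -> \bar R) u :
  measurable_fun setT K -> (forall p, 0 <= K p) ->
  \int[hmu al]_x \int[hsig al]_th K (x, rr u x th) =
  \int[hmu al]_x \int[hsig al]_th K (rr u x th, x).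
Proof.
move=> mK K0.
pose n1 (p : R * R) := Num.sqrt (p.1 ^+ 2 + p.2 ^+ 2).
pose n2 (p : R * R) := Num.sqrt ((p.1 + u) ^+ 2 + p.2 ^+ 2).
have mn1 : measurable_fun setT n1 by rewrite /n1; meas.
have mn2 : measurable_fun setT n2 by rewrite /n2; meas.
have E1 x th : (0 < x)%R -> n1 (x * cos th, x * sin th)%R = x.
  move=> x0; rewrite /n1/= !exprMn -mulrDr cos2Dsin2 mulr1 sqrtr_sqr ger0_norm//.
  exact: ltW.
have E2 x th : n2 (x * cos th, x * sin th)%R = rr u x th.
  rewrite /n2/= /rr; congr Num.sqrt.
  by rewrite exprMn (_ : sin th ^+ 2 = 1 - cos th ^+ 2)%R; [ring|rewrite -(cos2Dsin2 th) addrC addKr].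
have mrr : measurable_fun setT (fun p : R * R => rr u p.1 p.2).
  by apply: measurable_fun_rr; meas.
have -> : \int[hmu al]_x \int[hsig al]_th K (x, rr u x th) =
    \int[lebR]_X \int[lebR]_Y (if (0 < Y)%R then (kap * Y `^ (2 * al))%:E * K (n1 (X, Y), n2 (X, Y)) else 0).
  apply: (@cartesian (fun x th => K (x, rr u x th)) (fun p => K (n1 p, n2 p))) => //.
  - by meas.
  - by meas.
  - by move=> x th x0 _; rewrite E1// E2.
have -> : \int[hmu al]_x \int[hsig al]_th K (rr u x th, x) =
    \int[lebR]_X \int[lebR]_Y (if (0 < Y)%R then (kap * Y `^ (2 * al))%:E * K (n2 (X, Y), n1 (X, Y)) else 0).
  apply: (@cartesian (fun x th => K (rr u x th, x)) (fun p => K (n2 p, n1 p))) => //.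
  - by meas.
  - by meas.
  - by move=> x th x0 _; rewrite E1// E2.
pose H (X : R) := \int[lebR]_Y (if (0 < Y)%R then (kap * Y `^ (2 * al))%:E * K (n1 (X, Y), n2 (X, Y)) else 0).
have kap0 : (0 <= kap)%R.
  rewrite divr_ge0 ?(ltW csig_gt0)// mulr_ge0 ?powR_ge0//.
  by rewrite ltW// Gamma_al1_gt0.
have mH : measurable_fun setT H.
  apply: (@measurable_tonelli _ _ R R R lebR (fun X Y => if (0 < Y)%R then
     (kap * Y `^ (2 * al))%:E * K (n1 (X, Y), n2 (X, Y)) else 0)).
    by meas.
  by move=> X Y; case: ifP => // _; rewrite mule_ge0// lee_fin mulr_ge0 ?powR_ge0.
have mHN : measurable_fun setT (fun X : R => H (- X)%R).
  by apply: (measurableT_comp mH); meas.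
rewrite -[LHS]/(\int[lebR]_X H X) (lebesgue_reflect mH) (lebesgue_shift u mHN).
apply: eq_integral => X _; apply: eq_integral => Y _.
case: ifP => // Y0; congr (_ * K (_, _)); rewrite /n1 /n2/=; congr Num.sqrt; ring.
Qed.

Lemma cos_moment n :
  \int[hsig al]_th ((cos th) ^+ (2 * n))%:E =
  (Gamma (al + 1) * Gamma (n%:R + 2^-1) / (Gamma (2^-1) * Gamma (n%:R + al + 1)))%:E.
Proof.
rewrite integral_hsig; last by meas.
transitivity ((csig al)%:E * \int[lebR]_th (if (0 < th < pi)%R then ((cos th) ^+ (2 * n) * (sin th) `^ (2 * al))%:E else 0)).
  rewrite -ge0_integralZl_EFin ?(ltW csig_gt0)//; last 2 first.
  - by move=> th _; case: ifP => // _; rewrite lee_fin mulr_ge0 ?powR_ge0// exprM exprn_ge0// sqr_ge0.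
  - by meas.
  apply: eq_integral => th _; rewrite /dsig; case: ifP => _; last by rewrite mul0e mule0.
  by rewrite -!EFinM -mulrA [X in (_ * X)%R]mulrC.
rewrite beta_moment// -EFinM /csig; congr EFin.
have h1 : (Gamma (2^-1 : R) != 0)%R by rewrite gt_eqF// Gamma_gt0.
have h2 : (Gamma (al + 2^-1) != 0)%R by rewrite gt_eqF// Gamma_gt0//; have := al_gt; lra.
have h3 : (Gamma (n%:R + al + 1) != 0)%R.
  by rewrite gt_eqF// Gamma_gt0//; have := al_gt; have := ler0n R n; lra.
move: h1 h2 h3; move: (Gamma (n%:R + al + 1)) (Gamma (n%:R + 2^-1)) (Gamma (al + 2^-1))
  (Gamma (2^-1)) (Gamma (al + 1)) => A B C D E *.
by field; apply/and3P.
Qed.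

Lemma hsig_setT : hsig al setT = 1.
Proof.
have := cos_moment 0; rewrite muln0.
under eq_integral do rewrite expr0.
rewrite integral_cst// mul1e => E; apply: (etrans E).
rewrite !add0r [X in (X / _)%R]mulrC divff//.
by rewrite mulf_neq0 ?gt_eqF ?Gamma_gt0// ?al1_gt0.
Qed.

Lemma integrable_hsig (f : R -> R) M : measurable_fun setT f ->
  (forall x, `|f x| <= M)%R -> (hsig al).-integrable setT (EFin \o f).
Proof.
move=> mf fM; apply/integrableP; split; first exact/measurable_EFinP.
apply: (@le_lt_trans _ _ (\int[hsig al]_x M%:E)).
  apply: ge0_le_integral => //.
  - by apply: measurableT_comp => //; exact/measurable_EFinP.
  - by move=> x _; rewrite lee_fin.
rewrite integral_cst//; change (M%:E * hsig al setT < +oo).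
by rewrite hsig_setT mule1 ltry.
Qed.

(** Replacing [th] by [pi - th] preserves [hsig] and changes the sign of the cosine, so the finite
    integral equals its opposite. *)
Lemma cos_moment_odd n : \int[hsig al]_th ((cos th) ^+ n.*2.+1)%:E = 0.
Proof.
have i1 : (hsig al).-integrable setT (EFin \o (fun th => cos th ^+ n.*2.+1)%R).
  apply: (@integrable_hsig _ 1%R); first by meas.
  by move=> x; rewrite normrX exprn_ile1// ler_norml cos_geN1 cos_le1.
set I := \int[_]_th _.
have Ifin : I \is a fin_num by exact: integrable_fin_num i1.
suff : I = - I.
  by rewrite -(fineK Ifin) => -[] h; congr EFin; lra.
rewrite {2}/I -integralN; last exact: integrable_add_def.
rewrite [RHS](eq_integral (fun th => (- cos th ^+ n.*2.+1)%:E))//.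
rewrite /I integral_hsig; last by meas.
rewrite integral_hsig; last by meas.
set f := fun th : R => _.
have mf : measurable_fun setT f.
  by rewrite /f; have mds := measurable_dsig al; meas.
(* Reflection followed by a shift by [- pi] is the substitution of [pi - th] for [th]. *)
rewrite lebesgue_reflect// (@lebesgue_shift _ (- pi)%R); last first.
  by apply: (measurableT_comp mf); meas.
apply: eq_integral => th _.
rewrite /f /dsig opprD opprK addrC.
rewrite (_ : (0 < pi - th < pi)%R = (0 < th < pi)%R); last by apply/idP/idP => /andP[a b]; apply/andP; split; lra.
case: ifP => _; last by rewrite !mul0e.
have -> : sin (pi - th)%R = sin th by rewrite sinB sinpi cospi mul0r mulN1r sub0r opprK.
have -> : cos (pi - th)%R = (- cos th)%R by rewrite cosB cospi sinpi mulN1r mul0r addr0.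
by rewrite exprNn -signr_odd /= odd_double/= expr1 mulN1r.
Qed.

End measures.

(** * Dominated convergence and Fubini for real-valued integrals *)

Section Rintegral_tools.
Context {R : realType}.

Lemma Rint_dct d (T : measurableType d) (mu : {measure set T -> \bar R})
    (fn : nat -> T -> R) (f g : T -> R) :
  (forall n, measurable_fun setT (fn n)) ->
  (forall x, fn^~ x @ \oo --> f x) ->
  mu.-integrable setT (EFin \o g) -> (forall n x, `|fn n x| <= g x) ->
  mu.-integrable setT (EFin \o f) /\
  (fun n => \int[mu]_x fn n x) @ \oo --> \int[mu]_x f x.
Proof.
move=> mfn fnf ig fg.
have mf : measurable_fun setT f.
  by apply: (measurable_fun_cvg mfn) => x _; exact: fnf.
have [If _ L] : [/\ mu.-integrable setT (EFin \o f),
   [sequence (\int[mu]_u `|(EFin \o fn n) u - (EFin \o f) u|)%E]_n @ \oo --> 0%E &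
   [sequence (\int[mu]_u (EFin \o fn n) u)%E]_n @ \oo --> (\int[mu]_u (EFin \o f) u)%E].
  apply: (@dominated_convergence _ _ _ mu setT measurableT (fun n => EFin \o fn n) (EFin \o f) _ _ _ _ ig).
  - by move=> n; exact/measurable_EFinP.
  - exact/measurable_EFinP.
  - apply: aeW => x _; apply: cvg_EFin; first exact: nearW.
    exact: fnf.
  - by apply: aeW => x n _; rewrite lee_fin.
split => //; rewrite /Rintegral; apply: fine_cvg; rewrite fineK//.
exact: integrable_fin_num.
Qed.

Context d1 d2 (T1 : measurableType d1) (T2 : measurableType d2).
Variables (m1 : {sigma_finite_measure set T1 -> \bar R})
  (m2 : {sigma_finite_measure set T2 -> \bar R}).

(** Both halves of the extended integral are measurable by Tonelli, and so is [fine]; sections whose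
    integral is infinite or undefined simply receive its default value. *)
Lemma measurable_Rint (f : T1 -> T2 -> R) :
  measurable_fun setT (fun p => f p.1 p.2) ->
  measurable_fun setT (fun x => \int[m2]_y f x y).
Proof.
move=> mf; rewrite /Rintegral; apply: measurableT_comp => //.
have mF : measurable_fun setT (fun p => (f p.1 p.2)%:E) by exact/measurable_EFinP.
rewrite (_ : (fun x => _) = (fun x => \int[m2]_y (fun p => (f p.1 p.2)%:E)^\+ (x, y) -
   \int[m2]_y (fun p => (f p.1 p.2)%:E)^\- (x, y))%E); last first.
  apply/funext => x; rewrite integralE; congr (_ - _)%E; apply: eq_integral => y _.
    by rewrite !funeposE.
  by rewrite !funenegE.
apply: emeasurable_funB.
- apply: (measurable_tonelli m2 (f := fun x y => (fun p => (f p.1 p.2)%:E)^\+%E (x, y))) => //.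
  by apply: (measurableT_comp (measurable_funepos mF)); meas.
- apply: (measurable_tonelli m2 (f := fun x y => (fun p => (f p.1 p.2)%:E)^\-%E (x, y))) => //.
  by apply: (measurableT_comp (measurable_funeneg mF)); meas.
Qed.

Lemma ae_eq_Rint (f g : T1 -> R) : measurable_fun setT f -> measurable_fun setT g ->
  {ae m1, forall x, f x = g x} -> \int[m1]_x f x = \int[m1]_x g x.
Proof.
move=> mf mg fg; congr fine; apply: ae_eq_integral => //; try exact/measurable_EFinP.
by apply: filterS fg => x -> _.
Qed.

Lemma Rint_fubini12 (f : T1 -> T2 -> R) :
  (m1 \x m2)%E.-integrable setT (fun p => (f p.1 p.2)%:E) ->
  \int[m1]_x \int[m2]_y f x y = fine (\int[(m1 \x m2)%E]_p (f p.1 p.2)%:E)%E.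
Proof.
move=> iF; rewrite -(integral12_prod_meas1 iF); congr fine.
have mF := measurable_int _ iF.
have mf : measurable_fun setT (fun p => f p.1 p.2) by exact/measurable_EFinP.
apply: ae_eq_integral => //.
- by apply/measurable_EFinP; exact: measurable_Rint.
- exact: (@measurable_fubini_F _ _ _ _ _ m1 m2 _ iF).
apply: filterS (ae_integrable1 iF) => x ix _ /=.
by rewrite /fubini_F/= /Rintegral fineK//; exact: integrable_fin_num.
Qed.

End Rintegral_tools.

Section Rintegral_tools2.
Context {R : realType} d1 d2 (T1 : measurableType d1) (T2 : measurableType d2).
Variables (m1 : {sigma_finite_measure set T1 -> \bar R})
  (m2 : {sigma_finite_measure set T2 -> \bar R}).

Lemma integrable_swap (f : T1 -> T2 -> R) :
  (m1 \x m2)%E.-integrable setT (fun p => (f p.1 p.2)%:E) ->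
  (m2 \x m1)%E.-integrable setT (fun p => (f p.2 p.1)%:E).
Proof.
move=> iF.
have mF := measurable_int _ iF.
have mF' : measurable_fun setT (fun p : T2 * T1 => (f p.2 p.1)%:E).
  apply: (measurableT_comp (f := fun p : T1 * T2 => (f p.1 p.2)%:E) (g := fun p : T2 * T1 => (p.2, p.1))) => //.
  exact: measurable_fun_pair.
apply/(integrable12ltyP m2 m1 mF') => /=.
exact: (proj1 (integrable21ltyP m1 m2 mF) iF).
Qed.

Lemma Rint_fubini (f : T1 -> T2 -> R) :
  (m1 \x m2)%E.-integrable setT (fun p => (f p.1 p.2)%:E) ->
  \int[m1]_x \int[m2]_y f x y = \int[m2]_y \int[m1]_x f x y.
Proof.
move=> iF; rewrite Rint_fubini12// (Rint_fubini12 (f := fun x y => f y x) (integrable_swap iF)); congr fine.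
have mF := measurable_int _ iF.
have iF' := integrable_swap iF.
rewrite -(integral12_prod_meas1 iF) -(integral21_prod_meas1 iF').
by [].
Qed.

Lemma integrable_prod_bounded (F : T1 -> R) (G : T2 -> R) (k : T1 -> T2 -> R) B :
  m1.-integrable setT (EFin \o F) -> m2.-integrable setT (EFin \o G) ->
  measurable_fun setT (fun p => k p.1 p.2) -> (forall x y, `|k x y| <= B) ->
  (m1 \x m2)%E.-integrable setT (fun p => (F p.1 * (G p.2 * k p.1 p.2))%:E).
Proof.
move=> iF iG mk kB.
have mF : measurable_fun setT F by apply/measurable_EFinP; exact: measurable_int _ iF.
have mG : measurable_fun setT G by apply/measurable_EFinP; exact: measurable_int _ iG.
have mf : measurable_fun setT (fun p : T1 * T2 => (F p.1 * (G p.2 * k p.1 p.2))%:E).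
  by meas.
have B0 : 0 <= `|B| by [].
apply/(integrable12ltyP m1 m2 mf) => /=.
apply: (@le_lt_trans _ _ (\int[m1]_x \int[m2]_y ((`|B| * `|F x|) * `|G y|)%:E)%E).
  have m3 : measurable_fun setT (fun p : T1 * T2 => (`|B| * `|F p.1| * `|G p.2|)%:E : \bar R).
    by meas.
  apply: ge0_le_integral => //.
  - by move=> x _; exact: integral_ge0.
  - by apply: (measurable_tonelli m2 (f := fun x y => `|(F x * (G y * k x y))%:E|%E)) => //; exact: measurableT_comp.
  - by apply: (measurable_tonelli m2 (f := fun x y => (`|B| * `|F x| * `|G y|)%:E)) => // x y; rewrite lee_fin !mulr_ge0.
  - move=> x _; apply: ge0_le_integral => //.
    + by have mkx : measurable_fun setT (k x) := measurableT_comp mk (measurable_pair1 x); meas.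
    + exact: (measurableT_comp m3 (measurable_pair1 x)).
    + move=> y _; rewrite lee_fin !normrM.
      rewrite [leRHS](_ : _ = `|F x| * (`|G y| * `|B|)); last by ring.
      by rewrite ler_wpM2l// ler_wpM2l// (le_trans (kB x y))// ler_norm.
rewrite (ge0_integral_sep m1 m2 (f := fun x => `|B| * `|F x|) (g := fun y => `|G y|))//; try by [meas | move=> x; rewrite mulr_ge0].
apply: lte_mul_pinfty.
- by apply: integral_ge0 => x _; rewrite lee_fin mulr_ge0.
- rewrite ge0_fin_numE; last by apply: integral_ge0 => x _; rewrite lee_fin mulr_ge0.
  under eq_integral do rewrite EFinM.
  rewrite ge0_integralZl_EFin//; last by meas.
  by move/integrableP : iF => [_ h]; apply: lte_mul_pinfty.
- by move/integrableP : iG => [_].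
Qed.

(** The form in which Fubini is used for the transform: a bounded kernel, usually [jal], between an
    integrable function of each variable. *)
Lemma Rint_bilinear (F : T1 -> R) (G : T2 -> R) (k : T1 -> T2 -> R) B :
  m1.-integrable setT (EFin \o F) -> m2.-integrable setT (EFin \o G) ->
  measurable_fun setT (fun p => k p.1 p.2) -> (forall x y, `|k x y| <= B) ->
  \int[m1]_x (F x * \int[m2]_y (G y * k x y)) =
  \int[m2]_y (G y * \int[m1]_x (F x * k x y)).
Proof.
move=> iF iG mk kB.
have mF : measurable_fun setT F by apply/measurable_EFinP; exact: measurable_int _ iF.
have mG : measurable_fun setT G by apply/measurable_EFinP; exact: measurable_int _ iG.
have ib (d : measure_display) (T : measurableType d) (m : {measure set T -> \bar R}) (H h : T -> R) :
   m.-integrable setT (EFin \o H) -> measurable_fun setT h -> (forall x, `|h x| <= B) ->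
   m.-integrable setT (EFin \o (fun x => H x * h x)).
  move=> iH mh hB.
  have mH : measurable_fun setT H by apply/measurable_EFinP; exact: measurable_int _ iH.
  apply: (@le_integrable _ _ _ m _ measurableT _ (fun x => B%:E * (`|H x|)%:E)%E).
  - by apply/measurable_EFinP; meas.
  - move=> x _; rewrite !abse_EFin lee_fin !normrM mulrC normr_id ler_wpM2r//.
    by rewrite (le_trans (hB x))// ler_norm.
  - by apply: integrableZl => //; exact: integrable_abse iH.
have iP := integrable_prod_bounded iF iG mk kB.
transitivity (\int[m1]_x \int[m2]_y (F x * (G y * k x y))).
  apply: eq_Rintegral => x _; rewrite RintegralZl//.
  apply: ib => //; exact: (measurableT_comp mk (measurable_pair1 x)).
rewrite Rint_fubini//; apply: eq_Rintegral => y _.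
rewrite -RintegralZl//; first by apply: eq_Rintegral => x _; rewrite mulrCA.
apply: ib => //; exact: (measurableT_comp mk (measurable_pair2 y)).
Qed.

End Rintegral_tools2.

(** * Rising factorials and the Chu-Vandermonde sum *)

Section combinatorics.
Context {R : realType}.
Implicit Types (a x y : R).

(** The rising factorial, equal to the quotient of Gamma at [a + n] by Gamma at [a]; with it the
    identities between series coefficients become purely algebraic. *)
Fixpoint poch a n : R := if n is n'.+1 then poch a n' * (a + n'%:R) else 1.

Lemma pochSl a n : poch a n.+1 = a * poch (a + 1) n.
Proof.
elim: n => [|n IH]; first by rewrite /= addr0 mulr1 mul1r.
by rewrite [LHS]/= -/(poch a n.+1) IH /= -mulrA -natr1; congr (_ * (_ * _)); ring.
Qed.

Lemma poch_gt0 a n : 0 < a -> 0 < poch a n.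
Proof.
by move=> a0; elim: n => [|n IH] /=; rewrite ?ltr01// mulr_gt0// ltr_pwDl.
Qed.

Lemma Gamma_poch a n : 0 < a -> Gamma (n%:R + a) = poch a n * Gamma a.
Proof.
move=> a0; elim: n => [|n IH]; first by rewrite add0r mul1r.
rewrite -natr1 addrAC GammaS; last by rewrite ltr_wpDl.
by rewrite IH /= mulrCA mulrA [a + _]addrC.
Qed.

(** The duplication formula in algebraic form; it turns the half-integer Gamma values in the cosine
    moments into the factorials of the cosine series. *)
Lemma poch_half n : (4 ^ n * n`!)%:R * poch 2^-1 n = (2 * n)`!%:R :> R.
Proof.
elim: n => [|n IH]; first by rewrite /= !muln1 mulr1.
rewrite (_ : 2 * n.+1 = (2 * n).+2)%N; last by lia.
rewrite !factS !natrM -IH /= expnS !natrM.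
rewrite -[(2 * n).+2%:R]natr1 -[(2 * n).+1%:R]natr1 -[n.+1%:R]natr1 natrM.
by field.
Qed.

(* Chu-Vandermonde, by induction on k through Pascal's rule *)
Lemma vandermonde k l a M : 0 < a -> (k < M)%N ->
  \sum_(i < M) ('C(k, i) * 'C(l, i) * i`!)%:R / poch a i =
  poch a (k + l) / (poch a k * poch a l) :> R.
Proof.
elim: k l a M => [|k IH] l a [//|M] a0 kM.
  rewrite big_ord_recl big1; last by move=> i _; rewrite /= bin0n/= !mul0n mul0r.
  by rewrite /= !bin0 addr0 add0n mul1r !divff ?gt_eqF ?poch_gt0.
have pk := poch_gt0 k a0; have pl := poch_gt0 l a0; have pkl := poch_gt0 (k + l) a0.
have ak : 0 < a + k%:R by rewrite ltr_pwDl.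
transitivity (\sum_(i < M.+1) ('C(k, i) * 'C(l, i) * i`!)%:R / poch a i +
   \sum_(i < M) ('C(k, i) * 'C(l, i.+1) * i.+1`!)%:R / poch a i.+1 : R).
  rewrite [LHS]big_ord_recl [X in _ = X + _]big_ord_recl -addrA -big_split.
  congr (_ + _); first by rewrite !bin0.
  by apply: eq_bigr => i _; rewrite lift0 binS !mulnDl natrD mulrDl.
rewrite IH ?(leq_trans kM)//; last exact: ltnW.
case: l pl pkl => [|l] pl pkl.
  rewrite big1; last by move=> i _; rewrite bin0n/= muln0 mul0n mul0r.
  by rewrite !addn0 addr0 -[poch a 0]/1 !mulr1 !divff// gt_eqF// poch_gt0.
transitivity (poch a (k + l.+1) / (poch a k * poch a l.+1) +
   l.+1%:R / a * (poch (a + 1) (k + l) / (poch (a + 1) k * poch (a + 1) l))).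
  congr (_ + _); rewrite -(IH l (a + 1) M) ?addr_gt0//.
  rewrite mulr_sumr; apply: eq_bigr => i _.
  rewrite pochSl factS.
  have -> : ('C(k, i) * 'C(l.+1, i.+1) * (i.+1 * i`!) = l.+1 * ('C(k, i) * 'C(l, i) * i`!))%N.
    have E := mul_bin_diag l.+1 i.
    transitivity ('C(k, i) * i`! * (i.+1 * 'C(l.+1, i.+1)))%N; first by nia.
    by rewrite -E /=; nia.
  rewrite natrM; field.
  by apply/andP; split; rewrite gt_eqF// poch_gt0// addr_gt0.
have e2 n : poch (a + 1) n = poch a n.+1 / a.
  by apply: (mulfI (negbT (gt_eqF a0))); rewrite -pochSl mulrC divfK ?gt_eqF.
rewrite !e2 addSn -addnS -[(k + l.+1)%N]/(k + l.+1)%N.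
rewrite -[poch a k.+1]/(poch a k * (a + k%:R)).
rewrite (_ : poch a (k + l.+1).+1 = poch a (k + l.+1) * (a + (k + l.+1)%:R))//.
rewrite addnS in pkl *.
move: pk pl pkl ak; move: (poch a k) (poch a l.+1) (poch a (k + l).+1) => A B C A0 B0 C0 ak.
by rewrite -addnS natrD; field; rewrite !gt_eqF.
Qed.

Lemma sum_even_odd (h : nat -> R) N :
  \sum_(m < 2 * N) h m = \sum_(i < N) (h (2 * i)%N + h (2 * i).+1).
Proof.
elim: N => [|N IH]; first by rewrite !big_ord0.
rewrite (_ : 2 * N.+1 = (2 * N).+2)%N; last by lia.
by rewrite !big_ord_recr /= IH addrA.
Qed.

(** The binomial theorem for the exponent [n - 2 * i], with its index shifted by [i] so that the
    factor [(X * Y)^i] is absorbed. The range can be all [k <= n] because the two binomial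
    coefficients vanish unless [i <= k <= n - i]. *)
Lemma expD_fact (X Y : R) i n : (2 * i <= n)%N ->
  (X * Y) ^+ i * (X + Y) ^+ (n - 2 * i) / (n - 2 * i)`!%:R =
  \sum_(k < n.+1) X ^+ k * Y ^+ (n - k) *
    (('C(k, i) * 'C(n - k, i) * i`! * i`!)%:R / (k`! * (n - k)`!)%:R).
Proof.
move=> ni.
pose F k := X ^+ k * Y ^+ (n - k) *
    (('C(k, i) * 'C(n - k, i) * i`! * i`!)%:R / (k`! * (n - k)`!)%:R).
have F0 k : (k <= n)%N -> (k < i)%N || (n - i < k)%N -> F k = 0.
  move=> kn h; rewrite /F.
  have -> : ('C(k, i) * 'C(n - k, i) = 0)%N.
    by case/orP: h => h; [rewrite (bin_small h)|rewrite [X in (_ * X)%N]bin_small ?muln0//; lia].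
  by rewrite !mul0n mul0r mulr0.
have E : \sum_(k < n.+1) F k = \sum_(p < (n - 2 * i).+1) F (p + i)%N.
  rewrite -(big_mkord xpredT F) (@big_cat_nat _ _ _ i)//=; last by lia.
  rewrite big_nat big1 ?add0r; last by move=> k /andP[_ ki]; rewrite F0 ?ki//; lia.
  rewrite (@big_cat_nat _ _ _ (n - i).+1)//=; [|by lia|by lia].
  rewrite [X in _ + X]big_nat [X in _ + X]big1 ?addr0; last first.
    by move=> k /andP[ki kn]; rewrite F0 ?ki ?orbT//; lia.
  rewrite -{1}[i]add0n big_addn -(big_mkord xpredT (fun p => F (p + i)%N)).
  by rewrite (_ : (n - i).+1 - i = (n - 2 * i).+1)%N//; lia.
rewrite -[RHS]/(\sum_(k < n.+1) F k) E.
rewrite addrC exprDn mulrC mulr_sumr mulr_sumr; apply: eq_bigr => p _.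
have pn : (p <= n - 2 * i)%N by rewrite -ltnS.
set m := (n - 2 * i)%N in pn *.
rewrite /F (_ : n - (p + i) = (m - p) + i)%N; last by rewrite /m in pn *; lia.
have h1 := bin_fact (leq_addl p i : (i <= p + i)%N).
have h2 := bin_fact (leq_addl (m - p) i : (i <= m - p + i)%N).
have h3 := bin_fact pn.
rewrite addnK in h1; rewrite addnK in h2.
have nz j : (j`!%:R != 0 :> R) by rewrite pnatr_eq0 -lt0n fact_gt0.
rewrite -h1 -h2 -h3 !natrM exprMn !exprD.
have b1 : 'C(p + i, i)%:R != 0 :> R by rewrite pnatr_eq0 -lt0n bin_gt0 leq_addl.
have b2 : 'C(m - p + i, i)%:R != 0 :> R by rewrite pnatr_eq0 -lt0n bin_gt0 leq_addl.
have b3 : 'C(m, p)%:R != 0 :> R by rewrite pnatr_eq0 -lt0n bin_gt0.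
rewrite -mulr_natr; field.
by rewrite !nz b1 b2 b3.
Qed.

End combinatorics.

(** * The normalized Bessel function and its product formula *)

Section series_tools.
Context {R : realType}.

Lemma Rint_sum d (T : measurableType d) (mu : {measure set T -> \bar R})
    (f : nat -> T -> R) N :
  (forall n, mu.-integrable setT (EFin \o f n)) ->
  mu.-integrable setT (EFin \o (fun x => \sum_(i < N) f i x)) /\
  \int[mu]_x \sum_(i < N) f i x = \sum_(i < N) \int[mu]_x f i x.
Proof.
move=> fi; elim: N => [|N [IH1 IH2]].
  split; last by under eq_Rintegral do rewrite big_ord0; rewrite /Rintegral integral0 big_ord0.
  by under [X in _.-integrable _ X]eq_fun do rewrite big_ord0; exact: integrable0.
split.
  rewrite (_ : EFin \o _ = (EFin \o (fun x => \sum_(i < N) f i x)%R) \+ (EFin \o f N))%E; last first.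
    by apply/funext => x /=; rewrite big_ord_recr.
  exact: integrableD.
under eq_Rintegral do rewrite big_ord_recr.
by rewrite RintegralD// IH2 big_ord_recr.
Qed.

Lemma convolution_sum (u v : nat -> R) N :
  \sum_(n < N) \sum_(k < n.+1) u k * v (n - k)%N =
  \sum_(i < N) u i * \sum_(j < N - i) v j.
Proof.
elim: N => [|N IH]; first by rewrite !big_ord0.
rewrite big_ord_recr/= IH [X in _ + X]big_ord_recr [RHS]big_ord_recr/= addrA.
congr (_ + _); last by rewrite subnn subSnn big_ord1.
rewrite -big_split/=; apply: eq_bigr => i _.
by rewrite -mulrDr subSn ?(ltnW (ltn_ord i))// big_ord_recr.
Qed.

(** The square of partial sums and the triangle [i + j < N] differ only by pairs outside the square
    of side [N./2], which lies within the triangle. The absolute error is thus at most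
    [P N - P N./2], and this tends to 0 because [P] converges. *)
Lemma cauchy_product (u v : nat -> R) (U V A B : R) :
  (fun N => \sum_(i < N) u i) @ \oo --> U -> (fun N => \sum_(i < N) v i) @ \oo --> V ->
  (fun N => \sum_(i < N) `|u i|) @ \oo --> A ->
  (fun N => \sum_(i < N) `|v i|) @ \oo --> B ->
  (fun N => \sum_(n < N) \sum_(k < n.+1) u k * v (n - k)%N) @ \oo --> U * V.
Proof.
move=> cu cv ca cb.
pose S (N : nat) : R := (\sum_(i < N) u i) * (\sum_(i < N) v i).
pose P (N : nat) : R := (\sum_(i < N) `|u i|) * (\sum_(i < N) `|v i|).
pose T (N : nat) : R := \sum_(n < N) \sum_(k < n.+1) u k * v (n - k)%N.
have cS : S @ \oo --> U * V by exact: cvgM.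
have cP : P @ \oo --> A * B by exact: cvgM.
pose half (N : nat) := N./2.
have half_oo : half @ \oo --> \oo.
  move=> Q [M _ HM]; exists (M.*2) => // N /= MN; apply: HM => /=.
  by rewrite -(doubleK M) half_leq.
have cP2 : (fun N => P N./2) @ \oo --> A * B by exact: (@cvg_comp _ _ _ half P \oo \oo (nbhs (A * B)) half_oo cP).
have cd : (fun N => P N - P N./2) @ \oo --> 0.
  by rewrite -(subrr (A * B)); exact: cvgB.
have vle M N (MN : (M <= N)%N) : `|\sum_(i < N) v i - \sum_(i < M) v i| <=
    \sum_(i < N) `|v i| - \sum_(i < M) `|v i|.
  rewrite -!(big_mkord xpredT v) -!(big_mkord xpredT (fun i => `|v i|)).
  have E (f : nat -> R) : \sum_(0 <= i < N) f i - \sum_(0 <= i < M) f i = \sum_(M <= i < N) f i.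
    by rewrite (@big_cat_nat _ _ _ M 0 N _ _ (leq0n M) MN)/= addrAC subrr add0r.
  rewrite !E.
  exact: ler_norm_sum.
have qle M N (MN : (M <= N)%N) : \sum_(i < M) `|v i| <= \sum_(i < N) `|v i|.
  by rewrite -subr_ge0; apply: le_trans (vle _ _ MN).
have ST N : `|S N - T N| <= P N - P N./2.
  rewrite /S /T convolution_sum mulr_suml -sumrB.
  apply: (@le_trans _ _ (\sum_(i < N) `|u i| * (\sum_(j < N) `|v j| - \sum_(j < N - i) `|v j|))).
    apply: le_trans (ler_norm_sum _ _ _) _; apply: ler_sum => i _.
    by rewrite -mulrBr normrM ler_wpM2l// vle// leq_subr.
  under eq_bigr do rewrite mulrBr.
  rewrite sumrB -mulr_suml lerB//.
  have hN : (N./2 <= N)%N by lia.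
  rewrite /P mulr_suml -(big_mkord xpredT (fun i => `|u i| * \sum_(j < N./2) `|v j|)).
  rewrite -(big_mkord xpredT (fun i => `|u i| * \sum_(j < N - i) `|v j|)).
  rewrite [leRHS](@big_cat_nat _ _ _ N./2)//= -[leLHS]addr0 lerD//.
    rewrite !big_nat; apply: ler_sum => i /andP[_ iN].
    by rewrite ler_wpM2l// qle//; lia.
  by apply: sumr_ge0 => i _; rewrite mulr_ge0// sumr_ge0.
have cST : (fun N => S N - T N) @ \oo --> 0.
  apply: norm_cvg0; apply: (squeeze_cvgr _ (cvg_cst 0) cd).
  by apply: nearW => N; rewrite normr_ge0 ST.
rewrite -[U * V]subr0 -[X in X @ _ --> _](_ : (fun N => S N - (S N - T N)) = T).
  exact: cvgB.
by apply/funext => N; rewrite subKr.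
Qed.

Lemma even_exp_bound (y : R) N :
  \sum_(n < N) `|y| ^+ (2 * n) / (2 * n)`!%:R <= expR `|y|.
Proof.
apply: (@le_trans _ _ (\sum_(m < 2 * N) `|y| ^+ m / m`!%:R)).
  rewrite (sum_even_odd (fun m => `|y| ^+ m / m`!%:R)); apply: ler_sum => i _.
  by rewrite lerDl divr_ge0.
have -> : \sum_(m < 2 * N) `|y| ^+ m / m`!%:R = series (exp_coeff `|y|) (2 * N)%N.
  by rewrite /series/= big_mkord; apply: eq_bigr.
rewrite /expR; apply: nondecreasing_cvgn_le; last exact: is_cvg_series_exp_coeff.
by apply: nondecreasing_series => n _ _; exact: exp_coeff_ge0.
Qed.

End series_tools.

Section bessel.
Context {R : realType}.
Variable al : R.
Hypothesis al_gt : - 2^-1 < al.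
Implicit Types x y z t xi : R.

(** The modulus of the coefficient of [z^(2 n)] in the series of [jal], after cancellation of the
    Gamma factor at [al + 1]. *)
Definition cb n : R := (n`!%:R * 4 ^+ n * poch (al + 1) n)^-1.

Let a0 : 0 < al + 1. Proof. exact: al1_gt0. Qed.

Lemma cb_gt0 n : 0 < cb n.
Proof.
by rewrite invr_gt0 !mulr_gt0 ?exprn_gt0 ?poch_gt0// ltr0n fact_gt0.
Qed.

Lemma Rint_cos_even n : \int[hsig al]_th (cos th) ^+ (2 * n) = (2 * n)`!%:R * cb n.
Proof.
rewrite /Rintegral cos_moment//= -addrA !Gamma_poch// -poch_half /cb natrM natrX.
have g1 : Gamma (2^-1) != 0 :> R by rewrite gt_eqF// Gamma_gt0.
have g2 : Gamma (al + 1) != 0 :> R by rewrite gt_eqF// Gamma_gt0.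
have g3 : poch (al + 1) n != 0 by rewrite gt_eqF// poch_gt0.
have g4 : n`!%:R != 0 :> R by rewrite pnatr_eq0 -lt0n fact_gt0.
have g5 : (4 : R) ^+ n != 0 by rewrite expf_neq0.
move: g1 g2 g3 g4 g5.
move: (Gamma 2^-1) (Gamma (al + 1)) (poch (al + 1) n) (n`!%:R : R) ((4 : R) ^+ n) (poch 2^-1 n) => A B C D E F *.
by field; apply/and5P.
Qed.

Lemma Rint_cos_odd n : \int[hsig al]_th (cos th) ^+ (2 * n).+1 = 0.
Proof. by rewrite /Rintegral mul2n cos_moment_odd. Qed.

(** Up to the factor (2n)!, [cb n] is an even moment of the cosine under a probability measure,
    hence at most 1. The exponential thereby dominates all partial sums of the Bessel series. *)
Lemma cb_le n : cb n <= ((2 * n)`!%:R)^-1.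
Proof.
have f0 : 0 < (2 * n)`!%:R :> R by rewrite ltr0n fact_gt0.
rewrite -[leRHS]mul1r ler_pdivlMr// mulrC -Rint_cos_even.
apply: (@le_trans _ _ (\int[hsig al]_th 1)); last first.
  rewrite /Rintegral integral_cst//.
  by change (fine (1 * hsig al setT) <= 1); rewrite hsig_setT// mul1e.
apply: le_Rintegral => //.
- apply: (@integrable_hsig _ _ al_gt _ 1); first by meas.
  by move=> th; rewrite normrX exprn_ile1// ler_norml cos_geN1 cos_le1.
- by apply: (@integrable_hsig _ _ al_gt _ 1) => // th; rewrite normr1.
Qed.

Definition jpart N z := \sum_(n < N) (-1) ^+ n * cb n * z ^+ (2 * n).

Lemma jpart_abs N z : \sum_(n < N) `|(-1) ^+ n * cb n * z ^+ (2 * n)| <= expR `|z|.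
Proof.
apply: le_trans (even_exp_bound z N); apply: ler_sum => n _.
by rewrite !normrM normrX normrN1 expr1n mul1r normrX (gtr0_norm (cb_gt0 n)) mulrC ler_wpM2l ?cb_le.
Qed.

Lemma jpart_bound N z : `|jpart N z| <= expR `|z|.
Proof. exact: le_trans (ler_norm_sum _ _ _) (jpart_abs N z). Qed.

(** Poisson's integral: the cosine series is integrated term by term, the even moments turning the
    coefficient 1/(2n)! into [cb n]. *)
Lemma poisson z : (fun N => jpart N z) @ \oo --> \int[hsig al]_th cos (z * cos th).
Proof.
pose fn N th := \sum_(n < N) (-1) ^+ n * (z * cos th) ^+ (2 * n) / (2 * n)`!%:R.
have cos1 (th : R) : `|cos th| <= 1 by rewrite ler_norml cos_geN1 cos_le1.
have fi n : (hsig al).-integrable setT (EFin \o (fun th => (-1) ^+ n * (z * cos th) ^+ (2 * n) / (2 * n)`!%:R)).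
  apply: (@integrable_hsig _ _ al_gt _ (`|z| ^+ (2 * n) / (2 * n)`!%:R)); first by meas.
  move=> th; rewrite !normrM normrX normrN1 expr1n mul1r normrX normrM normfV.
  rewrite [X in _ / X]ger0_norm// ler_wpM2r//.
  by apply: lerXn2r; rewrite ?nnegrE ?mulr_ge0// ler_piMr.
have -> : (fun N => jpart N z) = (fun N => \int[hsig al]_th fn N th).
  apply/funext => N; rewrite /fn (proj2 (Rint_sum N fi)); apply: eq_bigr => n _.
  rewrite (_ : (fun th => _) = (fun th => ((-1) ^+ n * z ^+ (2 * n) / (2 * n)`!%:R) * cos th ^+ (2 * n))); last first.
    by apply/funext => th; rewrite exprMn; ring.
  rewrite RintegralZl//; last first.
    apply: (@integrable_hsig _ _ al_gt _ 1); first by meas.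
    by move=> th; rewrite normrX exprn_ile1.
  have f0 : (2 * n)`!%:R != 0 :> R by rewrite pnatr_eq0 -lt0n fact_gt0.
  by rewrite Rint_cos_even; field.
apply: (proj2 (@Rint_dct _ _ _ (hsig al) fn (fun th => cos (z * cos th)) (fun=> expR `|z|) _ _ _ _)).
- by move=> N; apply: measurable_sum => n; meas.
- move=> th; have := @cvg_cos_coeff' R (z * cos th).
  rewrite (_ : series _ = fn^~ th)//; apply/funext => N.
  by rewrite /series/= big_mkord /fn; apply: eq_bigr => i _; rewrite /cos_coeff'/= ?mul2n ?mulrA.
- by apply: (@integrable_hsig _ _ al_gt _ (expR `|z|)) => // th; rewrite ger0_norm ?expR_ge0.
- move=> N th; apply: le_trans (ler_norm_sum _ _ _) _.
  apply: (@le_trans _ _ (expR `|z * cos th|)); last first.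
    by rewrite ler_expR normrM ler_piMr.
  apply: le_trans (even_exp_bound _ N); apply: ler_sum => n _.
  by rewrite !normrM normrX normrN1 expr1n mul1r normrX normrM normfV [X in _ / X]ger0_norm.
Qed.

Lemma jalE z : jal al z = \int[hsig al]_th cos (z * cos th).
Proof.
have g2 : Gamma (al + 1) != 0 :> R by rewrite gt_eqF// Gamma_gt0.
rewrite /jal.
have -> : series (fun n : nat =>
    (-1) ^+ n / ((n`!)%:R * Gamma (n%:R + al + 1)) * (z / 2) ^+ (2 * n)) =
    (fun N => (Gamma (al + 1))^-1 * jpart N z).
  apply/funext => N; rewrite /series/= big_mkord /jpart mulr_sumr; apply: eq_bigr => n _.
  rewrite -addrA Gamma_poch// /cb exprMn exprVn [2 ^+ (2 * n)]exprM -natrX.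
  have g3 : poch (al + 1) n != 0 by rewrite gt_eqF// poch_gt0.
  have g4 : n`!%:R != 0 :> R by rewrite pnatr_eq0 -lt0n fact_gt0.
  have g5 : (4 : R) ^+ n != 0 by rewrite expf_neq0.
  move: g2 g3 g4 g5.
  rewrite (_ : (2 ^ 2)%:R = 4 :> R)//.
  move: (Gamma (al + 1)) (poch (al + 1) n) (n`!%:R : R) ((4 : R) ^+ n) => A B C D *.
  by field; apply/and4P.
have h : (fun N => (Gamma (al + 1))^-1 * jpart N z) @ \oo --> (Gamma (al + 1))^-1 * \int[hsig al]_th cos (z * cos th).
  by apply: cvgMr; exact: poisson.
by rewrite (cvg_lim _ h)// mulrA mulfV// mul1r.
Qed.

Lemma jpart_cvg z : (fun N => jpart N z) @ \oo --> jal al z.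
Proof. by rewrite jalE; exact: poisson. Qed.

Lemma jal_le1 z : `|jal al z| <= 1.
Proof.
have ic : (hsig al).-integrable setT (EFin \o (fun th => cos (z * cos th))).
  apply: (@integrable_hsig _ _ al_gt _ 1); first by meas.
  by move=> th; rewrite ler_norml cos_geN1 cos_le1.
rewrite jalE; apply: le_trans (le_normr_Rintegral _ _) _ => //.
apply: (@le_trans _ _ (\int[hsig al]_th 1)); last first.
  rewrite /Rintegral integral_cst//.
  by change (fine (1 * hsig al setT) <= 1); rewrite hsig_setT// mul1e.
apply: le_Rintegral => //.
- exact: integrable_norm.
- by apply: (@integrable_hsig _ _ al_gt _ 1) => // th; rewrite normr1.
- by move=> th _; rewrite ler_norml cos_geN1 cos_le1.
Qed.

Lemma measurable_jal : measurable_fun setT (jal al).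
Proof.
apply: (@measurable_fun_cvg _ _ _ _ jpart).
  by move=> N; apply: measurable_sum => n; meas.
by move=> z _; exact: jpart_cvg.
Qed.

End bessel.

Section product_formula.
Context {R : realType}.
Variable al : R.
Hypothesis al_gt : - 2^-1 < al.
Implicit Types x y z t xi : R.

Local Notation jc := (cb al).

Let a0 : 0 < al + 1. Proof. exact: al1_gt0. Qed.

Lemma integrable_cosX m : (hsig al).-integrable setT (EFin \o (fun th => cos th ^+ m)).
Proof.
apply: (@integrable_hsig _ _ al_gt _ 1); first by meas.
by move=> th; rewrite normrX exprn_ile1// ler_norml cos_geN1 cos_le1.
Qed.

(** The part of degree [2 n] of the product formula. In the expansion of [rr^(2 n)] odd powers of
    the cosine integrate to 0 and even ones give [cb i]; the result is sorted by powers of [X] and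
    [Y], and for each of them the sum over [i] is a Chu-Vandermonde sum. *)
Lemma rr_moment x y n : jc n * \int[hsig al]_th rr x y th ^+ (2 * n) =
  \sum_(k < n.+1) jc k * jc (n - k) * (x ^+ (2 * k) * y ^+ (2 * (n - k))).
Proof.
pose X := x ^+ 2; pose Y := y ^+ 2.
pose G m : R := 'C(n, m)%:R * (X + Y) ^+ (n - m) * (2 * x * y) ^+ m.
have e th : rr x y th ^+ (2 * n) = \sum_(m < 2 * n.+1) G m * cos th ^+ m.
  rewrite exprM rr_sqr exprDn -(big_mkord xpredT (fun m => G m * cos th ^+ m)).
  (* The sum is padded to the even length [2 * n.+1], so that it can be paired into even and odd
     indices; the added binomial coefficients are zero. *)
  rewrite (@big_cat_nat _ _ _ n.+1)//=; last by lia.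
  rewrite [Y in _ = _ + Y]big_nat [Y in _ = _ + Y]big1 ?addr0; last first.
    by move=> m /andP[nm _]; rewrite /G bin_small// !mul0r.
  rewrite big_mkord; apply: eq_bigr => m _.
  rewrite /G -mulr_natl exprMn; ring.
have ii m : (hsig al).-integrable setT (EFin \o (fun th => G m * cos th ^+ m)).
  exact: (integrableZl measurableT (G m) (integrable_cosX m)).
under eq_Rintegral do rewrite e.
rewrite (proj2 (Rint_sum _ ii)) (sum_even_odd (fun m => \int[hsig al]_th (G m * cos th ^+ m))).
have -> : \sum_(i < n.+1) (\int[hsig al]_x0 (G (2 * i)%N * cos x0 ^+ (2 * i)) +
    \int[hsig al]_x0 (G (2 * i).+1 * cos x0 ^+ (2 * i).+1)) =
   \sum_(i < n.+1) G (2 * i)%N * ((2 * i)`!%:R * jc i).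
  apply: eq_bigr => i _.
  rewrite (RintegralZl _ measurableT (integrable_cosX _)) (RintegralZl _ measurableT (integrable_cosX _)).
  by rewrite (Rint_cos_odd al_gt) (Rint_cos_even al_gt) mulr0 addr0.
have nz j : (j`!%:R != 0 :> R) by rewrite pnatr_eq0 -lt0n fact_gt0.
have pz j : poch (al + 1) j != 0 by rewrite gt_eqF// poch_gt0.
have f4 j : (4 : R) ^+ j != 0 by rewrite expf_neq0.
rewrite mulr_sumr.
transitivity (\sum_(i < n.+1) \sum_(k < n.+1) (4 ^+ n * poch (al + 1) n)^-1 *
   (X ^+ k * Y ^+ (n - k) / (k`! * (n - k)`!)%:R) *
   (('C(k, i) * 'C(n - k, i) * i`!)%:R / poch (al + 1) i)).
  apply: eq_bigr => i _; have [ni|ni] := leqP (2 * i) n.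
    transitivity ((4 ^+ n * poch (al + 1) n)^-1 * ((i`!%:R * poch (al + 1) i)^-1 *
       ((X * Y) ^+ i * (X + Y) ^+ (n - 2 * i) / (n - 2 * i)`!%:R))).
      have E : n`!%:R = 'C(n, 2 * i)%:R * ((2 * i)`!%:R * (n - 2 * i)`!%:R) :> R.
        by rewrite -!natrM bin_fact.
      have c0 : 'C(n, 2 * i)%:R != 0 :> R by rewrite pnatr_eq0 -lt0n bin_gt0.
      rewrite /G /X /Y /cb E [(2 * x * y) ^+ (2 * i)]exprM !exprMn.
      have -> : (4 : R) ^+ i = 2 ^+ i * 2 ^+ i by rewrite -exprMn -natrM.
      have f2 : (2 : R) ^+ i != 0 by rewrite expf_neq0.
      have := nz i; have := nz (n - 2 * i)%N; have := nz (2 * i)%N; have := pz i; have := pz n.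
      have := f2; have := f4 n.
      move: c0; move: ('C(n, 2 * i)%:R : R) (i`!%:R : R) ((n - 2 * i)`!%:R : R) ((2 * i)`!%:R : R)
        (poch (al + 1) i) (poch (al + 1) n) ((4 : R) ^+ n) ((2 : R) ^+ i).
      by move=> A B C D E' F H I *; field; do ?[apply/andP; split].
    rewrite expD_fact// !mulr_sumr; apply: eq_bigr => k _.
    rewrite [(_ * i`! * i`!)%:R]natrM.
    have := nz i; have := pz i.
    move: (('C(k, i) * 'C(n - k, i) * i`!)%:R : R) ((k`! * (n - k)`!)%:R^-1 : R) ((4 ^+ n * poch (al + 1) n)^-1).
    move=> A B C h1 h2; field.
    by rewrite h1 h2.
  rewrite /G bin_small// !mul0r mulr0 big1// => k _.
  have -> : ('C(k, i) * 'C(n - k, i) = 0)%N.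
    have [ki|ki] := ltnP k i; first by rewrite (bin_small ki).
    by rewrite [X in (_ * X)%N]bin_small ?muln0//; have := ltn_ord k; lia.
  by rewrite !mul0n mul0r mulr0.
rewrite exchange_big; apply: eq_bigr => k _ /=.
have kn : (k <= n)%N by rewrite -ltnS.
rewrite -mulr_sumr vandermonde// subnKC// /cb.
have -> : (4 : R) ^+ n = 4 ^+ k * 4 ^+ (n - k) by rewrite -exprD subnKC.
rewrite !exprM -/X -/Y natrM.
have := nz k; have := nz (n - k)%N; have := pz k; have := pz (n - k)%N; have := pz n; have := f4 k; have := f4 (n - k)%N.
move: (k`!%:R : R) ((n - k)`!%:R : R) (poch (al + 1) k) (poch (al + 1) (n - k)) (poch (al + 1) n)
  ((4 : R) ^+ k) ((4 : R) ^+ (n - k)) => A B C D E F G' *.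
by field; do ?[apply/andP; split].
Qed.

Lemma rr_le x y th : rr x y th <= `|x| + `|y|.
Proof.
rewrite -(ler_pXn2r (n := 2))// ?nnegrE ?rr_ge0 ?addr_ge0// rr_sqr sqrrD !real_normK ?num_real//.
have : x * y * cos th <= `|x| * `|y|; last by rewrite -mulr_natl; lra.
rewrite -normrM; apply: le_trans (ler_norm (x * y * cos th)) _; rewrite (normrM (x * y)) ler_piMr//.
by rewrite ler_norml cos_geN1 cos_le1.
Qed.

Lemma jpart_abs_cvg z : cvgn (fun N => \sum_(n < N) `|(-1) ^+ n * jc n * z ^+ (2 * n)|).
Proof.
apply: nondecreasing_is_cvgn.
  move=> m n mn; rewrite -!(big_mkord xpredT (fun n => `|(-1) ^+ n * jc n * z ^+ (2 * n)|)).
  by rewrite [leRHS](@big_cat_nat _ _ _ m)//= lerDl sumr_ge0.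
by exists (expR `|z|) => _ [N _ <-]; exact: jpart_abs.
Qed.

(** Termwise integration of the Bessel series, with [rr_moment], produces the partial Cauchy sums of
    the series of the two factors; both limits are known. *)
Lemma product_formula xi x y :
  \int[hsig al]_th jal al (xi * rr x y th) = jal al (x * xi) * jal al (y * xi).
Proof.
pose u z (k : nat) : R := (-1) ^+ k * jc k * z ^+ (2 * k).
have mr : measurable_fun setT (fun th => rr x y th) by apply: measurable_fun_rr; meas.
have L1 : (fun N => \int[hsig al]_th jpart al N (xi * rr x y th)) @ \oo -->
    \int[hsig al]_th jal al (xi * rr x y th).
  apply: (proj2 (@Rint_dct _ _ _ (hsig al) _ _ (fun=> expR (`|xi| * (`|x| + `|y|))) _ _ _ _)).
  - by move=> N; apply: measurable_sum => n; meas.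
  - by move=> th; exact: jpart_cvg.
  - by apply: (@integrable_hsig _ _ al_gt _ (expR (`|xi| * (`|x| + `|y|)))) => // th; rewrite ger0_norm ?expR_ge0.
  - move=> N th; apply: le_trans (jpart_bound al_gt _ _) _.
    by rewrite ler_expR normrM ler_wpM2l// ger0_norm ?rr_ge0 ?rr_le.
have L2 : (fun N => \sum_(n < N) \sum_(k < n.+1) u (x * xi) k * u (y * xi) (n - k)%N) @ \oo -->
    jal al (x * xi) * jal al (y * xi).
  have h := (@cauchy_product _ (u (x * xi)) (u (y * xi)) _ _ _ _ (@jpart_cvg _ al al_gt (x * xi)) (@jpart_cvg _ al al_gt (y * xi)) (@jpart_abs_cvg (x * xi)) (@jpart_abs_cvg (y * xi))).
  exact: h.
have E N : \int[hsig al]_th jpart al N (xi * rr x y th) =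
    \sum_(n < N) \sum_(k < n.+1) u (x * xi) k * u (y * xi) (n - k)%N.
  have ir n : (hsig al).-integrable setT (EFin \o (fun th => rr x y th ^+ (2 * n))).
    apply: (@integrable_hsig _ _ al_gt _ ((`|x| + `|y|) ^+ (2 * n))); first by meas.
    move=> th; rewrite normrX ger0_norm ?rr_ge0// lerXn2r ?nnegrE ?rr_ge0 ?addr_ge0//.
    exact: rr_le.
  have ii n : (hsig al).-integrable setT (EFin \o (fun th => ((-1) ^+ n * xi ^+ (2 * n) * jc n) * rr x y th ^+ (2 * n))).
    exact: (integrableZl measurableT ((-1) ^+ n * xi ^+ (2 * n) * jc n) (ir n)).
  have e th : jpart al N (xi * rr x y th) =
     \sum_(n < N) ((-1) ^+ n * xi ^+ (2 * n) * jc n) * rr x y th ^+ (2 * n).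
    by apply: eq_bigr => n _; rewrite exprMn; ring.
  under eq_Rintegral do rewrite e.
  rewrite (proj2 (Rint_sum _ ii)); apply: eq_bigr => n _.
  rewrite (RintegralZl _ measurableT (ir n)) -[X in X = _]mulrA rr_moment mulr_sumr; apply: eq_bigr => k _.
  have kn : (k <= n)%N by rewrite -ltnS.
  rewrite /u -{1 2}(subnKC kn) mulnDr !exprD !exprMn; ring.
by rewrite (funext E) in L1; exact: (cvg_unique (@Rhausdorff R) L1 L2).
Qed.

Lemma gauss_hmu n t : 0 < t ->
  (\int[hmu al]_xi (xi ^+ (2 * n) * expR (- (t * xi ^+ 2)))%:E =
  ((2 * t) `^ (- (al + 1)) * (poch (al + 1) n / t ^+ n))%:E)%E.
Proof.
move=> t0.
have g0 := Gamma_al1_gt0 al_gt; have p0 : 0 < 2 `^ al :> R by exact: powR_gt0.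
rewrite (integral_hmu al_gt); last by meas.
transitivity (((2 `^ al * Gamma (al + 1))^-1)%:E *
  \int[lebR]_x (if (0 < x)%R then (x `^ (2 * al + 1 + (2 * n)%:R) * expR (- (t * x ^+ 2)))%:E else 0))%E.
  rewrite -ge0_integralZl_EFin//; last 3 first.
  - by move=> x _; case: ifP => // _; rewrite lee_fin mulr_ge0 ?powR_ge0 ?expR_ge0.
  - by meas.
  - by rewrite invr_ge0 ltW// mulr_gt0.
  apply: eq_integral => x _; rewrite /dmu; case: ifP => x0; last by rewrite mul0e mule0.
  rewrite -!EFinM; congr EFin.
  by rewrite powRD ?(gt_eqF x0) ?implybT// powR_mulrn ?(ltW x0)// /wmu; field; rewrite !gt_eqF.
rewrite gauss_moment//; last by have := al_gt; have := ler0n R (2 * n); lra.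
rewrite -EFinM; congr EFin.
rewrite (_ : (2 * al + 1 + (2 * n)%:R + 1) / 2 = n%:R + (al + 1)); last by rewrite natrM; field.
rewrite Gamma_poch// opprD powRD ?(gt_eqF t0) ?implybT// (powRN t n%:R) powR_mulrn ?(ltW t0)//.
rewrite powRM ?(ltW t0)//.
have -> : 2 `^ (- (al + 1)) = (2 * 2 `^ al)^-1 :> R.
  by rewrite powRN (@powRD _ _ al 1) ?pnatr_eq0 ?implybT// powRr1// mulrC.
have tn : t ^+ n != 0 by rewrite expf_neq0 ?gt_eqF.
have := gt_eqF g0; have := gt_eqF p0; move: tn.
move: (t ^+ n) (t `^ (- (al + 1))) (2 `^ al) (Gamma (al + 1)) (poch (al + 1) n) => A B C D E A0 C0 D0.
by field; rewrite A0 C0 D0.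
Qed.

Lemma integrable_gauss n t : 0 < t ->
  (hmu al).-integrable setT (EFin \o (fun xi => xi ^+ (2 * n) * expR (- (t * xi ^+ 2)))).
Proof.
move=> t0; apply/integrableP; split; first by meas.
rewrite (eq_integral (fun xi => (xi ^+ (2 * n) * expR (- (t * xi ^+ 2)))%:E)).
  by rewrite gauss_hmu// ltry.
by move=> x _; rewrite /= ger0_norm// mulr_ge0 ?expR_ge0// exprM exprn_ge0 ?sqr_ge0.
Qed.

Lemma integrable_gauss0 t : 0 < t ->
  (hmu al).-integrable setT (EFin \o (fun xi => expR (- (t * xi ^+ 2)))).
Proof.
move=> t0; have := integrable_gauss 0 t0.
by rewrite (_ : (fun xi => xi ^+ _ * _) = (fun xi => expR (- (t * xi ^+ 2))))//; apply/funext => xi; rewrite mul1r.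
Qed.

(** The Gaussian moments contribute [poch (al + 1) n], which cancels the same factor in [cb n] and
    leaves an exponential series. *)
Lemma gauss_transform t z : 0 < t ->
  \int[hmu al]_xi (expR (- (t * xi ^+ 2)) * jal al (z * xi)) =
  (2 * t) `^ (- (al + 1)) * expR (- (z ^+ 2 / (4 * t))).
Proof.
move=> t0; have t20 : 0 < t / 2 by rewrite divr_gt0.
have L1 : (fun N => \int[hmu al]_xi (expR (- (t * xi ^+ 2)) * jpart al N (z * xi))) @ \oo -->
    \int[hmu al]_xi (expR (- (t * xi ^+ 2)) * jal al (z * xi)).
  (* The majorant spends half of the Gaussian: [|z * xi| <= z^2 / (2 * t) + t * xi^2 / 2]. *)
  apply: (proj2 (@Rint_dct _ _ _ (hmu al) _ _ (fun xi => expR (z ^+ 2 / (2 * t)) * expR (- (t / 2 * xi ^+ 2))) _ _ _ _)).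
  - move=> N; have : measurable_fun setT (fun xi => jpart al N (z * xi)) by apply: measurable_sum => n; meas.
    by move=> h; meas.
  - by move=> xi; apply: cvgMr; exact: jpart_cvg.
  - exact: (integrableZl measurableT (expR (z ^+ 2 / (2 * t))) (integrable_gauss0 t20)).
  - move=> N xi; rewrite normrM ger0_norm ?expR_ge0//.
    apply: (@le_trans _ _ (expR (- (t * xi ^+ 2)) * expR `|z * xi|)).
      by rewrite ler_wpM2l ?expR_ge0// jpart_bound.
    rewrite -!expRD ler_expR.
    have : `|z * xi| <= z ^+ 2 / (2 * t) + t / 2 * xi ^+ 2; last by lra.
    have h (a : R) : a = z * xi \/ a = - (z * xi) -> a <= z ^+ 2 / (2 * t) + t / 2 * xi ^+ 2.
      move=> ha; rewrite -subr_ge0.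
      have [e|e] := ha; rewrite e.
        rewrite (_ : _ - _ = (z - t * xi) ^+ 2 / (2 * t)); last by field; rewrite gt_eqF.
        by rewrite divr_ge0 ?sqr_ge0// mulr_ge0// ltW.
      rewrite (_ : _ - _ = (z + t * xi) ^+ 2 / (2 * t)); last by field; rewrite gt_eqF.
      by rewrite divr_ge0 ?sqr_ge0// mulr_ge0// ltW.
    by apply/ler_normlP; split; apply: h; [right|left].
have E N : \int[hmu al]_xi (expR (- (t * xi ^+ 2)) * jpart al N (z * xi)) =
    (2 * t) `^ (- (al + 1)) * series (exp_coeff (- (z ^+ 2 / (4 * t)))) N.
  have ii n : (hmu al).-integrable setT (EFin \o (fun xi => ((-1) ^+ n * jc n * z ^+ (2 * n)) * (xi ^+ (2 * n) * expR (- (t * xi ^+ 2))))).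
    exact: (integrableZl measurableT ((-1) ^+ n * jc n * z ^+ (2 * n)) (integrable_gauss n t0)).
  have e xi : expR (- (t * xi ^+ 2)) * jpart al N (z * xi) =
     \sum_(n < N) ((-1) ^+ n * jc n * z ^+ (2 * n)) * (xi ^+ (2 * n) * expR (- (t * xi ^+ 2))).
    by rewrite mulr_sumr; apply: eq_bigr => n _; rewrite exprMn; ring.
  under eq_Rintegral do rewrite e.
  rewrite (proj2 (Rint_sum _ ii)) /series/= big_mkord mulr_sumr; apply: eq_bigr => n _.
  rewrite (RintegralZl _ measurableT (integrable_gauss n t0)) /Rintegral gauss_hmu//=.
  rewrite [exp_coeff _ n](_ : _ = (- (z ^+ 2 / (4 * t))) ^+ n / n`!%:R)// (exprNn (z ^+ 2 / (4 * t))) expr_div_n -exprM (exprMn n 4 t) /cb.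
  have pz : poch (al + 1) n != 0 by rewrite gt_eqF// poch_gt0.
  have nz : n`!%:R != 0 :> R by rewrite pnatr_eq0 -lt0n fact_gt0.
  have f4 : (4 : R) ^+ n != 0 by rewrite expf_neq0.
  have tn : t ^+ n != 0 by rewrite expf_neq0 ?gt_eqF.
  move: pz nz f4 tn; move: (t ^+ n) ((4 : R) ^+ n) (n`!%:R : R) (poch (al + 1) n) => A B C D *.
  by field; do ?[apply/andP; split].
rewrite (funext E) in L1; apply: (cvg_unique (@Rhausdorff R) L1).
by apply: cvgMr; exact: is_cvg_series_exp_coeff.
Qed.

End product_formula.

Section integrable_tools.
Context {R : realType}.

Lemma integrable_meas d (T : measurableType d) (m : {measure set T -> \bar R}) (F : T -> R) :
  m.-integrable setT (EFin \o F) -> measurable_fun setT F.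
Proof. by move=> iF; apply/measurable_EFinP; exact: measurable_int _ iF. Qed.

Lemma integrable_mul_bounded d (T : measurableType d) (m : {measure set T -> \bar R})
    (F h : T -> R) B :
  m.-integrable setT (EFin \o F) -> measurable_fun setT h -> (forall x, `|h x| <= B) ->
  m.-integrable setT (EFin \o (fun x => F x * h x)).
Proof.
move=> iF mh hB; have mF := integrable_meas iF.
apply: (@le_integrable _ _ _ m _ measurableT _ (fun x => B%:E * (`|F x|)%:E)%E).
- by meas.
- move=> x _; rewrite !abse_EFin lee_fin !normrM mulrC normr_id ler_wpM2r//.
  by rewrite (le_trans (hB x))// ler_norm.
- by apply: integrableZl => //; exact: integrable_abse iF.
Qed.

End integrable_tools.

(** * The Bessel heat semigroup *)

Section heat_kernel.
Context {R : realType}.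
Variable al : R.
Hypothesis al_gt : - 2^-1 < al.
Implicit Types x y z s t xi : R.
Implicit Types F G : R -> R.

Local Notation mu := (hmu al).

Lemma hmu_ae_pos : {ae mu, forall x, 0 < x}.
Proof.
exists [set x | ~ (0 < x)]; split => //.
  rewrite [X in measurable X](_ : _ = `]-oo, 0]%classic); last first.
    by apply/seteqP; split => x /=; rewrite in_itv/= leNgt => /negP.
  exact: measurable_itv.
rewrite /hmu/= /mdens integral_mkcond; apply: integral0_eq => x _.
rewrite patchE; case: ifPn => // /set_mem/= /negP/negbTE x0.
by rewrite /dmu x0 normr0.
Qed.

(** The heat kernel issued from the origin: the transform of [expR (- (s * xi^2))], whose prefactor
    gives it mass 1 for [hmu]. *)
Definition hq s z : R := (2 * s) `^ (- (al + 1)) * expR (- (z ^+ 2 / (4 * s))).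

Definition hp s x y : R := \int[hsig al]_th hq s (rr x y th).

Lemma hq_ge0 s z : 0 <= hq s z.
Proof. by rewrite mulr_ge0 ?powR_ge0 ?expR_ge0. Qed.

Lemma hq_le s z : 0 < s -> hq s z <= (2 * s) `^ (- (al + 1)).
Proof.
move=> s0; rewrite ler_piMr ?powR_ge0// -[leRHS]expR0 ler_expR oppr_le0.
by rewrite divr_ge0 ?sqr_ge0// mulr_ge0// ltW.
Qed.

Lemma measurable_hq s : measurable_fun setT (hq s).
Proof. by rewrite /hq; meas. Qed.

Lemma measurable_hq_rr s : measurable_fun setT (fun p : (R * R) * R => hq s (rr p.1.1 p.1.2 p.2)).
Proof.
apply: (measurableT_comp (measurable_hq s)).
by apply: measurable_fun_rr; meas.
Qed.

Lemma integrable_hq_rr s x y : 0 < s ->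
  (hsig al).-integrable setT (EFin \o (fun th => hq s (rr x y th))).
Proof.
move=> s0; apply: (@integrable_hsig _ _ al_gt _ ((2 * s) `^ (- (al + 1)))).
  exact: (measurableT_comp (measurable_hq_rr s) (measurable_pair1 (x, y))).
by move=> th; rewrite ger0_norm ?hq_ge0 ?hq_le.
Qed.

Lemma measurable_hp s : measurable_fun setT (fun p : R * R => hp s p.1 p.2).
Proof.
exact: (@measurable_Rint _ _ _ _ _ (hsig al) (fun (p : R * R) th => hq s (rr p.1 p.2 th)) (measurable_hq_rr s)).
Qed.

Lemma measurable_hp1 s x : measurable_fun setT (hp s x).
Proof. exact: (measurableT_comp (measurable_hp s) (measurable_pair1 x)). Qed.

Lemma hp_ge0 s x y : 0 <= hp s x y.
Proof. by apply: Rintegral_ge0 => // th _; exact: hq_ge0. Qed.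

Lemma Rint_hsig_cst c : \int[hsig al]_th c = c.
Proof.
rewrite /Rintegral integral_cst//.
by change (fine (c%:E * hsig al setT) = c); rewrite hsig_setT// mule1.
Qed.

Lemma hp_le s x y : 0 < s -> hp s x y <= (2 * s) `^ (- (al + 1)).
Proof.
move=> s0; rewrite -[leRHS]Rint_hsig_cst; apply: le_Rintegral => //.
- exact: integrable_hq_rr.
- apply: (@integrable_hsig _ _ al_gt _ ((2 * s) `^ (- (al + 1)))) => // th.
  by rewrite ger0_norm ?powR_ge0.
- by move=> th _; exact: hq_le.
Qed.

Lemma hpC s x y : hp s x y = hp s y x.
Proof. by apply: eq_Rintegral => th _; rewrite rrC. Qed.

Lemma measurable_jal2 : measurable_fun setT (fun p : R * R => jal al (p.1 * p.2)).
Proof. by have mj := measurable_jal al_gt; meas. Qed.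

Lemma integrable_gauss_jal s x : 0 < s ->
  mu.-integrable setT (EFin \o (fun xi => expR (- (s * xi ^+ 2)) * jal al (x * xi))).
Proof.
move=> s0; apply: (@integrable_mul_bounded _ _ _ _ _ _ 1 (integrable_gauss0 al_gt s0)).
  by have mj := measurable_jal al_gt; meas.
by move=> xi; exact: jal_le1.
Qed.

Lemma hq_spectral s z : 0 < s ->
  hq s z = \int[mu]_xi (expR (- (s * xi ^+ 2)) * jal al (z * xi)).
Proof. by move=> s0; rewrite (gauss_transform al_gt). Qed.

(** Averaging over the angle under the spectral integral splits [jal] at [rr x y th] into a product,
    by the product formula. *)
Lemma hp_spectral s x y : 0 < s ->
  hp s x y = \int[mu]_xi (expR (- (s * xi ^+ 2)) * jal al (x * xi) * jal al (y * xi)).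
Proof.
move=> s0.
pose k (th xi : R) := jal al (rr x y th * xi).
have mk : measurable_fun setT (fun p : R * R => k p.1 p.2).
  rewrite /k; have mj := measurable_jal al_gt.
  have mr : measurable_fun setT (fun p : R * R => rr x y p.1) by apply: measurable_fun_rr; meas.
  by meas.
have i1 : (hsig al).-integrable setT (EFin \o (fun=> 1 : R)).
  by apply: (@integrable_hsig _ _ al_gt _ 1) => // th; rewrite normr1.
have B := @Rint_bilinear _ _ _ _ _ (hsig al) mu (fun=> 1) (fun xi => expR (- (s * xi ^+ 2))) k 1
  i1 (integrable_gauss0 al_gt s0) mk (fun th xi => jal_le1 al_gt _).
transitivity (\int[hsig al]_th (1 * \int[mu]_xi (expR (- (s * xi ^+ 2)) * k th xi))).
  by apply: eq_Rintegral => th _; rewrite mul1r hq_spectral.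
rewrite B; apply: eq_Rintegral => xi _.
rewrite -mulrA -(product_formula al_gt); congr (_ * _).
by apply: eq_Rintegral => th _; rewrite mul1r /k mulrC.
Qed.

Lemma hq_mass s : 0 < s -> (\int[mu]_y (hq s y)%:E = 1)%E.
Proof.
move=> s0; have t0 : 0 < (4 * s)^-1 by rewrite invr_gt0 mulr_gt0.
transitivity ((((2 * s) `^ (- (al + 1)))%:E * \int[mu]_y (y ^+ (2 * 0) * expR (- ((4 * s)^-1 * y ^+ 2)))%:E)%E).
  rewrite -ge0_integralZl_EFin ?powR_ge0//.
  - by apply: eq_integral => y _; rewrite -EFinM /hq muln0 expr0 mul1r [(4 * s)^-1 * _]mulrC.
  - by move=> y _; rewrite lee_fin muln0 expr0 mul1r expR_ge0.
  - by meas.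
rewrite gauss_hmu// -EFinM expr0 divr1 mulr1 -powRM; last 2 first.
- by rewrite mulr_ge0// ltW.
- by rewrite mulr_ge0// ltW.
rewrite (_ : 2 * s * _ = 1) ?powR1//.
by field; rewrite gt_eqF.
Qed.

(** By [translation_exchange] the radius [rr x y th] may be replaced by [y], which reduces the mass
    to that of the kernel at the origin. *)
Lemma hp_mass s x : 0 < s -> (\int[mu]_y (hp s x y)%:E = 1)%E.
Proof.
move=> s0.
have mq := measurable_hq s.
have E y : ((hp s x y)%:E = \int[hsig al]_th (hq s (rr x y th))%:E)%E.
  by rewrite /hp /Rintegral fineK//; apply: integrable_fin_num => //; exact: integrable_hq_rr.
under eq_integral do rewrite E.
have -> : (\int[mu]_y \int[hsig al]_th (hq s (rr x y th))%:E = \int[mu]_y \int[hsig al]_th (hq s y)%:E)%E.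
  apply: (translation_exchange al_gt x (K := fun p => (hq s p.2)%:E)).
    by meas.
  by move=> p; rewrite lee_fin hq_ge0.
rewrite -(hq_mass s0); apply: eq_integral => y _.
rewrite integral_cst//.
by change ((hq s y)%:E * hsig al setT = (hq s y)%:E)%E; rewrite hsig_setT// mule1.
Qed.

Lemma integrable_hp s x : 0 < s -> mu.-integrable setT (EFin \o hp s x).
Proof.
move=> s0; apply/integrableP; split; first by apply/measurable_EFinP; exact: measurable_hp1.
rewrite (eq_integral (fun y => (hp s x y)%:E)) ?hp_mass ?ltry//.
by move=> y _; rewrite /= ger0_norm ?hp_ge0.
Qed.

Lemma Rint_hp s x : 0 < s -> \int[mu]_y hp s x y = 1.
Proof. by move=> s0; rewrite /Rintegral hp_mass. Qed.

Lemma integrable_hq s : 0 < s -> mu.-integrable setT (EFin \o hq s).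
Proof.
move=> s0; apply/integrableP; split; first by apply/measurable_EFinP; exact: measurable_hq.
rewrite (eq_integral (fun y => (hq s y)%:E)) ?hq_mass ?ltry//.
by move=> y _; rewrite /= ger0_norm ?hq_ge0.
Qed.

Lemma hq_transform s xi : 0 < s -> \int[mu]_y (hq s y * jal al (y * xi)) = expR (- (s * xi ^+ 2)).
Proof.
move=> s0; have t0 : 0 < (4 * s)^-1 by rewrite invr_gt0 mulr_gt0.
transitivity (\int[mu]_y ((2 * s) `^ (- (al + 1)) * (expR (- ((4 * s)^-1 * y ^+ 2)) * jal al (xi * y)))).
  by apply: eq_Rintegral => y _; rewrite /hq mulrA [(4 * s)^-1 * _]mulrC [y * xi]mulrC.
rewrite (RintegralZl _ measurableT (integrable_gauss_jal _ t0)) (gauss_transform al_gt)//.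
rewrite mulrA -powRM; last 2 first.
- by rewrite mulr_ge0// ltW.
- by rewrite mulr_ge0// ltW.
rewrite (_ : 2 * s * _ = 1); last by field; rewrite gt_eqF.
rewrite powR1 mul1r; congr (expR (- _)); field; rewrite gt_eqF//.
Qed.

(** On the spectral side the two Gaussian multipliers multiply, so the times add. *)
Lemma hp_hq s t x : 0 < s -> 0 < t ->
  \int[mu]_y (hq t y * hp s x y) = hq (s + t) x.
Proof.
move=> s0 t0.
have B := @Rint_bilinear _ _ _ _ _ mu mu (hq t) (fun xi => expR (- (s * xi ^+ 2)) * jal al (x * xi))
  (fun y xi => jal al (y * xi)) 1 (integrable_hq t0) (integrable_gauss_jal x s0) measurable_jal2 (fun th xi => jal_le1 al_gt _).
have E y : hq t y * hp s x y = hq t y * \int[mu]_xi (expR (- (s * xi ^+ 2)) * jal al (x * xi) * jal al (y * xi)).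
  by rewrite hp_spectral.
transitivity (\int[mu]_y (hq t y * \int[mu]_xi (expR (- (s * xi ^+ 2)) * jal al (x * xi) * jal al (y * xi)))); first by apply: eq_Rintegral => y _; exact: E.
rewrite B (hq_spectral _ (addr_gt0 s0 t0)); apply: eq_Rintegral => xi _.
rewrite (hq_transform _ t0) mulrAC -expRD.
by have -> : - (s * xi ^+ 2) + - (t * xi ^+ 2) = - ((s + t) * xi ^+ 2) by ring.
Qed.

Lemma rr_ge x y th : 0 < x -> 0 < y -> (x - y) ^+ 2 <= rr x y th ^+ 2.
Proof.
move=> x0 y0; rewrite rr_sqr.
have := cos_geN1 th => h.
have : 0 <= x * y * (1 + cos th) by rewrite !mulr_ge0 ?(ltW x0) ?(ltW y0)//; lra.
by nra.
Qed.

(** The Gaussian factor is split in two. One half is small because [rr] is at least [|x - y|] and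
    [expR (- u) <= u^-1]; the other half is the kernel at time [2 * s], and [2^(al + 1)] compares
    the two normalisations. *)
Lemma hp_off s x y d : 0 < s -> 0 < x -> 0 < y -> 0 < d -> d <= `|x - y| ->
  hp s x y <= 2 `^ (al + 1) * (8 * s / d ^+ 2) * hp (2 * s) x y.
Proof.
move=> s0 x0 y0 d0 dxy; have s20 : 0 < 2 * s by rewrite mulr_gt0.
rewrite -(RintegralZl _ measurableT (integrable_hq_rr x y s20)).
apply: le_Rintegral => //.
- exact: integrable_hq_rr.
- exact: (integrableZl measurableT (2 `^ (al + 1) * (8 * s / d ^+ 2)) (integrable_hq_rr x y s20)).
move=> th _; rewrite /hq.
set r := rr x y th.
have -> : (2 * (2 * s)) `^ (- (al + 1)) = (2 `^ (al + 1))^-1 * (2 * s) `^ (- (al + 1)).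
  by rewrite powRM ?(ltW s20)// powRN.
have -> : expR (- (r ^+ 2 / (4 * s))) = expR (- (r ^+ 2 / (8 * s))) * expR (- (r ^+ 2 / (4 * (2 * s)))).
  by rewrite -expRD; congr expR; field; rewrite gt_eqF.
have e : expR (- (r ^+ 2 / (8 * s))) <= 8 * s / d ^+ 2.
  rewrite expRN -[leRHS]invrK lef_pV2 ?posrE ?expR_gt0 ?invr_gt0 ?divr_gt0 ?mulr_gt0 ?exprn_gt0//.
  rewrite invf_div; apply: le_trans (expR_ge1Dx _).
  apply: (@le_trans _ _ (r ^+ 2 / (8 * s))); last by lra.
  rewrite ler_pM2r ?invr_gt0 ?mulr_gt0//.
  apply: le_trans (rr_ge th x0 y0); rewrite -[leRHS]real_normK ?num_real//.
  by rewrite lerXn2r ?nnegrE// ltW.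
set P := (2 * s) `^ (- (al + 1)); set Q := expR (- (r ^+ 2 / (4 * (2 * s)))).
have p2 : 2 `^ (al + 1) != 0 :> R by rewrite gt_eqF// powR_gt0.
rewrite [leRHS](_ : _ = 8 * s / d ^+ 2 * (P * Q)); last by field; rewrite p2 gt_eqF.
rewrite [leLHS](_ : _ = expR (- (r ^+ 2 / (8 * s))) * (P * Q)); last by ring.
by rewrite ler_wpM2r// mulr_ge0 ?powR_ge0 ?expR_ge0.
Qed.

Definition Hk F xi : R := \int[mu]_x (F x * jal al (x * xi)).

Lemma measurable_Hk F : measurable_fun setT F -> measurable_fun setT (Hk F).
Proof.
move=> mF; apply: (@measurable_Rint _ _ _ _ _ mu (fun xi x => F x * jal al (x * xi))).
by have mj := measurable_jal al_gt; meas.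
Qed.

Lemma integrable_jal F xi : mu.-integrable setT (EFin \o F) ->
  mu.-integrable setT (EFin \o (fun x => F x * jal al (x * xi))).
Proof.
move=> iF; apply: (@integrable_mul_bounded _ _ _ _ _ _ 1 iF).
  by have mj := measurable_jal al_gt; meas.
by move=> x; exact: jal_le1.
Qed.

Lemma Hk_le F xi : mu.-integrable setT (EFin \o F) -> `|Hk F xi| <= \int[mu]_x `|F x|.
Proof.
move=> iF; apply: le_trans (le_normr_Rintegral _ _) _ => //; first exact: integrable_jal.
apply: le_Rintegral => //.
- exact: integrable_norm (integrable_jal xi iF).
- exact: integrable_norm.
- by move=> x _; rewrite normrM ler_piMr// jal_le1.
Qed.

(** For integrable [F] this is Fubini and nothing more, so it can be used to prove Plancherel's
    theorem. *)
Lemma hp_bilinear s F : 0 < s -> mu.-integrable setT (EFin \o F) ->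
  \int[mu]_x (F x * \int[mu]_y (F y * hp s x y)) =
  \int[mu]_xi (expR (- (s * xi ^+ 2)) * Hk F xi * Hk F xi).
Proof.
move=> s0 iF; have mF := integrable_meas iF.
have E x : \int[mu]_y (F y * hp s x y) =
    \int[mu]_xi ((expR (- (s * xi ^+ 2)) * Hk F xi) * jal al (x * xi)).
  have B := @Rint_bilinear _ _ _ _ _ mu mu F (fun xi => expR (- (s * xi ^+ 2)) * jal al (x * xi))
    (fun y xi => jal al (y * xi)) 1 iF (integrable_gauss_jal x s0) measurable_jal2 (fun th xi => jal_le1 al_gt _).
  have e y : F y * hp s x y = F y * \int[mu]_xi (expR (- (s * xi ^+ 2)) * jal al (x * xi) * jal al (y * xi)).
    by rewrite hp_spectral.
  transitivity (\int[mu]_y (F y * \int[mu]_xi (expR (- (s * xi ^+ 2)) * jal al (x * xi) * jal al (y * xi)))); first by apply: eq_Rintegral => y _; exact: e.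
  by rewrite B; apply: eq_Rintegral => xi _; rewrite mulrAC.
have iH : mu.-integrable setT (EFin \o (fun xi => expR (- (s * xi ^+ 2)) * Hk F xi)).
  apply: (integrable_mul_bounded (integrable_gauss0 al_gt s0) (measurable_Hk mF)).
  by move=> xi; exact: Hk_le.
have B := @Rint_bilinear _ _ _ _ _ mu mu F (fun xi => expR (- (s * xi ^+ 2)) * Hk F xi)
    (fun y xi => jal al (y * xi)) 1 iF iH measurable_jal2 (fun th xi => jal_le1 al_gt _).
under eq_Rintegral do rewrite E.
by apply: (etrans B); apply: eq_Rintegral.
Qed.

End heat_kernel.

Section integrable_tools2.
Context {R : realType} d (T : measurableType d) (m : {measure set T -> \bar R}).
Implicit Types f g : T -> R.

Lemma integrable_add f g : m.-integrable setT (EFin \o f) ->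
  m.-integrable setT (EFin \o g) -> m.-integrable setT (EFin \o (fun x => f x + g x)).
Proof. exact: integrableD. Qed.

Lemma integrable_sub f g : m.-integrable setT (EFin \o f) ->
  m.-integrable setT (EFin \o g) -> m.-integrable setT (EFin \o (fun x => f x - g x)).
Proof. exact: integrableB. Qed.

Lemma integrable_ge0 f : measurable_fun setT f -> (forall x, 0 <= f x) ->
  m.-integrable setT (EFin \o f) <-> (\int[m]_x (f x)%:E < +oo)%E.
Proof.
move=> mf f0.
have E : (\int[m]_x `|(EFin \o f) x| = \int[m]_x (f x)%:E)%E.
  by apply: eq_integral => x _; rewrite /= ger0_norm.
split; first by move/integrableP => [_]; rewrite E.
by move=> h; apply/integrableP; split; [exact/measurable_EFinP|rewrite E].
Qed.

Lemma integral_EFin f : m.-integrable setT (EFin \o f) ->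
  (\int[m]_x (f x)%:E = (\int[m]_x f x)%R%:E)%E.
Proof. by move=> h; rewrite /Rintegral fineK//; exact: integrable_fin_num. Qed.

End integrable_tools2.

(** * The energy form of the heat semigroup *)

Section energy.
Context {R : realType}.
Variable al : R.
Hypothesis al_gt : - 2^-1 < al.
Implicit Types x y z s t xi : R.
Implicit Types F G : R -> R.

Local Notation mu := (hmu al).
Local Notation mu2 := (hmu al \x hmu al)%E.

Lemma eq_integral_hmu (f g : R -> \bar R) :
  measurable_fun setT f -> measurable_fun setT g ->
  (forall x, 0 < x -> f x = g x) ->
  (\int[mu]_x f x = \int[mu]_x g x)%E.
Proof.
move=> mf mg fg; rewrite !(integral_hmu al_gt)//; apply: eq_integral => x _.
by have [x0|x0] := ltP 0 x; [rewrite fg|rewrite /dmu ltNge x0/= !mul0e].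
Qed.

Lemma le_Rint_hmu (f g : R -> R) :
  mu.-integrable setT (EFin \o f) -> mu.-integrable setT (EFin \o g) ->
  (forall x, 0 < x -> f x <= g x) ->
  \int[mu]_x f x <= \int[mu]_x g x.
Proof.
move=> iF iG fg; have mf := integrable_meas iF; have mg := integrable_meas iG.
pose h x := if 0 < x then f x else g x.
have mh : measurable_fun setT h by rewrite /h; meas.
have -> : \int[mu]_x f x = \int[mu]_x h x.
  by congr fine; apply: eq_integral_hmu; [meas|meas|move=> x x0; rewrite /h x0].
apply: le_Rintegral => //; last first.
  by move=> x _; rewrite /h; case: ifP => // x0; exact: fg.
have iFG : mu.-integrable setT (EFin \o (fun x => `|f x| + `|g x|)).
  by apply: integrable_add; exact: integrable_norm.
apply: (@le_integrable _ _ _ mu _ measurableT _ (EFin \o (fun x => `|f x| + `|g x|))) => //.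
- by meas.
- move=> x _; rewrite lee_fin [leRHS]ger0_norm ?addr_ge0// /h.
  by case: ifP => _; rewrite ?lerDl ?lerDr.
Qed.

Lemma integral_hp1 s (f : R -> R) : 0 < s -> measurable_fun setT f -> (forall x, 0 <= f x) ->
  (\int[mu2]_p (f p.1 * hp al s p.1 p.2)%:E = \int[mu]_x (f x)%:E)%E.
Proof.
move=> s0 mf f0; have mp := measurable_hp al s.
rewrite fubini_tonelli1; last 2 first.
- by meas.
- by move=> p; rewrite lee_fin mulr_ge0 ?hp_ge0.
apply: eq_integral => x _; rewrite /fubini_F/=.
under eq_integral do rewrite EFinM.
rewrite ge0_integralZl_EFin//; last 2 first.
- by move=> y _; rewrite lee_fin hp_ge0.
- by apply/measurable_EFinP; exact: measurable_hp1.
by rewrite hp_mass// mule1.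
Qed.

Lemma integral_hp2 s (f : R -> R) : 0 < s -> measurable_fun setT f -> (forall x, 0 <= f x) ->
  (\int[mu2]_p (f p.2 * hp al s p.1 p.2)%:E = \int[mu]_x (f x)%:E)%E.
Proof.
move=> s0 mf f0; have mp := measurable_hp al s.
rewrite fubini_tonelli2; last 2 first.
- by meas.
- by move=> p; rewrite lee_fin mulr_ge0 ?hp_ge0.
apply: eq_integral => x _; rewrite /fubini_G/=.
under eq_integral do rewrite EFinM hpC.
rewrite ge0_integralZl_EFin//; last 2 first.
- by move=> y _; rewrite lee_fin hp_ge0.
- by apply/measurable_EFinP; exact: measurable_hp1.
by rewrite hp_mass// mule1.
Qed.

(* twice the quadratic form [<F - P_s F, F>], defined for every measurable [F] *)
Definition En s F : \bar R := (\int[mu2]_p ((F p.1 - F p.2) ^+ 2 * hp al s p.1 p.2)%:E)%E.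

Lemma measurable_En s F : measurable_fun setT F ->
  measurable_fun setT (fun p : R * R => (F p.1 - F p.2) ^+ 2 * hp al s p.1 p.2).
Proof. by move=> mF; have mp := measurable_hp al s; meas. Qed.

(** The kernel has mass 1 in either variable. The constant is independent of [s], as the density
    argument for [En_cvg0] requires. *)
Lemma En_le s F : 0 < s -> measurable_fun setT F ->
  (En s F <= 4%:E * \int[mu]_x (F x ^+ 2)%:E)%E.
Proof.
move=> s0 mF; have mp := measurable_hp al s; have mE := measurable_En s mF.
apply: (@le_trans _ _ (\int[mu2]_p (((2 * F p.1 ^+ 2) * hp al s p.1 p.2)%:E + ((2 * F p.2 ^+ 2) * hp al s p.1 p.2)%:E))%E).
  apply: ge0_le_integral => //.
  - by move=> p _; rewrite lee_fin mulr_ge0 ?sqr_ge0 ?hp_ge0.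
  - by apply/measurable_EFinP.
  - by apply: emeasurable_funD; meas.
  - move=> p _; rewrite -EFinD lee_fin -mulrDl ler_wpM2r ?hp_ge0//.
    by have := sqr_ge0 (F p.1 + F p.2); nra.
have sq0 x : 0 <= 2 * F x ^+ 2 by rewrite mulr_ge0 ?sqr_ge0.
rewrite ge0_integralD//; last 4 first.
- by move=> p _; rewrite lee_fin mulr_ge0 ?hp_ge0.
- by meas.
- by move=> p _; rewrite lee_fin mulr_ge0 ?hp_ge0.
- by meas.
rewrite (@integral_hp1 s (fun x => 2 * F x ^+ 2))//; last by meas.
rewrite (@integral_hp2 s (fun x => 2 * F x ^+ 2))//; last by meas.
under eq_integral do rewrite EFinM.
rewrite ge0_integralZl_EFin//; last 2 first.
- by move=> x _; rewrite lee_fin sqr_ge0.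
- by meas.
rewrite -ge0_muleDl ?lee_fin//.
by rewrite -EFinD (_ : 2 + 2 = 4 :> R)// -natrD.
Qed.

Lemma En_tri s F G : 0 < s -> measurable_fun setT F -> measurable_fun setT G ->
  (En s F <= 2%:E * En s G + 2%:E * En s (fun x => F x - G x)%R)%E.
Proof.
move=> s0 mF mG; have mp := measurable_hp al s; have mE := measurable_En s mF.
have mE1 := measurable_En s mG.
have mFG : measurable_fun setT (fun x => F x - G x)%R by meas.
have mE2 := measurable_En s mFG.
have z (H : R -> R) (p : R * R) : (0 <= ((H p.1 - H p.2) ^+ 2 * hp al s p.1 p.2)%:E)%E.
  by rewrite lee_fin mulr_ge0 ?sqr_ge0 ?hp_ge0.
rewrite /En -!ge0_integralZl_EFin//; try by [move=> p _; exact: z|move=> p _; exact: (z (fun x => F x - G x))|meas].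
rewrite -ge0_integralD//; try by [move=> p _; rewrite mule_ge0// ?z|move=> p _; rewrite mule_ge0// (z (fun x => F x - G x))|meas].
apply: ge0_le_integral => //.
- by apply/measurable_EFinP.
- by apply: emeasurable_funD; apply: emeasurable_funM; meas.
- move=> p _; rewrite -!EFinM -EFinD lee_fin !mulrA -mulrDl ler_wpM2r ?hp_ge0//.
  have := sqr_ge0 ((G p.1 - G p.2) - (F p.1 - G p.1 - (F p.2 - G p.2))); nra.
Qed.

Lemma energy_id_hp s F : 0 < s -> mu.-integrable setT (EFin \o F) ->
  mu.-integrable setT (EFin \o (fun x => F x ^+ 2)) ->
  En s F = (2 * (\int[mu]_x (F x ^+ 2) - \int[mu]_x (F x * \int[mu]_y (F y * hp al s x y))))%:E.
Proof.
move=> s0 iF iF2; have mF := integrable_meas iF; have mp := measurable_hp al s.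
have sq0 x : 0 <= F x ^+ 2 by exact: sqr_ge0.
have msq : measurable_fun setT (fun x => F x ^+ 2) by meas.
have fin2 : (\int[mu]_x (F x ^+ 2)%:E < +oo)%E.
  move/integrableP : iF2 => [_]; rewrite (eq_integral (fun x => (F x ^+ 2)%:E))// => x _.
  by rewrite /= ger0_norm.
have i1 : mu2.-integrable setT (EFin \o (fun p => F p.1 ^+ 2 * hp al s p.1 p.2)).
  apply/integrableP; split; first by meas.
  rewrite (eq_integral (fun p => (F p.1 ^+ 2 * hp al s p.1 p.2)%:E)) ?(integral_hp1 s0 msq)// => p _.
  by rewrite /= ger0_norm// mulr_ge0 ?hp_ge0.
have i2 : mu2.-integrable setT (EFin \o (fun p => F p.2 ^+ 2 * hp al s p.1 p.2)).
  apply/integrableP; split; first by meas.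
  rewrite (eq_integral (fun p => (F p.2 ^+ 2 * hp al s p.1 p.2)%:E)) ?(integral_hp2 s0 msq)// => p _.
  by rewrite /= ger0_norm// mulr_ge0 ?hp_ge0.
have hpB x y : `|hp al s x y| <= (2 * s) `^ (- (al + 1)) by rewrite ger0_norm ?hp_ge0 ?hp_le.
have i3 := integrable_prod_bounded iF iF mp hpB.
have i4 : mu2.-integrable setT (EFin \o (fun p => 2 * (F p.1 * (F p.2 * hp al s p.1 p.2)))).
  exact: (integrableZl measurableT 2 i3).
have i12 : mu2.-integrable setT (EFin \o (fun p => F p.1 ^+ 2 * hp al s p.1 p.2 + F p.2 ^+ 2 * hp al s p.1 p.2)).
  exact: integrable_add.
have iE : mu2.-integrable setT (EFin \o (fun p => F p.1 ^+ 2 * hp al s p.1 p.2 + F p.2 ^+ 2 * hp al s p.1 p.2 - 2 * (F p.1 * (F p.2 * hp al s p.1 p.2)))).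
  exact: integrable_sub.
have -> : En s F = (\int[mu2]_p (F p.1 ^+ 2 * hp al s p.1 p.2 + F p.2 ^+ 2 * hp al s p.1 p.2 - 2 * (F p.1 * (F p.2 * hp al s p.1 p.2))))%:E.
  rewrite /En [in RHS]/Rintegral fineK; last exact: integrable_fin_num.
  by apply: eq_integral => p _; congr EFin; ring.
congr EFin.
rewrite (RintegralB measurableT i12 i4) (RintegralD measurableT i1 i2) (RintegralZl _ measurableT i3).
rewrite [X in X + _ - _](_ : _ = \int[mu]_x (F x ^+ 2)); last by congr fine; exact: integral_hp1.
rewrite [X in _ + X - _](_ : _ = \int[mu]_x (F x ^+ 2)); last by congr fine; exact: integral_hp2.
rewrite [X in _ - 2 * X](_ : _ = \int[mu]_x (F x * \int[mu]_y (F y * hp al s x y))).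
  by move: (Rintegral _ _ _) (Rintegral _ _ _) => A B; ring.
apply: (etrans (esym (Rint_fubini12 (f := fun x y => F x * (F y * hp al s x y)) i3))).
apply: eq_Rintegral => x _; apply: (RintegralZl _ measurableT).
exact: (integrable_mul_bounded iF (measurable_hp1 al s x) (hpB x)).
Qed.

Lemma energy_id s F : 0 < s -> mu.-integrable setT (EFin \o F) ->
  mu.-integrable setT (EFin \o (fun x => F x ^+ 2)) ->
  En s F = (2 * (\int[mu]_x (F x ^+ 2) - \int[mu]_xi (expR (- (s * xi ^+ 2)) * Hk al F xi * Hk al F xi)))%:E.
Proof. by move=> s0 iF iF2; rewrite (energy_id_hp s0 iF iF2) (hp_bilinear al_gt s0 iF). Qed.

End energy.

Lemma integrable_absr (R : realType) d (T : measurableType d) (m : {measure set T -> \bar R})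
    (f : T -> R) :
  m.-integrable setT (EFin \o f) -> m.-integrable setT (EFin \o (fun x => `|f x|)).
Proof. exact: integrable_norm. Qed.

Section plancherel.
Context {R : realType}.
Variable al : R.
Hypothesis al_gt : - 2^-1 < al.
Implicit Types x y z s t xi B N c r e : R.
Implicit Types F G g : R -> R.

Local Notation mu := (hmu al).

Lemma harmonic_gt0 n : 0 < harmonic n :> R.
Proof. by rewrite invr_gt0 ltr0n. Qed.

Lemma integrable_supported g B N : measurable_fun setT g -> (forall x, `|g x| <= B) ->
  (forall x, ~~ (0 < x < N) -> g x = 0) -> mu.-integrable setT (EFin \o g).
Proof.
move=> mg gB gN; have B0 : 0 <= B by exact: le_trans (gB 0).
(* On the support [x^2 < N^2], so this multiple of a Gaussian is at least [B] there. *)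
have i1 := integrableZl measurableT (B * expR (N ^+ 2)) (integrable_gauss0 al_gt (ltr01)).
apply: (@le_integrable _ _ _ mu _ measurableT _ _ _ _ i1).
  by apply/measurable_EFinP.
move=> x _; rewrite lee_fin [leRHS]ger0_norm ?mulr_ge0 ?expR_ge0//.
have [/andP[x0 xN]|xN] := boolP (0 < x < N); last by rewrite gN// normr0 !mulr_ge0 ?expR_ge0.
apply: le_trans (gB x) _; rewrite -mulrA ler_peMr// -expRD -[leLHS]expR0 ler_expR mul1r subr_ge0.
by rewrite lerXn2r ?nnegrE ?ltW// (lt_trans x0).
Qed.

Lemma hp_le_avg s g B x : 0 < s -> measurable_fun setT g -> (forall x, `|g x| <= B) ->
  mu.-integrable setT (EFin \o (fun y => g y * hp al s x y)) /\
  `|\int[mu]_y (g y * hp al s x y)| <= B.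
Proof.
move=> s0 mg gB.
have i0 : mu.-integrable setT (EFin \o (fun y => hp al s x y * g y)).
  exact: (integrable_mul_bounded (integrable_hp al_gt x s0) mg gB).
have e : (fun y => hp al s x y * g y) = (fun y => g y * hp al s x y).
  by apply/funext => y; rewrite mulrC.
rewrite e in i0; split => //.
have iB : mu.-integrable setT (EFin \o (fun y => B * hp al s x y)).
  exact: (integrableZl measurableT B (integrable_hp al_gt x s0)).
apply: le_trans (le_normr_Rintegral measurableT i0) _.
apply: (@le_trans _ _ (\int[mu]_y (B * hp al s x y))).
  apply: (le_Rintegral measurableT (integrable_absr i0) iB) => y _.
  by rewrite normrM [X in _ * X <= _]ger0_norm ?hp_ge0// ler_wpM2r ?hp_ge0.
by rewrite (RintegralZl _ measurableT (integrable_hp al_gt x s0)) (Rint_hp al_gt x s0) mulr1.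
Qed.

(** The kernel is an approximate identity. Near [x] continuity of [g] and mass 1 suffice; at
    distance at least [d], [hp_off] leaves a factor [s] times the kernel at time [2 * s], again of
    mass 1. *)
Lemma hp_approx g B x : measurable_fun setT g -> (forall x, `|g x| <= B) ->
  0 < x -> {for x, continuous g} ->
  (fun n => \int[mu]_y (g y * hp al (harmonic n) x y)) @ \oo --> g x.
Proof.
move=> mg gB x0 cg; have B0 : 0 <= B by exact: le_trans (gB 0).
apply/cvgrPdist_le => /= e e0.
have e20 : 0 < e / 2 by rewrite divr_gt0.
have /nbhs_ballP[d /= d0 dP] : nbhs x [set y | `|g x - g y| <= e / 2].
  by move/cvgrPdist_le : cg => /(_ _ e20).
(* [C * s] bounds the far contribution: [|g x - g y|] is at most [2 * B], and the remaining factor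
   is the one in [hp_off] with [s] taken out. *)
pose C := 2 * B * (2 `^ (al + 1) * (8 / d ^+ 2)).
have cC : (fun n => C * harmonic n) @ \oo --> 0.
  by rewrite -[0](mulr0 C); apply: cvgMr; exact: cvg_harmonic.
have /cvgrPdist_le /(_ _ e20) := cC; apply: filterS => n.
rewrite sub0r normrN => /(le_trans (ler_norm _)) Cn.
set s := harmonic n in Cn *; have s0 : 0 < s := harmonic_gt0 n.
have s20 : 0 < 2 * s by rewrite mulr_gt0.
have ip := integrable_hp al_gt x s0; have ip2 := integrable_hp al_gt x s20.
have [i1 _] := hp_le_avg x s0 mg gB.
have iZ c r (r0 : 0 < r) : mu.-integrable setT (EFin \o (fun y => c * hp al r x y)).
  exact: (integrableZl measurableT c (integrable_hp al_gt x r0)).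
have -> : g x = \int[mu]_y (g x * hp al s x y).
  by rewrite (RintegralZl _ measurableT ip) (Rint_hp al_gt x s0) mulr1.
rewrite -(RintegralB measurableT (iZ (g x) s s0) i1).
have iD := integrable_sub (iZ (g x) s s0) i1.
apply: le_trans (le_normr_Rintegral measurableT iD) _.
pose D := 2 * B * (2 `^ (al + 1) * (8 * s / d ^+ 2)).
apply: (@le_trans _ _ (\int[mu]_y (e / 2 * hp al s x y + D * hp al (2 * s) x y))).
  apply: (le_Rint_hmu al_gt (integrable_absr iD) (integrable_add (iZ (e / 2) s s0) (iZ D _ s20))).
  move=> y y0; rewrite -mulrBl normrM [X in _ * X <= _]ger0_norm ?hp_ge0//.
  have [xy|xy] := ltP `|x - y| d.
    apply: (@le_trans _ _ (e / 2 * hp al s x y)).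
      by rewrite ler_wpM2r ?hp_ge0//; apply: dP.
    rewrite lerDl mulr_ge0 ?hp_ge0// !mulr_ge0 ?powR_ge0 ?invr_ge0 ?sqr_ge0 ?(ltW s0)//.
  apply: (@le_trans _ _ (D * hp al (2 * s) x y)); last first.
    by rewrite lerDr mulr_ge0 ?hp_ge0// ltW.
  apply: (@le_trans _ _ (2 * B * hp al s x y)).
    rewrite ler_wpM2r ?hp_ge0//; apply: le_trans (ler_normB _ _) _.
    by have := gB x; have := gB y; lra.
  rewrite /D -[leRHS]mulrA ler_wpM2l ?mulr_ge0//.
  exact: hp_off.
rewrite (RintegralD measurableT (iZ (e / 2) s s0) (iZ D _ s20)) !(RintegralZl _ measurableT)//.
rewrite !(Rint_hp al_gt)// !mulr1.
suff -> : D = C * s by lra.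
by rewrite /D /C; ring.
Qed.

Lemma En_cvg0_nice g B N : measurable_fun setT g -> (forall x, `|g x| <= B) ->
  (forall x, ~~ (0 < x < N) -> g x = 0) ->
  (forall x, 0 < x < N -> {for x, continuous g}) ->
  forall e : R, 0 < e -> \forall n \near \oo, (En al (harmonic n) g <= e%:E)%E.
Proof.
move=> mg gB gN gc e e0; have B0 : 0 <= B by exact: le_trans (gB 0).
have iG := integrable_supported mg gB gN.
have iG2 : mu.-integrable setT (EFin \o (fun x => g x ^+ 2)).
  exact: (integrable_mul_bounded iG mg gB).
have c1 : (fun n => \int[mu]_x (g x * \int[mu]_y (g y * hp al (harmonic n) x y))) @ \oo -->
    \int[mu]_x (g x * g x).
  apply: (proj2 (@Rint_dct _ _ _ mu (fun n x => g x * \int[mu]_y (g y * hp al (harmonic n) x y)) _ (fun x => `|g x| * B) _ _ _ _)).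
  - move=> n; apply: measurable_funM => //.
    apply: (@measurable_Rint _ _ _ _ _ mu (fun x y => g y * hp al (harmonic n) x y)).
    by have mp := measurable_hp al (harmonic n); meas.
  - move=> x; have [xN|xN] := boolP (0 < x < N); last first.
      by rewrite gN//; under eq_fun do rewrite mul0r; rewrite mul0r; exact: cvg_cst.
    apply: cvgMr; apply: (hp_approx mg gB); last exact: gc.
    by case/andP : xN.
  - exact: (@integrable_mul_bounded _ _ _ _ _ (fun=> B) `|B| (integrable_absr iG) (measurable_cst B) (fun=> lexx _)).
  - move=> n x; rewrite normrM ler_wpM2l//.
    exact: (proj2 (hp_le_avg x (harmonic_gt0 n) mg gB)).
have c2 : (fun n => 2 * (\int[mu]_x (g x ^+ 2) - \int[mu]_x (g x * \int[mu]_y (g y * hp al (harmonic n) x y)))) @ \oo --> 0.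
  rewrite -[0](mulr0 2); apply: cvgMr; rewrite -[0](subrr (\int[mu]_x (g x ^+ 2))).
  by apply: cvgB; [exact: cvg_cst|exact: c1].
have /cvgrPdist_le /(_ _ e0) := c2; apply: filterS => n.
rewrite sub0r normrN => /(le_trans (ler_norm _)) h.
by rewrite (energy_id_hp al_gt (harmonic_gt0 n) iG iG2) lee_fin.
Qed.

End plancherel.

(** * Plancherel's theorem *)

Section density.
Context {R : realType}.
Variable al : R.
Hypothesis al_gt : - 2^-1 < al.
Implicit Types x y z s t xi B N c r e : R.
Implicit Types F G g h : R -> R.

Local Notation mu := (hmu al).
Local Notation leb := (@lebesgue_measure R).

(** The projection onto [[-N, N]], in a closed form whose continuity and measurability are inherited
    from the absolute value. *)
Definition clip N y : R := (`|y + N| - `|y - N|) / 2.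

Lemma clip_le N y : 0 <= N -> `|clip N y| <= N.
Proof.
move=> N0; rewrite /clip ler_norml.
by case: (leP 0 (y + N)) => h1; case: (leP 0 (y - N)) => h2;
  rewrite ?(ger0_norm h1) ?(ltr0_norm h1) ?(ger0_norm h2) ?(ltr0_norm h2); apply/andP; split; lra.
Qed.

Lemma clip_dist N y z : `|z| <= N -> `|z - clip N y| <= `|z - y|.
Proof.
rewrite /clip ler_norml => /andP[z1 z2].
by case: (leP 0 (y + N)) => h1; case: (leP 0 (y - N)) => h2;
  rewrite ?(ger0_norm h1) ?(ltr0_norm h1) ?(ger0_norm h2) ?(ltr0_norm h2);
  case: (leP 0 (z - y)) => h3; rewrite ?(ger0_norm h3) ?(ltr0_norm h3) ler_norml; apply/andP; split; lra.
Qed.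

Lemma wmu_mono x N : 0 < x -> x < N -> wmu al x <= wmu al N.
Proof.
move=> x0 xN; rewrite /wmu ler_wpM2r//.
  by rewrite invr_ge0 mulr_ge0 ?powR_ge0// ltW// Gamma_al1_gt0.
rewrite ge0_ler_powR// ?nnegrE ?ltW//; last exact: lt_trans xN.
by have := al_gt; lra.
Qed.

Lemma L1_approx N h0 e : 0 < e -> measurable_fun setT h0 -> (forall x, `|h0 x| <= N) ->
  exists h : R -> R, [/\ continuous h, measurable_fun setT h &
    (\int[lebR]_x (if (0 < x < N)%R then `|h0 x - h x| else 0)%R%:E <= e%:E)%E].
Proof.
move=> e0 mh0 h0N.
pose E : set R := `]0, N[%classic.
have mE : measurable (E : set (measurableTypeR R)) by exact: measurable_itv.
have fE : (leb E < +oo)%E.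
  by rewrite /E lebesgue_measure_itv/=; case: ifP => _; rewrite ?ltry// -EFinB ltry.
have i0 : leb.-integrable E (EFin \o h0).
  apply: measurable_bounded_integrable => //.
    by apply: measurable_funTS; exact: mh0.
  exists N; split; rewrite ?num_real// => M NM x Ex /=.
  exact: le_trans (h0N x) (ltW NM).
have [g_ [cg ig lg]] := approximation_continuous_integrable mE fE i0.
have [n hn] : exists n, (\int[leb]_(z in E) `|(h0 z - g_ n z)%:E| <= e%:E)%E.
  move/fine_cvgP : lg => [[m _ fm] /cvgrPdist_le /(_ _ e0)[p _ hp]].
  exists (maxn m p).
  have := hp (maxn m p) (leq_maxr m p); rewrite sub0r normrN => /(le_trans (ler_norm _)).
  rewrite -lee_fin fineK//; apply: fm; exact: leq_maxl.
exists (g_ n); have mg : measurable_fun setT (g_ n).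
  by apply: continuous_measurable_fun; exact: cg.
split => //.
have mD : measurable_fun [set: R] (fun z => `|(h0 z - g_ n z)%:E|%E).
  by apply: measurableT_comp => //; meas.
apply: le_trans hn; rewrite -integral_lebR_in//; last exact: measurable_funTS.
rewrite [leRHS]integral_mkcond le_eqVlt; apply/orP; left; apply/eqP.
apply: eq_integral => x _; rewrite patchE /E.
have -> : (x \in `]0, N[%classic) = (0 < x < N).
  by apply/idP/idP => [/set_mem|xN]; [rewrite /= in_itv|apply/mem_set; rewrite /= in_itv].
by case: ifPn.
Qed.

(** [F] is cut in position and size, then approximated in L1 by a continuous function, clipped to
    the same bound [N]. For two functions bounded by [N] the squared distance is at most [2 * N]
    times the distance, so L1 closeness gives L2 closeness. Continuity is kept only inside []0, N[],
    all that [hp_approx] asks for. *)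
Lemma approx_nice F e : measurable_fun setT F ->
  mu.-integrable setT (EFin \o (fun x => F x ^+ 2)) -> 0 < e ->
  exists g B N, [/\ measurable_fun setT g, (forall x, `|g x| <= B),
    (forall x, ~~ (0 < x < N) -> g x = 0),
    (forall x, 0 < x < N -> {for x, continuous g}) &
    (\int[mu]_x ((F x - g x) ^+ 2)%:E <= e%:E)%E].
Proof.
move=> mF iF2 e0.
pose T n x := if (x < n%:R) && (`|F x| <= n%:R) then F x else 0.
have mT n : measurable_fun setT (T n) by rewrite /T; meas.
have e40 : 0 < e / 4 by rewrite divr_gt0.
have [n Tn] : exists n, (\int[mu]_x ((F x - T n x) ^+ 2)%:E <= (e / 4)%:E)%E.
  have [_ c0] : mu.-integrable setT (EFin \o (fun=> 0)) /\
      (fun n => \int[mu]_x ((F x - T n x) ^+ 2)) @ \oo --> \int[mu]_x 0.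
    apply: (@Rint_dct _ _ _ mu (fun n x => (F x - T n x) ^+ 2) (fun=> 0) (fun x => F x ^+ 2)) => //.
    - by move=> n; meas.
    - move=> x; apply: cvg_near_cst.
      have H := @nbhs_infty_gtr R (Num.max x `|F x|).
      apply: filterS H => n; rewrite gt_max => /andP[xn /ltW Fn].
      by rewrite /T xn Fn/= subrr expr0n.
    - move=> n x; rewrite ger0_norm ?sqr_ge0// /T; case: ifP => _; last by rewrite subr0.
      by rewrite subrr expr0n sqr_ge0.
  move/cvgrPdist_le : c0 => /(_ _ e40)[n _ /(_ n (leqnn n))].
  rewrite /Rintegral integral0/= sub0r normrN => /(le_trans (ler_norm _)) h.
  exists n; rewrite -lee_fin in h; apply: le_trans h.
  rewrite integral_EFin//.
  have i3 : mu.-integrable setT (EFin \o (fun x => F x ^+ 2)) := iF2.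
  apply: (@le_integrable _ _ _ mu _ measurableT _ _ _ _ i3).
    by meas.
  move=> x _; rewrite lee_fin !ger0_norm ?sqr_ge0// /T; case: ifP => _; last by rewrite subr0.
  by rewrite subrr expr0n sqr_ge0.
set N := n%:R : R; have N0 : 0 <= N by rewrite ler0n.
(* The factor relating the squared [hmu] distance to the L1 distance: the density on []0, N[] is at
   most its value at [N]. The added 1 keeps [c] positive when [N = 0]. *)
pose c := 2 * N * wmu al N + 1.
have c0 : 0 < c.
  by have w0 := wmu_ge0 al_gt N; rewrite ltr_wpDl// mulr_ge0// mulr_ge0.
have TN x : `|T n x| <= N.
  by rewrite /T; case: ifP => [/andP[]//|_]; rewrite normr0.
have d0 : 0 < e / (4 * c) by rewrite divr_gt0// mulr_gt0.
have [h [ch mh hT]] := L1_approx d0 (mT n) TN.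
pose g x := if 0 < x < N then clip N (h x) else 0.
have mg : measurable_fun setT g by rewrite /g /clip; meas.
have gN x : `|g x| <= N.
  by rewrite /g; case: ifP => _; rewrite ?clip_le// normr0.
exists g, N, N; split => //.
- by move=> x xN; rewrite /g (negbTE xN).
- move=> x xN.
  have E : \forall y \near x, clip N (h y) = g y.
    have : x \in `]0, N[ by rewrite in_itv.
    move/near_in_itvoo; apply: filterS => y; rewrite in_itv/= => yN.
    by rewrite /g yN.
  suff : g @ x --> clip N (h x) by rewrite (nbhs_singleton E).
  apply: (cvg_trans (near_eq_cvg E)).
  apply: cvgMl; apply: cvgB; apply: cvg_norm; [apply: cvgD|apply: cvgB]; try exact: cvg_cst; exact: ch.
have md := measurable_dmu al.
have step2 : (\int[mu]_x ((T n x - g x) ^+ 2)%:E <= (e / 4)%:E)%E.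
  rewrite (integral_hmu al_gt); last by meas.
  apply: (@le_trans _ _ (\int[lebR]_x (c%:E * (if (0 < x < N)%R then `|T n x - h x| else 0)%R%:E))%E).
    apply: ge0_le_integral => //.
    - by move=> x _; rewrite mule_ge0// lee_fin ?sqr_ge0// (dmu_ge0 al_gt).
    - by apply: emeasurable_funM; meas.
    - by apply: emeasurable_funM; meas.
    move=> x _; rewrite -!EFinM lee_fin /dmu.
    have [x0|x0] := ltP 0 x; last by rewrite mul0r/= mulr0.
    have [xN|xN] := ltP x N; last first.
      by rewrite /T /g ltNge xN/= andbF subrr expr0n/= !mulr0.
    have gE : g x = clip N (h x) by rewrite /g x0 xN.
    rewrite -real_normK ?num_real//.
    have h1 : `|T n x - g x| <= `|T n x - h x| by rewrite gE clip_dist.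
    have h2 : `|T n x - g x| <= 2 * N.
      by apply: le_trans (ler_normB _ _) _; have := TN x; have := gN x; lra.
    have w0 := wmu_ge0 al_gt x; have w1 := wmu_mono x0 xN.
    apply: (@le_trans _ _ (wmu al N * (2 * N * `|T n x - h x|))).
      apply: ler_pM => //.
      by rewrite expr2 ler_pM.
    rewrite /= mulrA ler_wpM2r// /c mulrC; lra.
  rewrite ge0_integralZl_EFin//; last 3 first.
  - by move=> x _; rewrite lee_fin; case: ifP.
  - by meas.
  - exact: ltW.
  apply: (@le_trans _ _ (c%:E * (e / (4 * c))%:E)%E).
    by rewrite lee_pmul2l.
  rewrite -EFinM lee_fin le_eqVlt; apply/orP; left; apply/eqP; field.
  by rewrite gt_eqF.
apply: (@le_trans _ _ (2%:E * \int[mu]_x ((F x - T n x) ^+ 2)%:E + 2%:E * \int[mu]_x ((T n x - g x) ^+ 2)%:E)%E).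
  have z (H : R -> R) x : (0 <= ((H x) ^+ 2)%:E)%E by rewrite lee_fin sqr_ge0.
  rewrite -!ge0_integralZl_EFin//; try by [move=> x _; rewrite lee_fin sqr_ge0|meas].
  rewrite -ge0_integralD//; try by [move=> x _; rewrite mule_ge0// lee_fin sqr_ge0|apply: emeasurable_funM; meas].
  apply: ge0_le_integral => //.
  - by meas.
  - by apply: emeasurable_funD; apply: emeasurable_funM; meas.
  move=> x _; rewrite -!EFinM -EFinD lee_fin.
  by have := sqr_ge0 ((F x - T n x) - (T n x - g x)); nra.
apply: (@le_trans _ _ (2%:E * (e / 4)%:E + 2%:E * (e / 4)%:E)%E).
  by apply: leeD; rewrite lee_pmul2l.
by rewrite -!EFinM -EFinD lee_fin; lra.
Qed.

(** Density: [En] of the error [F - g] is at most four times its squared norm whatever [s] is, so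
    convergence for the approximants carries over. *)
Lemma En_cvg0 F e : measurable_fun setT F ->
  mu.-integrable setT (EFin \o (fun x => F x ^+ 2)) -> 0 < e ->
  \forall n \near \oo, (En al (harmonic n) F <= e%:E)%E.
Proof.
move=> mF iF2 e0.
have e16 : 0 < e / 16 by rewrite divr_gt0.
have e4 : 0 < e / 4 by rewrite divr_gt0.
have [g [B [N [mg gB gN gc gF]]]] := approx_nice mF iF2 e16.
have := En_cvg0_nice al_gt mg gB gN gc e4; apply: filterS => n h.
have mFg : measurable_fun setT (fun x => F x - g x) by meas.
apply: le_trans (En_tri al (harmonic_gt0 n) mF mg) _.
have h2 := En_le al_gt (harmonic_gt0 n) mFg.
apply: (@le_trans _ _ (2%:E * (e / 4)%:E + 2%:E * (4%:E * (e / 16)%:E))%E).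
  apply: leeD; rewrite lee_pmul2l//; apply: le_trans h2 _.
  by rewrite lee_pmul2l.
by rewrite -!EFinM -EFinD lee_fin; lra.
Qed.

(** The Gaussian-damped integrals of the squared transform have two limits along [s = 1/(n + 1)]:
    the squared norm of [F], since the energy tends to 0, and the undamped integral, by monotone
    convergence. *)
Lemma plancherel F : mu.-integrable setT (EFin \o F) ->
  mu.-integrable setT (EFin \o (fun x => F x ^+ 2)) ->
  (\int[mu]_xi (Hk al F xi ^+ 2)%:E = \int[mu]_x (F x ^+ 2)%:E)%E.
Proof.
move=> iF iF2; have mF := integrable_meas iF; have mH := measurable_Hk al_gt mF.
pose c n := \int[mu]_xi (expR (- (harmonic n * xi ^+ 2)) * Hk al F xi * Hk al F xi).
have ic n : mu.-integrable setT (EFin \o (fun xi => expR (- (harmonic n * xi ^+ 2)) * Hk al F xi * Hk al F xi)).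
  apply: (integrable_mul_bounded _ mH) => [|xi]; last exact: (Hk_le al_gt).
  apply: (integrable_mul_bounded (integrable_gauss0 al_gt (harmonic_gt0 n)) mH) => xi.
  exact: (Hk_le al_gt).
have E n : En al (harmonic n) F = (2 * (\int[mu]_x (F x ^+ 2) - c n))%:E.
  exact: (energy_id al_gt (harmonic_gt0 n) iF iF2).
have En0 n : (0 <= En al (harmonic n) F)%E.
  by apply: integral_ge0 => p _; rewrite lee_fin mulr_ge0 ?sqr_ge0 ?hp_ge0.
have L1 : (fun n => (c n)%:E) @ \oo --> (\int[mu]_x (F x ^+ 2))%:E.
  apply: cvg_EFin; first exact: nearW.
  apply/cvgrPdist_le => /= e e0; have e20 : 0 < 2 * e by rewrite mulr_gt0.
  have := En_cvg0 mF iF2 e20; apply: filterS => n.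
  have := En0 n; rewrite E !lee_fin => h1 h2.
  by rewrite ger0_norm; lra.
have L2 : (fun n => (c n)%:E) @ \oo --> (\int[mu]_xi (Hk al F xi ^+ 2)%:E)%E.
  have -> : (fun n => (c n)%:E) = (fun n => \int[mu]_xi (expR (- (harmonic n * xi ^+ 2)) * Hk al F xi * Hk al F xi)%:E)%E.
    by apply/funext => n; rewrite integral_EFin.
  have -> : (\int[mu]_xi (Hk al F xi ^+ 2)%:E = \int[mu]_xi limn (fun n => (expR (- (harmonic n * xi ^+ 2)) * Hk al F xi * Hk al F xi)%:E))%E.
    apply: eq_integral => xi _; apply/esym/cvg_lim => //.
    apply: cvg_EFin; first exact: nearW.
    rewrite -[X in _ --> X]mul1r -expR0.
    under eq_fun do rewrite -mulrA.
    apply: cvgMl; apply: continuous_cvg; first exact: continuous_expR.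
    rewrite -oppr0 -(mul0r (xi ^+ 2)); apply: cvgN; apply: cvgMl; exact: cvg_harmonic.
  apply: cvg_monotone_convergence => //.
  - by move=> n; meas.
  - by move=> n xi _; rewrite lee_fin -mulrA mulr_ge0 ?expR_ge0// -expr2 sqr_ge0.
  - move=> xi _ m n mn; rewrite lee_fin -!mulrA ler_wpM2r -?expr2 ?sqr_ge0//.
    rewrite ler_expR lerN2 ler_wpM2r ?sqr_ge0// /harmonic/= lef_pV2 ?posrE ?ltr0n//.
    by rewrite ler_nat.
rewrite (integral_EFin iF2); exact: (cvg_unique (@ereal_hausdorff R) L2 L1).
Qed.

End density.

Ltac pos := repeat match goal with
  | H : is_true (0 <= ?x)%R |- is_true (0 <= ?x)%R => exact: H
  | H : is_true (0 < ?x)%R |- is_true (0 <= ?x)%R => exact: (ltW H)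
  | H : forall x, is_true (0 <= ?f x)%R |- is_true (0 <= ?f _)%R => exact: H
  | H : forall x, is_true (0 < ?f x)%R |- is_true (0 <= ?f _)%R => exact: ltW (H _)
  | |- is_true (0 <= _%:R)%R => exact: ler0n
  | |- is_true (0 <= 1)%R => exact: ler01
  | |- is_true (0 <= _ ^+ 2)%R => exact: sqr_ge0
  | |- is_true (0 <= `|_|)%R => exact: normr_ge0
  | |- is_true (0 <= expR _)%R => exact: expR_ge0
  | |- is_true (0 <= powR _ _)%R => exact: powR_ge0
  | |- is_true (0 <= hp _ _ _ _)%R => exact: hp_ge0
  | |- is_true (0 <= _ * _)%R => apply: mulr_ge0
  | |- is_true (0 <= _ + _)%R => apply: addr_ge0
  | |- is_true (0 <= _^-1)%R => rewrite invr_ge0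
  | |- is_true (0 <= _ ^+ _)%R => apply: exprn_ge0
  | |- is_true (0%R <= _%:E)%E => rewrite lee_fin
  | |- is_true (0%R <= _ * _)%E => apply: mule_ge0
  | |- is_true (0%R <= _ + _)%E => apply: adde_ge0
  end.

(** * The ground state inequality for Gaussians *)

Section ground_state.
Context {R : realType}.
Variable al : R.
Hypothesis al_gt : - 2^-1 < al.
Implicit Types x y z s t xi B N c r e lam eps : R.
Implicit Types F G g h w V : R -> R.

Local Notation mu := (hmu al).
Local Notation mu2 := (hmu al \x hmu al)%E.
Local Notation b := (al + 1).

Let b0 : 0 < b. Proof. exact: al1_gt0. Qed.

Lemma powR_le_quadratic r : 0 <= r ->
  (1 + r) `^ (- b) <= 1 - b * r + (b + b ^+ 2) * r ^+ 2.
Proof.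
move=> r0; have r1 : 0 < 1 + r by rewrite ltr_wpDr.
(* [r / (1 + r)] is a lower bound of [ln (1 + r)] that lies within [r^2] of [r], and
   [expR (- z) <= (1 + z)^-1 <= 1 - z + z^2]. *)
pose z := b * (r / (1 + r)).
have z0 : 0 <= z by rewrite mulr_ge0 ?(ltW b0)// divr_ge0// ltW.
have zb : z <= b * r.
  by rewrite ler_wpM2l ?(ltW b0)// ler_pdivrMr// ler_peMr// lerDl.
have zb2 : b * r - b * r ^+ 2 <= z.
  rewrite -mulrBr ler_wpM2l ?(ltW b0)// ler_pdivlMr//.
  by have := exprn_ge0 3 r0; nra.
have lz : z <= b * ln (1 + r).
  rewrite ler_wpM2l ?(ltW b0)// -lerN2 -lnV ?posrE//.
  have h : 0 < (1 + r)^-1 by rewrite invr_gt0.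
  have -> : - (r / (1 + r)) = (1 + r)^-1 - 1 by field; rewrite gt_eqF.
  have := @le_ln1Dx R ((1 + r)^-1 - 1).
  by rewrite (_ : 1 + ((1 + r)^-1 - 1) = (1 + r)^-1); [apply; lra|ring].
have -> : (1 + r) `^ (- b) = expR (- (b * ln (1 + r))) by rewrite /powR gt_eqF// mulNr.
apply: (@le_trans _ _ (expR (- z))); first by rewrite ler_expR lerN2.
have : expR (- z) * (1 + z) <= 1.
  apply: (@le_trans _ _ (expR (- z) * expR z)); last by rewrite -expRD addNr expR0.
  by rewrite ler_wpM2l ?expR_ge0// expR_ge1Dx.
have e0 := expR_ge0 (- z).
have : expR (- z) <= 1 by rewrite -[leRHS]expR0 ler_expR oppr_le0.
move: (expR (- z)) e0 => E E0 E1 EZ.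
have EZ2 : E <= 1 - z + z ^+ 2 by nra.
have : z ^+ 2 <= (b * r) ^+ 2 by rewrite lerXn2r ?nnegrE// mulr_ge0// ltW.
by rewrite exprMn; nra.
Qed.

Lemma sqr_expRN y : 0 <= y -> y ^+ 2 * expR (- y) <= 4.
Proof.
move=> y0; rewrite expRN ler_pdivrMr ?expR_gt0//.
have -> : expR y = expR (y / 2) ^+ 2 by rewrite expr2 -expRD -splitr.
have := expR_ge1Dx (y / 2) => h.
have : (1 + y / 2) ^+ 2 <= expR (y / 2) ^+ 2 by rewrite lerXn2r ?nnegrE ?expR_ge0//; lra.
by move: (expR (y / 2)) h => E h; nra.
Qed.

(** The error must be uniform in [y], which will be [lam * x^2 / 2] for arbitrary [x]. If the change
    of exponent [d] is at most 1/2, the exponential is expanded to second order and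
    [y^2 * expR (- y) <= 4] bounds the remainder; otherwise the left side is itself of order
    [r^2]. *)
Lemma gauss_perturbation r y : 0 <= r -> r <= 1 -> 0 <= y ->
  expR (- (y / (1 + r))) <= expR (- y) * (1 + r * y) + 64 * r ^+ 2.
Proof.
move=> r0 r1 y0; have r10 : 0 < 1 + r by rewrite ltr_wpDr.
pose d := y * (r / (1 + r)).
have d0 : 0 <= d by rewrite mulr_ge0// divr_ge0// ltW.
have dry : d <= r * y.
  by rewrite /d mulrC ler_wpM2r// ler_pdivrMr// ler_peMr// lerDl.
have -> : - (y / (1 + r)) = - y + d by rewrite /d; field; rewrite gt_eqF.
have u0 := expR_gt0 (- y); have y2 := sqr_expRN y0.
have [dh|dh] := leP d 2^-1.
  have ed : expR d <= 1 + d + 2 * d ^+ 2.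
    have h : expR (- d) * expR d = 1 by rewrite -expRD addNr expR0.
    have := expR_ge1Dx (- d); have := expR_gt0 d.
    move: (expR d) (expR (- d)) h => E E' h E0 E1.
    have : E * (1 - d) <= 1 by nra.
    by move=> h2; have : 1 <= (1 + d + 2 * d ^+ 2) * (1 - d); nra.
  rewrite expRD; apply: (@le_trans _ _ (expR (- y) * (1 + d + 2 * d ^+ 2))).
    by rewrite ler_wpM2l// ltW.
  have d2 : d ^+ 2 <= r ^+ 2 * y ^+ 2 by rewrite -(exprMn 2 r y) lerXn2r// nnegrE; pos.
  apply: (@le_trans _ _ (expR (- y) * (1 + r * y + 2 * (r ^+ 2 * y ^+ 2)))).
    by rewrite ler_wpM2l ?(ltW u0)//; lra.
  rewrite mulrDr lerD2l.
  rewrite [leLHS](_ : _ = r ^+ 2 * (2 * (y ^+ 2 * expR (- y)))); last by ring.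
  by rewrite mulrC; have := sqr_ge0 r; nra.
(* Here the left side is at most [E = expR (- (y / 2))], and [y^2 * E <= 16]; since
   [(r * y)^2 >= 1/4], it follows that [E <= 64 * r^2]. *)
have yr : 1 / 2 < r * y by lra.
have yp : 0 < y by rewrite lt_neqAle y0 andbT; apply/eqP => e; rewrite -e mulr0 in yr; lra.
apply: (@le_trans _ _ (64 * r ^+ 2)); last first.
  by rewrite lerDr mulr_ge0 ?(ltW u0)// addr_ge0// mulr_ge0.
have y20 : 0 <= y / 2 by rewrite divr_ge0.
have h := sqr_expRN y20.
apply: (@le_trans _ _ (expR (- (y / 2)))).
  rewrite ler_expR /d.
  have : y * (r / (1 + r)) <= y * (1 / 2); last by lra.
  by rewrite ler_wpM2l// ler_pdivrMr//; lra.
have : 1 / 4 <= (r * y) ^+ 2.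
  rewrite (_ : 1 / 4 = (1 / 2) ^+ 2); last by rewrite expr2; field.
  by rewrite lerXn2r ?nnegrE ?mulr_ge0// ltW.
have := expR_gt0 (- (y / 2)).
move: (expR (- (y / 2))) h => E h E0; rewrite exprMn => h2.
have h3 : E * (1 / 4) <= E * (r ^+ 2 * y ^+ 2) by rewrite ler_wpM2l// ltW.
have : r ^+ 2 * ((y / 2) ^+ 2 * E) <= r ^+ 2 * 4 by rewrite ler_wpM2l ?sqr_ge0.
by rewrite exprMn; lra.
Qed.

Definition gs lam x : R := expR (- (lam * x ^+ 2 / 2)).

Lemma hp_gs lam s x : 0 < lam -> 0 < s ->
  (\int[mu]_y (gs lam y * hp al s x y)%:E =
   ((1 + 2 * lam * s) `^ (- b) * expR (- (lam * x ^+ 2 / 2 / (1 + 2 * lam * s))))%:E)%E.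
Proof.
move=> l0 s0; pose t := (2 * lam)^-1.
have t0 : 0 < t by rewrite invr_gt0 mulr_gt0.
have p0 : 0 < lam^-1 `^ (- b) by rewrite powR_gt0// invr_gt0.
have r1 : 0 < 1 + 2 * lam * s by rewrite ltr_wpDr// !mulr_ge0// ltW.
(* Up to a constant, [gs lam] is the heat kernel from the origin at time [1/(2 * lam)], so the
   semigroup only advances its time by [s]. *)
have E y : gs lam y = (lam^-1 `^ (- b))^-1 * hq al t y.
  rewrite /hq mulrA (_ : 2 * t = lam^-1); last by rewrite /t; field; rewrite gt_eqF.
  rewrite mulVf ?gt_eqF// mul1r /gs; congr (expR (- _)); rewrite /t; field; rewrite gt_eqF//.
have hB y : `|hq al t y| <= (2 * t) `^ (- b) by rewrite ger0_norm ?hq_ge0 ?hq_le.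
have [iq _] := hp_le_avg al_gt x s0 (measurable_hq al t) hB.
transitivity (\int[mu]_y ((lam^-1 `^ (- b))^-1 * (hq al t y * hp al s x y))%:E)%E.
  by apply: eq_integral => y _; rewrite E -mulrA.
rewrite (integral_EFin (integrableZl measurableT (lam^-1 `^ (- b))^-1 iq)); congr EFin.
rewrite (RintegralZl _ measurableT iq) (hp_hq al_gt x s0 t0) /hq.
have -> : 2 * (s + t) = lam^-1 * (1 + 2 * lam * s) by rewrite /t; field; rewrite gt_eqF.
rewrite powRM ?invr_ge0 ?(ltW l0) ?(ltW r1)// !mulrA mulVf ?gt_eqF// mul1r.
congr (_ * expR (- _)); rewrite /t; field; rewrite !gt_eqF//.
Qed.

Lemma gs_gt0 lam x : 0 < gs lam x. Proof. exact: expR_gt0. Qed.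

(** The fraction of the weight [gs + eps] that is genuinely Gaussian; it tends to 1 pointwise as
    [eps] tends to 0. *)
Definition gsw lam eps x : R := gs lam x / (gs lam x + eps).

(** With [r = 2 * lam * s] and [y = lam * x^2 / 2], the terms of first order in [r] are
    [- b * r * gs] and [r * y * gs]. The first is the gain to be kept; the second, divided by
    [gs + eps], is at most [r * y = s * lam^2 * x^2]. All the rest is of order [r^2] and is divided
    by at least [eps]. *)
Lemma hp_gs_ratio lam s eps x : 0 < lam -> 0 < s -> 2 * lam * s <= 1 -> 0 < eps ->
  ((1 + 2 * lam * s) `^ (- b) * expR (- (lam * x ^+ 2 / 2 / (1 + 2 * lam * s))) + eps) / (gs lam x + eps)
  + 2 * lam * b * s * gsw lam eps x <=
  1 + s * lam ^+ 2 * x ^+ 2 + (b + b ^+ 2 + 64) * (2 * lam * s) ^+ 2 / eps.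
Proof.
move=> l0 s0 r1 e0; set r := 2 * lam * s in r1 *; set y := lam * x ^+ 2 / 2.
have r0 : 0 <= r by rewrite !mulr_ge0// ltW.
have y0 : 0 <= y by rewrite divr_ge0// mulr_ge0 ?sqr_ge0// ltW.
have h1 := powR_le_quadratic r0; have h2 := gauss_perturbation r0 r1 y0.
have u0 := gs_gt0 lam x; rewrite -/(gs lam x) -/y in h2.
have ue : 0 < gs lam x + eps by rewrite addr_gt0.
have -> : s * lam ^+ 2 * x ^+ 2 = r * y by rewrite /r /y; field.
have -> : 2 * lam * b * s = b * r by rewrite /r; ring.
have u1 : gs lam x <= 1 by rewrite -[leRHS]expR0 ler_expR oppr_le0.
have p0 : 0 <= (1 + r) `^ (- b) by exact: powR_ge0.
have p1 : (1 + r) `^ (- b) <= 1.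
  rewrite /powR gt_eqF; last by rewrite ltr_wpDr.
  by rewrite -[leRHS]expR0 ler_expR mulNr oppr_le0 mulr_ge0 ?(ltW b0)// ln_ge0// lerDl.
have q0 := expR_ge0 (- (y / (1 + r))).
have ry0 : 0 <= r * y by rewrite mulr_ge0.
set K := b + b ^+ 2 + 64.
have K0 : 0 <= K by rewrite /K; have := sqr_ge0 b; have := b0; lra.
have main : (1 + r) `^ (- b) * expR (- (y / (1 + r))) <=
    gs lam x - b * r * gs lam x + r * y * gs lam x + K * r ^+ 2.
  apply: (@le_trans _ _ ((1 + r) `^ (- b) * gs lam x + r * y * gs lam x + 64 * r ^+ 2)).
    apply: (@le_trans _ _ ((1 + r) `^ (- b) * (gs lam x * (1 + r * y) + 64 * r ^+ 2))).
      by rewrite ler_wpM2l.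
    have A0 : 0 <= gs lam x * (r * y) by rewrite mulr_ge0// ltW.
    have A1 : 0 <= 64 * r ^+ 2 by rewrite mulr_ge0 ?sqr_ge0.
    have := ler_wpM2r A0 p1; have := ler_wpM2r A1 p1; lra.
  have := ler_wpM2r (ltW u0) h1.
  have : (b + b ^+ 2) * r ^+ 2 * gs lam x <= (b + b ^+ 2) * r ^+ 2.
    by rewrite ler_piMr// mulr_ge0 ?sqr_ge0// addr_ge0 ?sqr_ge0// ltW.
  by rewrite /K; lra.
rewrite /gsw mulrA -mulrDl ler_pdivrMr//.
have E1 : (1 + r * y + K * r ^+ 2 / eps) * (gs lam x + eps) =
   gs lam x + eps + r * y * gs lam x + r * y * eps + K * r ^+ 2 + K * r ^+ 2 / eps * gs lam x.
  by field; rewrite gt_eqF.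
rewrite E1.
have B1 : 0 <= r * y * eps by rewrite mulr_ge0// ltW.
have B2 : 0 <= K * r ^+ 2 / eps * gs lam x.
  by rewrite !mulr_ge0 ?invr_ge0 ?sqr_ge0// ltW.
by lra.
Qed.

(** The square of [F x * w y - F y * w x], divided by [w x * w y], is nonnegative; integrated
    against the symmetric kernel, each of its two quotient terms yields the integral of [F^2 * V].
    Everything is stated as sums of nonnegative terms, since each integral may be infinite. *)
Lemma ground_state_weight s F w V : 0 < s -> measurable_fun setT F ->
  measurable_fun setT w -> measurable_fun setT V -> (forall x, 0 < w x) ->
  (forall x, \int[mu]_y (w y * hp al s x y)%:E = (V x * w x)%:E)%E ->
  (2%:E * \int[mu]_x (F x ^+ 2)%:E <=
   En al s F + 2%:E * \int[mu]_x (F x ^+ 2 * V x)%:E)%E.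
Proof.
move=> s0 mF mw mV w0 wV; have mp := measurable_hp al s.
have V0 x : 0 <= V x.
  rewrite -(pmulr_lge0 _ (w0 x)) -lee_fin -wV.
  by apply: integral_ge0 => y _; pos.
have mF2 : measurable_fun setT (fun x => F x ^+ 2) by meas.
have sq0 x : 0 <= F x ^+ 2 by exact: sqr_ge0.
have I1 : (\int[mu2]_p (F p.1 ^+ 2 / w p.1 * (w p.2 * hp al s p.1 p.2))%:E = \int[mu]_x (F x ^+ 2 * V x)%:E)%E.
  rewrite fubini_tonelli1; last 2 first.
  - by meas.
  - by move=> p; pos.
  apply: eq_integral => x _; rewrite /fubini_F/=.
  under eq_integral do rewrite EFinM.
  rewrite ge0_integralZl_EFin//; last 3 first.
  - by move=> y _; pos.
  - by have mp1 := measurable_hp1 al s x; meas.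
  - by rewrite divr_ge0// ltW.
  by rewrite wV -EFinM; congr EFin; field; rewrite gt_eqF.
have I2 : (\int[mu2]_p (F p.2 ^+ 2 / w p.2 * (w p.1 * hp al s p.1 p.2))%:E = \int[mu]_x (F x ^+ 2 * V x)%:E)%E.
  rewrite fubini_tonelli2; last 2 first.
  - by meas.
  - by move=> p; pos.
  apply: eq_integral => x _; rewrite /fubini_G/=.
  under eq_integral do rewrite EFinM hpC.
  rewrite ge0_integralZl_EFin//; last 3 first.
  - by move=> y _; pos.
  - by have mp1 := measurable_hp1 al s x; meas.
  - by rewrite divr_ge0// ltW.
  by rewrite wV -EFinM; congr EFin; field; rewrite gt_eqF.
have two (X : \bar R) : (0 <= X -> 2%:E * X = X + X)%E.
  by move=> X0; rewrite (_ : 2%:E = 1%:E + 1%:E)%E ?ge0_muleDl ?lee_fin// ?mul1e// -EFinD.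
have Fge : (0 <= \int[mu]_x (F x ^+ 2)%:E)%E by apply: integral_ge0 => x _; rewrite lee_fin.
have FVge : (0 <= \int[mu]_x (F x ^+ 2 * V x)%:E)%E.
  by apply: integral_ge0 => x _; pos.
rewrite !two//.
rewrite -{1}(integral_hp1 al_gt s0 mF2 sq0) -(integral_hp2 al_gt s0 mF2 sq0) -{1}I1 -I2 /En.
have g1 p : (0 <= (F p.1 ^+ 2 / w p.1 * (w p.2 * hp al s p.1 p.2))%:E)%E.
  by pos.
have g2 p : (0 <= (F p.2 ^+ 2 / w p.2 * (w p.1 * hp al s p.1 p.2))%:E)%E.
  by pos.
have g3 p : (0 <= ((F p.1 - F p.2) ^+ 2 * hp al s p.1 p.2)%:E)%E.
  by pos.
have g4 p : (0 <= (F p.1 ^+ 2 * hp al s p.1 p.2)%:E)%E by pos.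
have g5 p : (0 <= (F p.2 ^+ 2 * hp al s p.1 p.2)%:E)%E by pos.
have m1 : measurable_fun setT (fun p : R * R => (F p.1 ^+ 2 / w p.1 * (w p.2 * hp al s p.1 p.2))%:E) by meas.
have m2 : measurable_fun setT (fun p : R * R => (F p.2 ^+ 2 / w p.2 * (w p.1 * hp al s p.1 p.2))%:E) by meas.
have m3 : measurable_fun setT (fun p : R * R => ((F p.1 - F p.2) ^+ 2 * hp al s p.1 p.2)%:E) by meas.
have m4 : measurable_fun setT (fun p : R * R => (F p.1 ^+ 2 * hp al s p.1 p.2)%:E) by meas.
have m5 : measurable_fun setT (fun p : R * R => (F p.2 ^+ 2 * hp al s p.1 p.2)%:E) by meas.
have m12 := emeasurable_funD m1 m2.
rewrite -(ge0_integralD mu2 measurableT (fun p _ => g4 p) m4 (fun p _ => g5 p) m5).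
rewrite -(ge0_integralD mu2 measurableT (fun p _ => g1 p) m1 (fun p _ => g2 p) m2).
rewrite -(ge0_integralD mu2 measurableT (fun p _ => g3 p) m3 (fun p _ => adde_ge0 (g1 p) (g2 p)) m12).
apply: ge0_le_integral => //.
- by move=> p _; exact: adde_ge0.
- exact: emeasurable_funD.
- exact: emeasurable_funD.
move=> p _; rewrite -!EFinD lee_fin !mulrA -!mulrDl ler_wpM2r ?hp_ge0//.
have a0 := w0 p.1; have c0 := w0 p.2.
move: (F p.1) (F p.2) (w p.1) (w p.2) a0 c0 => A B a c a0 c0.
rewrite -subr_ge0 [X in 0 <= X](_ : _ = (A * c - B * a) ^+ 2 / (a * c)).
  by rewrite divr_ge0 ?sqr_ge0// mulr_ge0// ltW.
by field; rewrite !gt_eqF.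
Qed.

(** The integral of [F^2] stays on both sides, for it may be infinite at this stage. It is cancelled
    only after integration over the scales, where it is the finite squared norm of [f]. *)
Lemma ground_state lam s eps F : 0 < lam -> 0 < s -> 2 * lam * s <= 1 -> 0 < eps ->
  measurable_fun setT F ->
  (2%:E * \int[mu]_x (F x ^+ 2)%:E + (4 * lam * b * s)%:E * \int[mu]_x (F x ^+ 2 * gsw lam eps x)%:E <=
   En al s F + 2%:E * \int[mu]_x (F x ^+ 2)%:E + (2 * s * lam ^+ 2)%:E * \int[mu]_x (x ^+ 2 * F x ^+ 2)%:E
   + (2 * ((b + b ^+ 2 + 64) * (2 * lam * s) ^+ 2 / eps))%:E * \int[mu]_x (F x ^+ 2)%:E)%E.
Proof.
move=> l0 s0 ls1 e0 mF.
pose w x := gs lam x + eps.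
pose Pu x := (1 + 2 * lam * s) `^ (- b) * expR (- (lam * x ^+ 2 / 2 / (1 + 2 * lam * s))).
pose V x := (Pu x + eps) / (gs lam x + eps).
have u0 := gs_gt0 lam.
have ue x : 0 < gs lam x + eps by rewrite addr_gt0.
have mgs : measurable_fun setT (gs lam) by rewrite /gs; meas.
have mw : measurable_fun setT w by rewrite /w; meas.
have mV : measurable_fun setT V by rewrite /V /Pu; meas.
have mgw : measurable_fun setT (gsw lam eps) by rewrite /gsw; meas.
have V0 x : 0 <= V x.
  by rewrite divr_ge0 ?(ltW (ue x))// addr_ge0 ?(ltW e0)// mulr_ge0 ?powR_ge0 ?expR_ge0.
have gw0 x : 0 <= gsw lam eps x by rewrite divr_ge0 ?(ltW (u0 x)) ?(ltW (ue x)).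
have wV x : (\int[mu]_y (w y * hp al s x y)%:E = (V x * w x)%:E)%E.
  under eq_integral do rewrite mulrDl EFinD.
  have mp := measurable_hp1 al s x.
  rewrite ge0_integralD//; last 4 first.
  - by move=> y _; pos.
  - by meas.
  - by move=> y _; pos.
  - by meas.
  rewrite hp_gs//.
  under eq_integral do rewrite EFinM.
  rewrite ge0_integralZl_EFin//; last 3 first.
  - by move=> y _; rewrite lee_fin hp_ge0.
  - by meas.
  - exact: ltW.
  by rewrite hp_mass// mule1 -EFinD; congr EFin; rewrite /V /w -/(Pu x) divfK// gt_eqF.
have H := ground_state_weight s0 mF mw mV ue wV.
set K := (b + b ^+ 2 + 64) * (2 * lam * s) ^+ 2 / eps.
have K0 : 0 <= K.
  by have bb := b0; rewrite /K; pos.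
have sq0 x : 0 <= F x ^+ 2 by exact: sqr_ge0.
have c0 : 0 <= 4 * lam * b * s by pos.
have c1 : 0 <= 2 * s * lam ^+ 2 by pos.
apply: le_trans (leeD2r _ H) _.
rewrite -[X in (_ <= X)%E]addeA -[X in (_ <= X)%E]addeA -[X in (X <= _)%E]addeA leeD2l//.
have g1 x : (0 <= 2%:E * (F x ^+ 2 * V x)%:E)%E by pos.
have g2 x : (0 <= (4 * lam * b * s)%:E * (F x ^+ 2 * gsw lam eps x)%:E)%E by pos.
have g3 x : (0 <= 2%:E * (F x ^+ 2)%:E)%E by pos.
have g4 x : (0 <= (2 * s * lam ^+ 2)%:E * (x ^+ 2 * F x ^+ 2)%:E)%E.
  by pos.
have g5 x : (0 <= (2 * K)%:E * (F x ^+ 2)%:E)%E by pos.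
have m1 : measurable_fun setT (fun x => 2%:E * (F x ^+ 2 * V x)%:E)%E by apply: emeasurable_funM; meas.
have m2 : measurable_fun setT (fun x => (4 * lam * b * s)%:E * (F x ^+ 2 * gsw lam eps x)%:E)%E by apply: emeasurable_funM; meas.
have m3 : measurable_fun setT (fun x => 2%:E * (F x ^+ 2)%:E)%E by apply: emeasurable_funM; meas.
have m4 : measurable_fun setT (fun x => (2 * s * lam ^+ 2)%:E * (x ^+ 2 * F x ^+ 2)%:E)%E by apply: emeasurable_funM; meas.
have m5 : measurable_fun setT (fun x => (2 * K)%:E * (F x ^+ 2)%:E)%E by apply: emeasurable_funM; meas.
rewrite -!ge0_integralZl_EFin//; try by [meas|move=> x _; pos|pos].
have m45 := emeasurable_funD m4 m5.
rewrite -(ge0_integralD mu measurableT (fun p _ => g1 p) m1 (fun p _ => g2 p) m2).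
rewrite -(ge0_integralD mu measurableT (fun p _ => g4 p) m4 (fun p _ => g5 p) m5).
rewrite -(ge0_integralD mu measurableT (fun p _ => g3 p) m3 (fun p _ => adde_ge0 (g4 p) (g5 p)) m45).
apply: ge0_le_integral => //.
- by move=> x _; exact: adde_ge0.
- exact: emeasurable_funD.
- exact: emeasurable_funD.
move=> x _; rewrite -!EFinM -!EFinD lee_fin.
have hr := hp_gs_ratio x l0 s0 ls1 e0.
rewrite -/(Pu x) -/(V x) -/K in hr.
have := ler_wpM2l (sq0 x) hr.
by lra.
Qed.

End ground_state.

Section integral_bounds.
Context {R : realType} d (T : measurableType d) (m : {measure set T -> \bar R}).
Implicit Types f g : T -> R.

Lemma Rint_abs_le f : measurable_fun setT f ->
  ((`|\int[m]_x f x|)%:E <= \int[m]_x (`|f x|)%:E)%E.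
Proof.
move=> mf; have [h|h] := boolP (\int[m]_x (`|f x|)%:E < +oo)%E; last first.
  by rewrite -leNgt leye_eq in h; rewrite (eqP h) leey.
have iF : m.-integrable setT (EFin \o f) by apply/integrableP; split => //; exact/measurable_EFinP.
by rewrite (integral_EFin (integrable_absr iF)) lee_fin; exact: le_normr_Rintegral.
Qed.

(** Jensen's inequality for a probability measure, from the nonnegativity of the variance; when the
    right side is infinite there is nothing to prove. *)
Lemma Rint_sqr_le f : m setT = 1%E -> measurable_fun setT f ->
  (((\int[m]_x f x) ^+ 2)%:E <= \int[m]_x (f x ^+ 2)%:E)%E.
Proof.
move=> m1 mf; have mf2 : measurable_fun setT (fun x => f x ^+ 2) by meas.
have [h|h] := boolP (\int[m]_x (f x ^+ 2)%:E < +oo)%E; last first.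
  by rewrite -leNgt leye_eq in h; rewrite (eqP h) leey.
have i2 : m.-integrable setT (EFin \o (fun x => f x ^+ 2)) by apply/(integrable_ge0 _ mf2) => // x; exact: sqr_ge0.
have ic (c : R) : m.-integrable setT (EFin \o (fun=> c)).
  apply/integrableP; split; first by meas.
  by rewrite integral_cst// m1 mule1 ltry.
have Ic (c : R) : \int[m]_x c = c by rewrite /Rintegral integral_cst// m1 mule1.
have iF : m.-integrable setT (EFin \o f).
  apply: (@le_integrable _ _ _ m _ measurableT _ _ _ _ (integrable_add (ic 1) i2)); first by meas.
  move=> x _; rewrite lee_fin [leRHS]ger0_norm; last by rewrite addr_ge0// sqr_ge0.
  by rewrite -(real_normK (num_real (f x))); have := sqr_ge0 (`|f x| - 1); have := normr_ge0 (f x); nra.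
rewrite (integral_EFin i2) lee_fin.
set M := \int[m]_x f x.
have iM : m.-integrable setT (EFin \o (fun x => 2 * M * f x)) := integrableZl measurableT (2 * M) iF.
have : 0 <= \int[m]_x (f x ^+ 2 - 2 * M * f x + M ^+ 2).
  by apply: Rintegral_ge0 => // x _; have := sqr_ge0 (f x - M); nra.
rewrite (RintegralD measurableT (integrable_sub i2 iM) (ic _)) (RintegralB measurableT i2 iM).
rewrite (RintegralZl _ measurableT iF) Ic -/M.
by move: (Rintegral _ _ _) => I; nra.
Qed.

Lemma integrable_mul_L2 f g : measurable_fun setT f -> measurable_fun setT g ->
  m.-integrable setT (EFin \o (fun y => f y ^+ 2)) ->
  m.-integrable setT (EFin \o (fun y => g y ^+ 2)) ->
  m.-integrable setT (EFin \o (fun y => f y * g y)).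
Proof.
move=> mf mg f2 g2.
apply: (@le_integrable _ _ _ m _ measurableT _ _ _ _ (integrable_add f2 g2)); first by meas.
move=> y _; rewrite lee_fin [leRHS]ger0_norm; last by rewrite addr_ge0// sqr_ge0.
rewrite normrM -(real_normK (num_real (f y))) -(real_normK (num_real (g y))).
have := sqr_ge0 (`|f y| - `|g y|); have := normr_ge0 (f y); have := normr_ge0 (g y); nra.
Qed.

End integral_bounds.

(** * Hankel translation and convolution on L1 and L2 *)

Section translation.
Context {R : realType}.
Variable al : R.
Hypothesis al_gt : - 2^-1 < al.
Implicit Types x y z s t u xi B N c r e : R.
Implicit Types F G g h f phi : R -> R.

Local Notation mu := (hmu al).
Local Notation sig := (hsig al).
Local Notation mus := (hmu al \x hsig al)%E.

Lemma measurable_rr_u u : measurable_fun setT (fun p : R * R => rr u p.1 p.2).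
Proof. by apply: measurable_fun_rr; meas. Qed.

Lemma ge0_integral_exchange u (K : R * R -> \bar R) :
  measurable_fun setT K -> (forall p, 0 <= K p)%E ->
  (\int[mus]_p K (p.1, rr u p.1 p.2) = \int[mus]_p K (rr u p.1 p.2, p.1))%E.
Proof.
move=> mK K0; have mr := measurable_rr_u u.
rewrite !fubini_tonelli1//; last 2 first.
- by apply: (measurableT_comp mK); meas.
- by apply: (measurableT_comp mK); meas.
exact: (translation_exchange al_gt u mK K0).
Qed.

Lemma integral_exchange u (K : R * R -> R) : measurable_fun setT K ->
  mus.-integrable setT (fun p => (K (p.1, rr u p.1 p.2))%:E) ->
  \int[mu]_x \int[sig]_th K (x, rr u x th) = \int[mu]_x \int[sig]_th K (rr u x th, x).
Proof.
move=> mK iA; have mr := measurable_rr_u u.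
have mE : measurable_fun setT (fun p => (K p)%:E) by exact/measurable_EFinP.
have mp : measurable_fun setT (fun p => (fun q => (K q)%:E)^\+ p)%E by exact: measurable_funepos.
have mn : measurable_fun setT (fun p => (fun q => (K q)%:E)^\- p)%E by exact: measurable_funeneg.
have iB : mus.-integrable setT (fun p => (K (rr u p.1 p.2, p.1))%:E).
  apply/integrableP; split.
    by apply/measurable_EFinP; apply: (measurableT_comp mK); meas.
  rewrite -(@ge0_integral_exchange u (fun p => `|(K p)%:E|%E)).
  - by move/integrableP : iA => [].
  - exact: measurableT_comp.
  - by [].
rewrite (Rint_fubini12 (f := fun x th => K (x, rr u x th)) iA).
rewrite (Rint_fubini12 (f := fun x th => K (rr u x th, x)) iB).
congr fine; rewrite integralE [in RHS]integralE.
have P : (\int[mus]_p (fun p => (K (p.1, rr u p.1 p.2))%:E)^\+ p = \int[mus]_p (fun p => (K (rr u p.1 p.2, p.1))%:E)^\+ p)%E.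
  apply: etrans (etrans _ (@ge0_integral_exchange u _ mp (fun p => funepos_ge0 _ _))) _.
    by apply: eq_integral => p _; rewrite !funeposE.
  by apply: eq_integral => p _; rewrite !funeposE.
have N : (\int[mus]_p (fun p => (K (p.1, rr u p.1 p.2))%:E)^\- p = \int[mus]_p (fun p => (K (rr u p.1 p.2, p.1))%:E)^\- p)%E.
  apply: etrans (etrans _ (@ge0_integral_exchange u _ mn (fun p => funeneg_ge0 _ _))) _.
    by apply: eq_integral => p _; rewrite !funenegE.
  by apply: eq_integral => p _; rewrite !funenegE.
by rewrite P N.
Qed.

Definition tr phi x y : R := \int[sig]_th phi (rr x y th).

Lemma trC phi x y : tr phi x y = tr phi y x.
Proof. by apply: eq_Rintegral => th _; rewrite rrC. Qed.

Lemma measurable_phi_rr phi : measurable_fun setT phi ->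
  measurable_fun setT (fun p : (R * R) * R => phi (rr p.1.1 p.1.2 p.2)).
Proof. by move=> mphi; apply: (measurableT_comp mphi); apply: measurable_fun_rr; meas. Qed.

Lemma measurable_phi_rr1 phi x : measurable_fun setT phi ->
  measurable_fun setT (fun p : R * R => phi (rr x p.1 p.2)).
Proof. by move=> mphi; apply: (measurableT_comp mphi); apply: measurable_fun_rr; meas. Qed.

Lemma measurable_phi_rr2 phi x y : measurable_fun setT phi ->
  measurable_fun setT (fun th => phi (rr x y th)).
Proof. by move=> mphi; apply: (measurableT_comp mphi); apply: measurable_fun_rr; meas. Qed.

Lemma measurable_tr phi : measurable_fun setT phi ->
  measurable_fun setT (fun p : R * R => tr phi p.1 p.2).
Proof.
move=> mphi.
exact: (@measurable_Rint _ _ _ _ _ sig (fun (p : R * R) th => phi (rr p.1 p.2 th)) (measurable_phi_rr mphi)).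
Qed.

Lemma measurable_tr1 phi x : measurable_fun setT phi -> measurable_fun setT (tr phi x).
Proof. by move=> mphi; exact: (measurableT_comp (measurable_tr mphi) (measurable_pair1 x)). Qed.

Lemma integral_sig_rr phi x : measurable_fun setT phi -> (forall y, 0 <= phi y) ->
  (\int[mu]_y \int[sig]_th (phi (rr x y th))%:E = \int[mu]_y (phi y)%:E)%E.
Proof.
move=> mphi phi0.
have -> : (\int[mu]_y \int[sig]_th (phi (rr x y th))%:E = \int[mu]_y \int[sig]_th (phi y)%:E)%E.
  by apply: (translation_exchange al_gt x (K := fun p => (phi p.2)%:E)); [meas|move=> p; rewrite lee_fin].
apply: eq_integral => y _; rewrite integral_cst//.
by change ((phi y)%:E * hsig al setT = (phi y)%:E)%E; rewrite hsig_setT// mule1.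
Qed.

Lemma measurable_sig_rr phi x : measurable_fun setT phi -> (forall y, 0 <= phi y) ->
  measurable_fun setT (fun y => \int[sig]_th (phi (rr x y th))%:E)%E.
Proof.
move=> mphi phi0.
apply: (measurable_tonelli sig (f := fun y th => (phi (rr x y th))%:E)).
  by apply/measurable_EFinP; exact: measurable_phi_rr1.
by move=> y th; rewrite lee_fin.
Qed.

Lemma tr_L1 phi x : measurable_fun setT phi ->
  (\int[mu]_y (`|tr phi x y|)%:E <= \int[mu]_y (`|phi y|)%:E)%E.
Proof.
move=> mphi; have mt := measurable_tr1 x mphi.
have ma : measurable_fun setT (fun y => `|phi y|) by meas.
rewrite -(integral_sig_rr x ma)//; apply: ge0_le_integral => //.
- by meas.
- exact: (measurable_sig_rr x ma).
- by move=> y _; apply: Rint_abs_le; exact: measurable_phi_rr2.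
Qed.

(** Jensen's inequality on the angles, then the invariance of [hmu] under translation. *)
Lemma tr_L2 phi x : measurable_fun setT phi ->
  (\int[mu]_y ((tr phi x y) ^+ 2)%:E <= \int[mu]_y (phi y ^+ 2)%:E)%E.
Proof.
move=> mphi; have mt := measurable_tr1 x mphi.
have ma : measurable_fun setT (fun y => phi y ^+ 2) by meas.
have a0 y : 0 <= phi y ^+ 2 by exact: sqr_ge0.
rewrite -(integral_sig_rr x ma)//; apply: ge0_le_integral => //.
- by move=> y _; rewrite lee_fin sqr_ge0.
- by meas.
- exact: (measurable_sig_rr x ma).
- move=> y _; apply: Rint_sqr_le; last exact: measurable_phi_rr2.
  exact: hsig_setT.
Qed.

Lemma integrable_tr phi x : mu.-integrable setT (EFin \o phi) ->
  mu.-integrable setT (EFin \o tr phi x).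
Proof.
move=> iphi; have mphi := integrable_meas iphi.
apply/integrableP; split; first by apply/measurable_EFinP; exact: measurable_tr1.
by apply: le_lt_trans (tr_L1 x mphi) _; move/integrableP : iphi => [].
Qed.

Lemma integrable_tr2 phi x : measurable_fun setT phi ->
  mu.-integrable setT (EFin \o (fun y => phi y ^+ 2)) ->
  mu.-integrable setT (EFin \o (fun y => tr phi x y ^+ 2)).
Proof.
move=> mphi i2; have mt := measurable_tr1 x mphi.
apply/(integrable_ge0 mu); [by meas|by move=> y; exact: sqr_ge0|].
apply: le_lt_trans (tr_L2 x mphi) _.
by move/(integrable_ge0 mu) : i2; apply; [meas|move=> y; exact: sqr_ge0].
Qed.

(** The exchange formula moves the translated radius from [phi] into [jal], where the product
    formula separates it. *)
Lemma Hk_tr phi u xi : mu.-integrable setT (EFin \o phi) ->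
  Hk al (tr phi u) xi = jal al (u * xi) * Hk al phi xi.
Proof.
move=> iphi; have mphi := integrable_meas iphi; have mj := measurable_jal al_gt.
have mr := measurable_rr_u u.
pose K (p : R * R) := phi p.2 * jal al (p.1 * xi).
have mK : measurable_fun setT K by rewrite /K; meas.
have iP : mus.-integrable setT (fun p => (phi (rr u p.1 p.2))%:E).
  apply/integrableP; split; first by apply/measurable_EFinP; exact: measurable_phi_rr1.
  have ma : measurable_fun setT (fun y => `|phi y|) by meas.
  rewrite fubini_tonelli1//; last first.
    by apply: measurableT_comp => //; apply/measurable_EFinP; exact: measurable_phi_rr1.
  rewrite /fubini_F/=; have -> := integral_sig_rr u ma (fun y => normr_ge0 _).
  by move/integrableP : iphi => [].
have iK : mus.-integrable setT (fun p => (K (p.1, rr u p.1 p.2))%:E).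
  apply: (@integrable_mul_bounded _ _ _ _ (fun p : R * R => phi (rr u p.1 p.2)) (fun p : R * R => jal al (p.1 * xi)) 1) => //.
    by meas.
  by move=> p; exact: jal_le1.
have mt := measurable_tr1 u mphi.
transitivity (\int[mu]_x \int[sig]_th K (x, rr u x th)).
  (* For an integrable [phi] only almost every section in the angle is integrable; at the other
     points [tr] is a default value, which an almost everywhere comparison ignores. *)
  apply: ae_eq_Rint.
  - by meas.
  - apply: (@measurable_Rint _ _ _ _ _ sig (fun x th => K (x, rr u x th))).
    by apply: (measurableT_comp mK); meas.
  apply: filterS (ae_integrable1 iP) => x ith.
  rewrite mulrC -(RintegralZl _ measurableT ith); apply: eq_Rintegral => th _.
  by rewrite mulrC.
rewrite (integral_exchange mK iK) /Hk.
rewrite -(RintegralZl _ measurableT (integrable_jal al_gt xi iphi)); apply: eq_Rintegral => x _.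
rewrite /K/= (RintegralZl _ measurableT).
  rewrite mulrCA -(product_formula al_gt); congr (_ * _); apply: eq_Rintegral => th _.
  by rewrite mulrC.
apply: (@integrable_hsig _ _ al_gt _ 1); last by move=> th; exact: jal_le1.
by have mr1 := measurableT_comp mr (measurable_pair1 x); meas.
Qed.

(* [h] integrated against the Hankel translates of [phi] *)
Definition cw phi h x : R := \int[mu]_t (h t * tr phi x t).

Lemma measurable_cw phi h : measurable_fun setT phi -> measurable_fun setT h ->
  measurable_fun setT (cw phi h).
Proof.
move=> mphi mh; apply: (@measurable_Rint _ _ _ _ _ mu (fun x t => h t * tr phi x t)).
by have mt := measurable_tr mphi; meas.
Qed.

Lemma integrable_h_tr phi h x : measurable_fun setT phi -> measurable_fun setT h ->
  mu.-integrable setT (EFin \o (fun y => phi y ^+ 2)) ->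
  mu.-integrable setT (EFin \o (fun y => h y ^+ 2)) ->
  mu.-integrable setT (EFin \o (fun t => h t * tr phi x t)).
Proof.
move=> mphi mh p2 h2; apply: integrable_mul_L2 => //; first exact: measurable_tr1.
exact: integrable_tr2.
Qed.

Lemma cw_bounded phi h x : measurable_fun setT phi -> measurable_fun setT h ->
  mu.-integrable setT (EFin \o (fun y => phi y ^+ 2)) ->
  mu.-integrable setT (EFin \o (fun y => h y ^+ 2)) ->
  `|cw phi h x| <= \int[mu]_y (h y ^+ 2) + \int[mu]_y (phi y ^+ 2).
Proof.
move=> mphi mh p2 h2; have ih := integrable_h_tr x mphi mh p2 h2.
have it := integrable_tr2 x mphi p2.
apply: le_trans (le_normr_Rintegral measurableT ih) _.
apply: (@le_trans _ _ (\int[mu]_y (h y ^+ 2 + tr phi x y ^+ 2))).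
  apply: (le_Rintegral measurableT (integrable_absr ih) (integrable_add h2 it)) => y _.
  rewrite normrM -(real_normK (num_real (h y))) -(real_normK (num_real (tr phi x y))).
  have := sqr_ge0 (`|h y| - `|tr phi x y|); have := normr_ge0 (h y); have := normr_ge0 (tr phi x y); nra.
rewrite (RintegralD measurableT h2 it) lerD2l -lee_fin.
have := tr_L2 x mphi.
by rewrite (integral_EFin it) (integral_EFin p2).
Qed.

Lemma integrable_cw_prod phi h : mu.-integrable setT (EFin \o phi) ->
  mu.-integrable setT (EFin \o h) ->
  (mu \x mu)%E.-integrable setT (fun p => (h p.2 * tr phi p.1 p.2)%:E).
Proof.
move=> ip ih; have mp := integrable_meas ip; have mh := integrable_meas ih.
have mt := measurable_tr mp.
apply/integrableP; split; first by meas.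
have mabs : measurable_fun setT (fun p : R * R => (`|h p.2| * `|tr phi p.1 p.2|)%:E) by meas.
apply: (@le_lt_trans _ _ (\int[mu \x mu]_p (`|h p.2| * `|tr phi p.1 p.2|)%:E)%E).
  apply: ge0_le_integral => //; first by apply: measurableT_comp => //; meas.
  by move=> p _; rewrite lee_fin normrM.
(* Integrating in the translation parameter before [t] turns the inner integral, by the symmetry
   [trC], into the L1 norm of a translate. *)
rewrite fubini_tonelli2//.
apply: (@le_lt_trans _ _ (\int[mu]_t ((`|h t|)%:E * \int[mu]_y (`|phi y|)%:E))%E).
  apply: ge0_le_integral => //.
  - by move=> t _; apply: integral_ge0.
  - exact: (measurable_fun_fubini_tonelli_G _ mabs).
  - by apply: emeasurable_funM; meas.
  move=> t _; rewrite /fubini_G/=.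
  under eq_integral do rewrite EFinM trC.
  have mt1 := measurable_tr1 t mp.
  rewrite ge0_integralZl_EFin//; last by meas.
  by apply: lee_wpmul2l => //; exact: tr_L1.
have fp : (\int[mu]_y (`|phi y|)%:E < +oo)%E by move/integrableP : ip => [].
have fh : (\int[mu]_y (`|h y|)%:E < +oo)%E by move/integrableP : ih => [].
have p0 : (0 <= \int[mu]_y (`|phi y|)%:E)%E by apply: integral_ge0.
have h0 : (0 <= \int[mu]_y (`|h y|)%:E)%E by apply: integral_ge0.
rewrite -(fineK (_ : (\int[mu]_y (`|phi y|)%:E)%E \is a fin_num)); last by rewrite ge0_fin_numE.
under eq_integral do rewrite muleC.
rewrite ge0_integralZl_EFin//; last 2 first.
- by meas.
- exact: fine_ge0.
by apply: lte_mul_pinfty => //; rewrite lee_fin fine_ge0.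
Qed.

Lemma integrable_cw phi h : mu.-integrable setT (EFin \o phi) ->
  mu.-integrable setT (EFin \o h) -> mu.-integrable setT (EFin \o cw phi h).
Proof.
move=> ip ih; have mp := integrable_meas ip; have mh := integrable_meas ih.
have iP := integrable_cw_prod ip ih; have mt := measurable_tr mp.
have mP : measurable_fun setT (fun p : R * R => `|h p.2 * tr phi p.1 p.2|) by meas.
apply/integrableP; split; first by apply/measurable_EFinP; exact: measurable_cw.
move/integrableP : iP => [_]; apply: le_lt_trans.
rewrite fubini_tonelli1//; last by apply/measurable_EFinP.
apply: ge0_le_integral => //.
- by apply: measurableT_comp => //; apply/measurable_EFinP; exact: measurable_cw.
- by apply: (measurable_tonelli mu (f := fun x t => (`|h t * tr phi x t|)%:E)) => //; apply/measurable_EFinP.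
- move=> x _; apply: Rint_abs_le.
  by have mt1 := measurable_tr1 x mp; meas.
Qed.

(** The convolution theorem: after Fubini and [trC] the inner integral is the transform of a
    translate of [phi]. *)
Lemma Hk_cw phi h xi : mu.-integrable setT (EFin \o phi) ->
  mu.-integrable setT (EFin \o h) ->
  mu.-integrable setT (EFin \o (fun y => phi y ^+ 2)) ->
  mu.-integrable setT (EFin \o (fun y => h y ^+ 2)) ->
  Hk al (cw phi h) xi = Hk al h xi * Hk al phi xi.
Proof.
move=> ip ih ip2 ih2; have mp := integrable_meas ip; have mh := integrable_meas ih.
have iP := integrable_cw_prod ip ih; have mt := measurable_tr mp.
have mj := measurable_jal al_gt.
have iQ : (mu \x mu)%E.-integrable setT (fun p => ((h p.2 * tr phi p.1 p.2) * jal al (p.1 * xi))%:E).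
  apply: (@integrable_mul_bounded _ _ _ _ (fun p : R * R => h p.2 * tr phi p.1 p.2) (fun p : R * R => jal al (p.1 * xi)) 1) => //.
    by meas.
  by move=> p; exact: jal_le1.
transitivity (\int[mu]_x \int[mu]_t ((h t * tr phi x t) * jal al (x * xi))).
  apply: eq_Rintegral => x _; rewrite mulrC -(RintegralZl _ measurableT (integrable_h_tr x mp mh ip2 ih2)).
  by apply: eq_Rintegral => t _; rewrite mulrC.
rewrite (Rint_fubini (f := fun x t => (h t * tr phi x t) * jal al (x * xi)) iQ).
rewrite mulrC -(RintegralZl _ measurableT (integrable_jal al_gt xi ih)).
apply: eq_Rintegral => t _.
transitivity (h t * Hk al (tr phi t) xi); last by rewrite (Hk_tr _ _ ip); ring.
rewrite -(RintegralZl _ measurableT (integrable_jal al_gt xi (integrable_tr t ip))).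
by apply: eq_Rintegral => x _; rewrite mulrA trC.
Qed.

End translation.

(** * The wavelet transform *)

Section wavelet.
Context {R : realType}.
Variable al : R.
Hypothesis al_gt : - 2^-1 < al.
Implicit Types x y z s t u xi B c r e a k K : R.
Implicit Types F G g h f phi v P : R -> R.

Local Notation mu := (hmu al).
Local Notation b := (al + 1).

Let b0 : 0 < b. Proof. exact: al1_gt0. Qed.

Lemma dmu_scale a x : 0 < a -> a * dmu al (a * x) = a `^ (2 * b) * dmu al x.
Proof.
move=> a_gt0; rewrite /dmu pmulr_rgt0//; case: ifP => x0; last by rewrite !mulr0.
rewrite /wmu powRM ?ltW// !mulrA; congr (_ * _ / _).
rewrite (_ : 2 * b = 1 + (2 * al + 1)); last by ring.
by rewrite [RHS]powRD ?(gt_eqF a_gt0) ?implybT// powRr1// ltW.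
Qed.

Lemma hmu_scale a (f : R -> \bar R) : 0 < a -> measurable_fun setT f ->
  (\int[mu]_x f x = \int[lebR]_x ((a `^ (2 * b) * dmu al x)%:E * f (a * x)%R))%E.
Proof.
move=> a_gt0 mf; have md := measurable_dmu al.
rewrite (integral_hmu al_gt)// (lebesgue_affine 0 a_gt0); last by meas.
by apply: eq_integral => x _; rewrite addr0 muleA -EFinM dmu_scale.
Qed.

Lemma ge0_hmu_scale a f : 0 < a -> measurable_fun setT f -> (forall x, 0 <= f x) ->
  (\int[mu]_x (f x)%:E = (a `^ (2 * b))%:E * \int[mu]_x (f (a * x))%:E)%E.
Proof.
move=> a_gt0 mf f0; have md := measurable_dmu al; have md0 := dmu_ge0 al_gt.
rewrite (hmu_scale a_gt0); last by meas.
rewrite (integral_hmu al_gt); last by meas.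
rewrite -ge0_integralZl_EFin ?powR_ge0//.
- by apply: eq_integral => x _; rewrite EFinM muleA.
- by move=> x _; rewrite mule_ge0// lee_fin.
- by meas.
Qed.

Lemma integrable_hmu_scale a f : 0 < a -> mu.-integrable setT (EFin \o f) ->
  mu.-integrable setT (EFin \o (fun x => f (a * x))).
Proof.
move=> a_gt0 iF; have mf := integrable_meas iF.
have p0 : 0 < a `^ (2 * b) by exact: powR_gt0.
apply/integrableP; split; first by meas.
move/integrableP : iF => [_]; rewrite /=.
rewrite (ge0_hmu_scale a_gt0 (f := fun x => `|f x|))//; last by meas.
rewrite ltey => h; rewrite ltey; apply: contraNneq h => /= ->.
by rewrite gt0_muley// lte_fin.
Qed.

Lemma Rint_hmu_scale a f : 0 < a -> mu.-integrable setT (EFin \o f) ->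
  \int[mu]_x f x = a `^ (2 * b) * \int[mu]_x f (a * x).
Proof.
move=> a_gt0 iF; have mf := integrable_meas iF; have md := measurable_dmu al.
have iFa := integrable_hmu_scale a_gt0 iF; have mfa := integrable_meas iFa.
have md0 := dmu_ge0 al_gt.
apply: EFin_inj; rewrite EFinM -(integral_EFin iF) -(integral_EFin iFa).
rewrite (hmu_scale a_gt0); last by meas.
rewrite (integral_hmu al_gt); last by meas.
rewrite -integralZl//.
  by apply: eq_integral => x _; rewrite EFinM muleA.
have mfe : measurable_fun setT (fun x => (f (a * x))%:E) by meas.
have := proj1 (integrable_mdens md mfe) iFa.
apply: eq_integrable => // x _.
by rewrite ger0_norm.
Qed.

Definition dl a phi x : R := a `^ b * phi (a * x).

Lemma measurable_dl a phi : measurable_fun setT phi -> measurable_fun setT (dl a phi).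
Proof. by move=> mp; rewrite /dl; meas. Qed.

(** The class where the transform is an absolutely convergent integral and Plancherel's theorem
    applies. The wavelet lies in it, being integrable and essentially bounded; [f] only after
    truncation. *)
Definition L12 phi := mu.-integrable setT (EFin \o phi) /\
  mu.-integrable setT (EFin \o (fun x => phi x ^+ 2)).

Lemma L12_meas phi : L12 phi -> measurable_fun setT phi.
Proof. by move=> [/integrable_meas]. Qed.

Lemma L12_dl a phi : 0 < a -> L12 phi -> L12 (dl a phi).
Proof.
move=> a_gt0 [i1 i2]; split.
  exact: (integrableZl measurableT (a `^ b) (integrable_hmu_scale a_gt0 i1)).
rewrite (_ : EFin \o _ = EFin \o (fun x => (a `^ b) ^+ 2 * phi (a * x) ^+ 2)).
  exact: (integrableZl measurableT ((a `^ b) ^+ 2) (integrable_hmu_scale a_gt0 i2)).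
by apply/funext => x /=; rewrite /dl exprMn.
Qed.

Lemma Hk_dl a phi xi : 0 < a -> mu.-integrable setT (EFin \o phi) ->
  Hk al (dl a phi) xi = a `^ (- b) * Hk al phi (xi / a).
Proof.
move=> a_gt0 ip; rewrite /Hk (Rint_hmu_scale a_gt0 (integrable_jal al_gt (xi / a) ip)) mulrA.
rewrite -powRD; last by rewrite (gt_eqF a_gt0) implybT.
rewrite (_ : - b + 2 * b = b); last by ring.
have ia := integrable_hmu_scale a_gt0 (integrable_jal al_gt (xi / a) ip).
rewrite -(RintegralZl _ measurableT ia); apply: eq_Rintegral => x _.
rewrite /dl mulrA (_ : a * x * (xi / a) = x * xi)//; field; rewrite gt_eqF//.
Qed.

Definition wt phi h (p : R * R) : R := cw al (dl p.1 phi) h p.2.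

Lemma measurable_wt phi h : measurable_fun setT phi -> measurable_fun setT h ->
  measurable_fun setT (wt phi h).
Proof.
move=> mp mh.
have mtr : measurable_fun setT (fun q : (R * R) * R => tr al (dl q.1.1 phi) q.1.2 q.2).
  apply: (@measurable_Rint _ _ _ _ _ (hsig al) (fun (q : (R * R) * R) th => dl q.1.1 phi (rr q.1.2 q.2 th))).
  have mr : measurable_fun setT (fun p : ((R * R) * R) * R => rr p.1.1.2 p.1.2 p.2) by apply: measurable_fun_rr; meas.
  rewrite /dl; apply: measurable_funM; last by meas.
  have mw : measurable_fun setT (fun a => a `^ b) by meas.
  by meas.
apply: (@measurable_Rint _ _ _ _ _ mu (fun (p : R * R) t => h t * tr al (dl p.1 phi) p.2 t)).
by meas.
Qed.

Definition ada a : R := if 0 < a then a `^ (2 * al + 1) else 0.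

Lemma measurable_ada : measurable_fun [set: R] ada.
Proof. by rewrite /ada; meas. Qed.

Lemma ada_ge0 a : 0 <= ada a.
Proof. by rewrite /ada; case: ifP => // _; exact: powR_ge0. Qed.

Definition nua := mdens measurable_ada.

Lemma integral_nua (f : R -> \bar R) : measurable_fun setT f ->
  (\int[nua]_x f x = \int[lebR]_x ((ada x)%:E * f x))%E.
Proof.
move=> mf; rewrite integral_mdens//.
by apply: eq_integral => x _; rewrite ger0_norm// ada_ge0.
Qed.

Lemma eq_integral_nua (f g : R -> \bar R) :
  measurable_fun setT f -> measurable_fun setT g ->
  (forall x, 0 < x -> f x = g x) ->
  (\int[nua]_x f x = \int[nua]_x g x)%E.
Proof.
move=> mf mg fg; rewrite !integral_nua//; apply: eq_integral => x _.
by have [x0|x0] := ltP 0 x; [rewrite fg|rewrite /ada ltNge x0/= !mul0e].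
Qed.

(** The measure [da / a] is invariant under [a -> xi / a]; in the logarithm of [a] this is a
    reflection and a shift. *)
Lemma integral_inversion (G : R -> \bar R) xi : 0 < xi -> measurable_fun setT G ->
  (\int[lebR]_a (if (0 < a)%R then (a^-1)%:E * G (xi / a)%R else 0) =
   \int[lebR]_a (if (0 < a)%R then (a^-1)%:E * G a else 0))%E.
Proof.
move=> x0 mG.
have minv := @measurable_inv R.
have m1 : measurable_fun setT (fun a => (a^-1)%:E * G (xi / a)%R)%E by meas.
have m2 : measurable_fun setT (fun a => (a^-1)%:E * G a)%E by meas.
rewrite (lebesgue_expR m1) (lebesgue_expR m2).
have E1 t : ((expR t)%:E * ((expR t)^-1%:E * G (xi / expR t)%R) = G (expR (ln xi - t)))%E.
  by rewrite muleA -EFinM divff ?gt_eqF ?expR_gt0// mul1e expRD lnK ?posrE// expRN.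
have E2 t : ((expR t)%:E * ((expR t)^-1%:E * G (expR t)) = G (expR t))%E.
  by rewrite muleA -EFinM divff ?gt_eqF ?expR_gt0// mul1e.
have m3 : measurable_fun setT (fun t => G (expR t)) by meas.
have m4 : measurable_fun setT (fun t => G (expR (t + ln xi))) by meas.
transitivity (\int[lebR]_t G (expR (ln xi - t)))%E; first by apply: eq_integral => t _; exact: E1.
transitivity (\int[lebR]_t G (expR t))%E; last by apply: eq_integral => t _; exact/esym/E2.
rewrite (lebesgue_shift (ln xi) m3) (lebesgue_reflect m4).
by apply: eq_integral => t _; rewrite addrC.
Qed.

(** After Tonelli the density [a^(2 al + 1)] and the factor [a^(-2 (al + 1))] from the dilation
    combine to [a^-1]. By inversion the inner integral is then the same for every [xi], and the
    admissibility constant normalises it to 1. *)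
Lemma scale_average K v (N : R -> R) P : measurable_fun setT v -> measurable_fun setT N -> measurable_fun setT P ->
  0 <= K -> (forall xi, 0 <= v xi) -> (forall xi, 0 <= N xi) -> (forall xi, 0 <= P xi) ->
  (K%:E * \int[lebR]_a (if (0 < a)%R then (a^-1)%:E * (P a)%:E else 0) = 1)%E ->
  (\int[nua]_a \int[mu]_xi (v xi * (K * (a `^ (- (2 * b)) * (N xi * P (xi / a)))))%:E =
   \int[mu]_xi (v xi * N xi)%:E)%E.
Proof.
move=> mv mN mP K0 v0 N0 P0 Hc.
have mad := measurable_ada.
pose J a xi := v xi * (K * (a `^ (- (2 * b)) * (N xi * P (xi / a)))).
have mw : measurable_fun setT (fun a => a `^ (- (2 * b))) by meas.
have mJ : measurable_fun setT (fun p : R * R => (J p.1 p.2)%:E) by rewrite /J; meas.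
have J0 a xi : (0 <= (J a xi)%:E)%E by rewrite lee_fin /J; pos.
rewrite (tonelli nua mu (f := fun a xi => (J a xi)%:E))//.
apply: (eq_integral_hmu al_gt).
- apply: (measurable_tonelli nua (f := fun xi a => (J a xi)%:E)) => //.
  by rewrite /J; meas.
- by meas.
move=> xi x0.
rewrite integral_nua; last first.
  by exact: (measurableT_comp mJ (measurable_pair2 xi)).
transitivity (\int[lebR]_a ((v xi * N xi * K)%:E * (if (0 < a)%R then (a^-1)%:E * (P (xi / a))%:E else 0)))%E.
  apply: eq_integral => a _; rewrite /ada; case: ifP => a_gt0; last by rewrite mul0e mule0.
  rewrite /J -!EFinM; congr EFin.
  have -> : a^-1 = a `^ (2 * al + 1) * a `^ (- (2 * b)).
    rewrite -powRD ?(gt_eqF a_gt0) ?implybT// (_ : _ + _ = -1); last by ring.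
    by rewrite powR_inv1// ltW.
  by ring.
have minv := @measurable_inv R.
have mI (G : R -> R) : measurable_fun setT G -> measurable_fun setT (fun a : R => if (0 < a)%R then (a^-1)%:E * (G a)%:E else 0)%E by move=> mG; meas.
rewrite ge0_integralZl_EFin//; last 3 first.
- by move=> a _; case: ifP => // a_gt0; rewrite -EFinM lee_fin; pos.
- by apply: (mI (fun a => P (xi / a))); meas.
- by pos.
rewrite (@integral_inversion (fun a => (P a)%:E) xi x0); last by meas.
by rewrite EFinM -muleA Hc mule1.
Qed.

Variables (phi1 phi2 : R -> R) (k : R).
Hypotheses (L1 : L12 phi1) (L2 : L12 phi2).

(* Complex functions are split: [NH f1 f2] is the squared modulus of the Hankel
   transform of [f1 + i f2], and [W1], [W2] are the real and imaginary parts of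
   the wavelet transform of [h1 + i h2] for the wavelet [phi1 + i phi2], with
   [k] standing for c_psi^(-1/2). *)
Definition NH f1 f2 xi : R := Hk al f1 xi ^+ 2 + Hk al f2 xi ^+ 2.

Hypothesis Hc : ((k ^+ 2)%:E * \int[lebR]_a (if (0 < a)%R then (a^-1)%:E * (NH phi1 phi2 a)%:E else 0) = 1)%E.

Lemma NH_ge0 f1 f2 xi : 0 <= NH f1 f2 xi.
Proof. by rewrite addr_ge0 ?sqr_ge0. Qed.

Lemma measurable_NH f1 f2 : measurable_fun setT f1 -> measurable_fun setT f2 ->
  measurable_fun setT (NH f1 f2).
Proof.
by move=> m1 m2; have h1 := measurable_Hk al_gt m1; have h2 := measurable_Hk al_gt m2; rewrite /NH; meas.
Qed.

(** The weight [v] is 1 for the norm identity and [1 - expR (- (s * xi^2))] for the energy. *)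
Lemma calderon v h1 h2 : measurable_fun setT v -> (forall xi, 0 <= v xi) ->
  measurable_fun setT h1 -> measurable_fun setT h2 ->
  (\int[nua]_a \int[mu]_xi (v xi * (k ^+ 2 * (a `^ (- (2 * b)) * (NH h1 h2 xi * NH phi1 phi2 (xi / a)))))%:E =
   \int[mu]_xi (v xi * NH h1 h2 xi)%:E)%E.
Proof.
move=> mv v0 m1 m2.
apply: (@scale_average (k ^+ 2) v (NH h1 h2) (NH phi1 phi2)) => //.
- exact: measurable_NH.
- by apply: measurable_NH; apply: L12_meas.
- exact: sqr_ge0.
- exact: NH_ge0.
- exact: NH_ge0.
Qed.

Definition W1 h1 h2 a x : R := k * (wt phi1 h1 (a, x) + wt phi2 h2 (a, x)).
Definition W2 h1 h2 a x : R := k * (wt phi1 h2 (a, x) - wt phi2 h1 (a, x)).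

Lemma L12_cw phi h : L12 phi -> L12 h -> L12 (cw al phi h).
Proof.
move=> [p1 p2] [h1 h2]; have mp := integrable_meas p1; have mh := integrable_meas h1.
have i := integrable_cw al_gt p1 h1; split => //.
exact: (integrable_mul_bounded i (integrable_meas i) (fun x => cw_bounded al_gt x mp mh p2 h2)).
Qed.

Lemma L12Z c f : L12 f -> L12 (fun x => c * f x).
Proof.
move=> [i1 i2]; split; first exact: (integrableZl measurableT c i1).
rewrite (_ : EFin \o _ = EFin \o (fun x => c ^+ 2 * f x ^+ 2)); first exact: (integrableZl measurableT (c ^+ 2) i2).
by apply/funext => x /=; rewrite exprMn.
Qed.

Lemma L12D f g : L12 f -> L12 g -> L12 (fun x => f x + g x).
Proof.
move=> [f1 f2] [g1 g2]; split; first exact: integrable_add.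
have mf := integrable_meas f1; have mg := integrable_meas g1.
have fg := integrable_mul_L2 mf mg f2 g2.
have fg2 : mu.-integrable setT (EFin \o (fun x => 2 * (f x * g x))) := integrableZl measurableT 2 fg.
rewrite (_ : EFin \o _ = EFin \o (fun x => f x ^+ 2 + 2 * (f x * g x) + g x ^+ 2)).
  exact: (integrable_add (integrable_add f2 fg2) g2).
by apply/funext => x /=; congr EFin; ring.
Qed.

Lemma HkZ c f xi : mu.-integrable setT (EFin \o f) -> Hk al (fun x => c * f x) xi = c * Hk al f xi.
Proof.
move=> iF; rewrite /Hk -(RintegralZl _ measurableT (integrable_jal al_gt xi iF)).
by apply: eq_Rintegral => x _; rewrite mulrA.
Qed.

Lemma HkD f g xi : mu.-integrable setT (EFin \o f) -> mu.-integrable setT (EFin \o g) ->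
  Hk al (fun x => f x + g x) xi = Hk al f xi + Hk al g xi.
Proof.
move=> iF iG; rewrite /Hk -(RintegralD measurableT (integrable_jal al_gt xi iF) (integrable_jal al_gt xi iG)).
by apply: eq_Rintegral => x _; rewrite mulrDl.
Qed.

Section fixed_scale.
Variables (h1 h2 : R -> R) (a : R).
Hypotheses (H1 : L12 h1) (H2 : L12 h2) (a_gt0 : 0 < a).

Let C11 := L12_cw (L12_dl a_gt0 L1) H1.
Let C22 := L12_cw (L12_dl a_gt0 L2) H2.
Let C12 := L12_cw (L12_dl a_gt0 L1) H2.
Let C21 := L12_cw (L12_dl a_gt0 L2) H1.

Lemma W1E : W1 h1 h2 a = (fun x => k * (cw al (dl a phi1) h1 x + cw al (dl a phi2) h2 x)).
Proof. by []. Qed.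

Lemma W2E : W2 h1 h2 a = (fun x => k * (cw al (dl a phi1) h2 x + (- 1) * cw al (dl a phi2) h1 x)).
Proof. by apply/funext => x; rewrite /W2 mulN1r. Qed.

Lemma L12_W1 : L12 (W1 h1 h2 a).
Proof. by rewrite W1E; exact: (L12Z k (L12D C11 C22)). Qed.

Lemma L12_W2 : L12 (W2 h1 h2 a).
Proof. by rewrite W2E; exact: (L12Z k (L12D C12 (L12Z (-1) C21))). Qed.

(** The two transforms are the real and imaginary parts of a product of complex numbers, one of them
    conjugated; the modulus is multiplicative. *)
Lemma Hk_W xi : Hk al (W1 h1 h2 a) xi ^+ 2 + Hk al (W2 h1 h2 a) xi ^+ 2 =
  k ^+ 2 * (a `^ (- (2 * b)) * (NH h1 h2 xi * NH phi1 phi2 (xi / a))).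
Proof.
have [p1 p1'] := L12_dl a_gt0 L1; have [p2 p2'] := L12_dl a_gt0 L2.
have [q1 q1'] := H1; have [q2 q2'] := H2.
have D1 := L12D C11 C22; have Z := L12Z (-1) C21; have D2 := L12D C12 Z.
rewrite W2E W1E (HkZ _ _ (proj1 D1)) (HkZ _ _ (proj1 D2)).
rewrite (HkD _ (proj1 C11) (proj1 C22)) (HkD _ (proj1 C12) (proj1 Z)) (HkZ _ _ (proj1 C21)).
rewrite !(Hk_cw al_gt)// !(Hk_dl _ a_gt0) ?(proj1 L1) ?(proj1 L2)//.
have -> : a `^ (- (2 * b)) = a `^ (- b) ^+ 2.
  by rewrite -powR_mulrn ?powR_ge0// -powRrM; congr powR; ring.
rewrite /NH; move: (Hk al h1 xi) (Hk al h2 xi) (Hk al phi1 _) (Hk al phi2 _) (a `^ (- b)) => A B C D E.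
by ring.
Qed.

Lemma plancherel_W : (\int[mu]_x (W1 h1 h2 a x ^+ 2)%:E + \int[mu]_x (W2 h1 h2 a x ^+ 2)%:E =
  \int[mu]_xi (1 * (k ^+ 2 * (a `^ (- (2 * b)) * (NH h1 h2 xi * NH phi1 phi2 (xi / a)))))%:E)%E.
Proof.
have [i1 j1] := L12_W1; have [i2 j2] := L12_W2.
have m1 := measurable_Hk al_gt (integrable_meas i1); have m2 := measurable_Hk al_gt (integrable_meas i2).
rewrite -(plancherel al_gt i1 j1) -(plancherel al_gt i2 j2) -ge0_integralD//; last 4 first.
- by move=> x _; rewrite lee_fin sqr_ge0.
- by meas.
- by move=> x _; rewrite lee_fin sqr_ge0.
- by meas.
by apply: eq_integral => xi _; rewrite -EFinD Hk_W mul1r.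
Qed.

Lemma energy_spectral s F : 0 < s -> L12 F ->
  (En al s F = 2%:E * \int[mu]_xi ((1 - expR (- (s * xi ^+ 2))) * Hk al F xi ^+ 2)%:E)%E.
Proof.
move=> s0 [i1 i2]; rewrite (energy_id al_gt s0 i1 i2) EFinM; congr (_ * _)%E.
have mF := integrable_meas i1; have mH := measurable_Hk al_gt mF.
have iH2 : mu.-integrable setT (EFin \o (fun xi => Hk al F xi ^+ 2)).
  apply/(integrable_ge0 mu); [by meas|by move=> xi; exact: sqr_ge0|].
  rewrite (plancherel al_gt i1 i2).
  by move/(integrable_ge0 mu) : i2; apply; [meas|move=> y; exact: sqr_ge0].
have E1 : \int[mu]_x (F x ^+ 2) = \int[mu]_xi (Hk al F xi ^+ 2) by rewrite /Rintegral (plancherel al_gt i1 i2).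
have ie : mu.-integrable setT (EFin \o (fun xi => expR (- (s * xi ^+ 2)) * Hk al F xi * Hk al F xi)).
  apply: (integrable_mul_bounded _ mH) => [|xi]; last exact: (Hk_le al_gt).
  apply: (integrable_mul_bounded (integrable_gauss0 al_gt s0) mH) => xi.
  exact: (Hk_le al_gt).
rewrite E1 -(RintegralB measurableT iH2 ie) -(integral_EFin (integrable_sub iH2 ie)).
by apply: eq_integral => xi _; congr EFin; ring.
Qed.

Lemma energy_W s : 0 < s -> (En al s (W1 h1 h2 a) + En al s (W2 h1 h2 a) =
  2%:E * \int[mu]_xi ((1 - expR (- (s * xi ^+ 2))) *
    (k ^+ 2 * (a `^ (- (2 * b)) * (NH h1 h2 xi * NH phi1 phi2 (xi / a)))))%:E)%E.
Proof.
move=> s0.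
have [i1 j1] := L12_W1; have [i2 j2] := L12_W2.
have m1 := measurable_Hk al_gt (integrable_meas i1); have m2 := measurable_Hk al_gt (integrable_meas i2).
have e0 xi : 0 <= 1 - expR (- (s * xi ^+ 2)).
  by rewrite subr_ge0 -[leRHS]expR0 ler_expR oppr_le0 mulr_ge0 ?sqr_ge0// ltW.
have g (H : R -> R) xi : (0 <= ((1 - expR (- (s * xi ^+ 2))) * H xi ^+ 2)%:E)%E.
  by rewrite lee_fin mulr_ge0 ?sqr_ge0.
rewrite (energy_spectral s0 L12_W1) (energy_spectral s0 L12_W2) -ge0_muleDr; last 2 first.
- by apply: integral_ge0 => xi _; exact: (g (Hk al (W1 h1 h2 a))).
- by apply: integral_ge0 => xi _; exact: (g (Hk al (W2 h1 h2 a))).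
have mm (H : R -> R) : measurable_fun setT H ->
    measurable_fun setT (fun xi => ((1 - expR (- (s * xi ^+ 2))) * H xi ^+ 2)%:E) by move=> mH; meas.
congr (_ * _)%E.
rewrite -(ge0_integralD mu measurableT (fun x _ => g (Hk al (W1 h1 h2 a)) x) (mm _ m1)
  (fun x _ => g (Hk al (W2 h1 h2 a)) x) (mm _ m2)).
by apply: eq_integral => xi _; rewrite -EFinD -mulrDr Hk_W.
Qed.

End fixed_scale.

End wavelet.

(** The bound is asked only for [n >= N]; the sequence is therefore shifted by [N] before Fatou's
    lemma is applied. *)
Lemma fatou_le (R : realType) d (T : measurableType d) (m : {measure set T -> \bar R})
    (fn : nat -> T -> R) (f : T -> R) (C : \bar R) N :
  (forall n, measurable_fun setT (fn n)) -> (forall n x, 0 <= fn n x) ->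
  (forall x, fn^~ x @ \oo --> f x) ->
  (forall n, (N <= n)%N -> (\int[m]_x (fn n x)%:E <= C)%E) ->
  (\int[m]_x (f x)%:E <= C)%E.
Proof.
move=> mf f0 cf fC.
have E x : (f x)%:E = limn_einf (fun n => (fn (n + N)%N x)%:E).
  have h : (fun n => (fn (n + N)%N x)%:E) @ \oo --> (f x)%:E.
    apply: cvg_EFin; first exact: nearW.
    by apply: (@cvg_comp _ _ _ (addn^~ N) (fn^~ x) \oo \oo (nbhs (f x))); [exact: cvg_addnr|exact: cf].
  by rewrite is_cvg_limn_einfE; [apply/esym/cvg_lim|apply/cvg_ex; exists (f x)%:E].
under eq_integral do rewrite E.
apply: le_trans (@fatou _ _ _ m setT measurableT (fun n x => (fn (n + N)%N x)%:E) _ _) _.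
- by move=> n; apply/measurable_EFinP.
- by move=> n x _; rewrite lee_fin.
rewrite limn_einf_lim; apply: lime_le; first exact: is_cvg_einfs.
apply: nearW => n; apply: le_trans (fC (n + N)%N (leq_addl _ _)).
by apply: ereal_inf_lbound; exists n => /=.
Qed.

Lemma product_sigma_finite (R : realType) d1 d2 (T1 : measurableType d1) (T2 : measurableType d2)
    (m1 : {sigma_finite_measure set T1 -> \bar R}) (m2 : {sigma_finite_measure set T2 -> \bar R}) :
  sigma_finite setT (m1 \x m2)%E.
Proof.
have /sigma_finiteP[F [TF ndF Fm]] := sigma_finiteT m1.
have /sigma_finiteP[G [TG ndG Gm]] := sigma_finiteT m2.
exists (fun n => F n `*` G n).
  apply/seteqP; split => // -[x y] _.
  have [m _ Fx] : (\bigcup_i F i) x by rewrite -TF.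
  have [n _ Gy] : (\bigcup_i G i) y by rewrite -TG.
  exists (maxn m n) => //; split; [move: Fx|move: Gy]; apply/subsetPset.
    exact/ndF/leq_maxl.
  exact/ndG/leq_maxr.
move=> n; have [mF fF] := Fm n; have [mG fG] := Gm n.
split; first exact: measurableX.
by rewrite product_measure1E// lte_mul_pinfty// ge0_fin_numE.
Qed.

Section hmu2.
Context {R : realType}.
Variable al : R.

(* [hmu al \x hmu al], bundled as a sigma-finite measure so that it can be a
   factor of a further product *)
Definition hmu2 : set (R * R) -> \bar R := (hmu al \x hmu al)%E.

HB.instance Definition _ := isMeasure.Build _ _ R hmu2
  (measure0 (hmu al \x hmu al)%E) (measure_ge0 (hmu al \x hmu al)%E)
  (@measure_semi_sigma_additive _ _ _ (hmu al \x hmu al)%E).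

Let hmu2_sigma_finite : sigma_finite setT hmu2.
Proof. exact: product_sigma_finite. Qed.

HB.instance Definition _ := @Measure_isSigmaFinite.Build _ _ R hmu2 hmu2_sigma_finite.

End hmu2.

(** * Norm and energy of the transform integrated over all scales *)

Section isometry.
Context {R : realType}.
Variable al : R.
Hypothesis al_gt : - 2^-1 < al.
Variables (phi1 phi2 : R -> R) (k : R).
Hypotheses (L1 : L12 al phi1) (L2 : L12 al phi2).
Hypothesis Hc : ((k ^+ 2)%:E * \int[lebR]_a (if (0 < a)%R then (a^-1)%:E * (NH al phi1 phi2 a)%:E else 0) = 1)%E.
Implicit Types x y z s t u xi B c r e a : R.
Implicit Types F G g h f v : R -> R.

Local Notation mu := (hmu al).
Local Notation mu2 := (hmu2 al).
Local Notation nu := (nua al).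
Local Notation b := (al + 1).

(* Scales [a <= 0] are junk: masking them makes the transform a function on the
   whole plane that is compatible with [nua]. *)
Definition V1 h1 h2 (p : R * R) : R := if 0 < p.1 then W1 al phi1 phi2 k h1 h2 p.1 p.2 else 0.
Definition V2 h1 h2 (p : R * R) : R := if 0 < p.1 then W2 al phi1 phi2 k h1 h2 p.1 p.2 else 0.

Lemma measurable_V h1 h2 : measurable_fun setT h1 -> measurable_fun setT h2 ->
  measurable_fun setT (V1 h1 h2) /\ measurable_fun setT (V2 h1 h2).
Proof.
move=> m1 m2; have n1 := L12_meas L1; have n2 := L12_meas L2.
have w11 := measurable_wt al n1 m1; have w22 := measurable_wt al n2 m2.
have w12 := measurable_wt al n1 m2; have w21 := measurable_wt al n2 m1.
by rewrite /V1 /V2 /W1 /W2; split; meas.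
Qed.

(** The weight acts on the position alone: 1 gives the squared norm of the transform, [x^2] the
    moment in the theorem, and [gsw] the gain in the ground state inequality. *)
Definition TT v h1 h2 : \bar R :=
  (\int[nu \x mu]_p (v p.2 * (V1 h1 h2 p ^+ 2 + V2 h1 h2 p ^+ 2))%:E)%E.

Lemma TT_fubini v h1 h2 : measurable_fun setT h1 -> measurable_fun setT h2 ->
  measurable_fun setT v -> (forall x, 0 <= v x) ->
  TT v h1 h2 = (\int[nu]_a \int[mu]_x (v x * (V1 h1 h2 (a, x) ^+ 2 + V2 h1 h2 (a, x) ^+ 2))%:E)%E.
Proof.
move=> m1 m2 mv v0; have [mV1 mV2] := measurable_V m1 m2.
rewrite /TT; move: (V1 h1 h2) (V2 h1 h2) mV1 mV2 => A B mV1 mV2; rewrite fubini_tonelli1//; first by meas.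
by move=> p; rewrite lee_fin mulr_ge0// addr_ge0 ?sqr_ge0.
Qed.

Definition EE s h1 h2 : \bar R :=
  (\int[nu \x mu2]_q (((V1 h1 h2 (q.1, q.2.1) - V1 h1 h2 (q.1, q.2.2)) ^+ 2 +
     (V2 h1 h2 (q.1, q.2.1) - V2 h1 h2 (q.1, q.2.2)) ^+ 2) * hp al s q.2.1 q.2.2)%:E)%E.

Lemma EE_fubini s h1 h2 : measurable_fun setT h1 -> measurable_fun setT h2 ->
  EE s h1 h2 = (\int[nu]_a (En al s (fun x => V1 h1 h2 (a, x)) + En al s (fun x => V2 h1 h2 (a, x))))%E.
Proof.
move=> m1 m2; have [mV1 mV2] := measurable_V m1 m2; have mp := measurable_hp al s.
have mp2 : measurable_fun setT (fun q : R * (R * R) => hp al s q.2.1 q.2.2) := measurableT_comp mp measurable_snd.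
rewrite /EE; move: (V1 h1 h2) (V2 h1 h2) mV1 mV2 => A B mV1 mV2.
rewrite fubini_tonelli1//; last 2 first.
- by meas.
- by move=> q; rewrite lee_fin mulr_ge0 ?hp_ge0// addr_ge0 ?sqr_ge0.
apply: eq_integral => a _; rewrite /fubini_F/= /En -/(hmu2 al).
have n1 : measurable_fun setT (fun x => A (a, x)) by meas.
have n2 : measurable_fun setT (fun x => B (a, x)) by meas.
have g (H : R -> R) (p : R * R) : (0 <= ((H p.1 - H p.2) ^+ 2 * hp al s p.1 p.2)%:E)%E.
  by rewrite lee_fin mulr_ge0 ?sqr_ge0 ?hp_ge0.
have e1 : measurable_fun setT (fun p : R * R => ((A (a, p.1) - A (a, p.2)) ^+ 2 * hp al s p.1 p.2)%:E).
  by apply/measurable_EFinP; exact: (measurable_En al s n1).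
have e2 : measurable_fun setT (fun p : R * R => ((B (a, p.1) - B (a, p.2)) ^+ 2 * hp al s p.1 p.2)%:E).
  by apply/measurable_EFinP; exact: (measurable_En al s n2).
rewrite -(ge0_integralD mu2 measurableT (fun p _ => g (fun x => A (a, x)) p) e1 (fun p _ => g (fun x => B (a, x)) p) e2).
by apply: eq_integral => p _; rewrite -EFinD mulrDl.
Qed.

Definition nrm2 h1 h2 : \bar R := (\int[mu]_x (h1 x ^+ 2 + h2 x ^+ 2)%:E)%E.

Lemma nrm2D h1 h2 : measurable_fun setT h1 -> measurable_fun setT h2 ->
  nrm2 h1 h2 = (\int[mu]_x (h1 x ^+ 2)%:E + \int[mu]_x (h2 x ^+ 2)%:E)%E.
Proof.
move=> m1 m2; rewrite -ge0_integralD//; last 4 first.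
- by move=> x _; rewrite lee_fin sqr_ge0.
- by meas.
- by move=> x _; rewrite lee_fin sqr_ge0.
- by meas.
Qed.

Lemma measurable_integral_nua (f : R * R -> \bar R) : measurable_fun setT f ->
  (forall p, 0 <= f p)%E -> measurable_fun setT (fun a => \int[mu]_x f (a, x))%E.
Proof.
move=> mf f0; apply: (measurable_tonelli mu (f := fun a x => f (a, x))) => //.
by apply: (measurableT_comp mf); meas.
Qed.

Lemma scale_kernel_measurable v h1 h2 : measurable_fun setT v -> (forall x, 0 <= v x) ->
  measurable_fun setT h1 -> measurable_fun setT h2 ->
  measurable_fun setT (fun a => \int[mu]_xi (v xi * (k ^+ 2 * (a `^ (- (2 * b)) *
     (NH al h1 h2 xi * NH al phi1 phi2 (xi / a)))))%:E)%E.
Proof.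
move=> mv v0 m1 m2; have mN := measurable_NH al_gt m1 m2.
have mP := measurable_NH al_gt (L12_meas L1) (L12_meas L2).
have N0 := NH_ge0 al h1 h2; have P0 := NH_ge0 al phi1 phi2.
move: (NH al h1 h2) (NH al phi1 phi2) mN mP N0 P0 => N P mN mP N0 P0.
have mw : measurable_fun setT (fun a : R => a `^ (- (2 * b))) by meas.
apply: (@measurable_integral_nua (fun p => (v p.2 * (k ^+ 2 * (p.1 `^ (- (2 * b)) * (N p.2 * P (p.2 / p.1)))))%:E)).
  by meas.
by move=> p; pos.
Qed.

Lemma TT_L12 h1 h2 : L12 al h1 -> L12 al h2 -> TT (fun=> 1) h1 h2 = nrm2 h1 h2.
Proof.
move=> H1 H2; have m1 := L12_meas H1; have m2 := L12_meas H2.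
have [mV1 mV2] := measurable_V m1 m2.
have m1c : measurable_fun [set: R] (fun=> 1 : R) by exact: measurable_cst.
rewrite TT_fubini// nrm2D// -(plancherel al_gt (proj1 H1) (proj2 H1)) -(plancherel al_gt (proj1 H2) (proj2 H2)).
rewrite -nrm2D; [|exact: (measurable_Hk al_gt m1)|exact: (measurable_Hk al_gt m2)].
transitivity (\int[mu]_xi (1 * NH al h1 h2 xi)%:E)%E; last by apply: eq_integral => xi _; rewrite mul1r.
rewrite -(calderon al_gt L1 L2 Hc m1c (fun=> ler01) m1 m2).
apply: eq_integral_nua.
- apply: (@measurable_integral_nua (fun p => (1 * (V1 h1 h2 p ^+ 2 + V2 h1 h2 p ^+ 2))%:E)); first by move: (V1 h1 h2) (V2 h1 h2) mV1 mV2 => A B mV1 mV2; meas.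
  by move=> p; rewrite lee_fin mul1r addr_ge0 ?sqr_ge0.
- exact: (scale_kernel_measurable m1c (fun=> ler01) m1 m2).
move=> a a_gt0; rewrite -(plancherel_W al_gt k L1 L2 H1 H2 a_gt0) -nrm2D.
- by apply: eq_integral => x _; rewrite mul1r /V1 /V2/= a_gt0.
- exact: (L12_meas (L12_W1 al_gt k L1 L2 H1 H2 a_gt0)).
- exact: (L12_meas (L12_W2 al_gt k L1 L2 H1 H2 a_gt0)).
Qed.

Lemma EE_L12 s h1 h2 : 0 < s -> L12 al h1 -> L12 al h2 ->
  EE s h1 h2 = (2%:E * \int[mu]_xi ((1 - expR (- (s * xi ^+ 2))) * NH al h1 h2 xi)%:E)%E.
Proof.
move=> s0 H1 H2; have m1 := L12_meas H1; have m2 := L12_meas H2.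
have [mV1 mV2] := measurable_V m1 m2; have mp := measurable_hp al s.
have mp2 : measurable_fun setT (fun q : R * (R * R) => hp al s q.2.1 q.2.2) := measurableT_comp mp measurable_snd.
have mv : measurable_fun setT (fun xi : R => 1 - expR (- (s * xi ^+ 2))) by meas.
have v0 xi : 0 <= 1 - expR (- (s * xi ^+ 2)).
  by rewrite subr_ge0 -[leRHS]expR0 ler_expR oppr_le0 mulr_ge0 ?sqr_ge0// ltW.
rewrite EE_fubini// -(calderon al_gt L1 L2 Hc mv v0 m1 m2).
have mS := scale_kernel_measurable mv v0 m1 m2.
have mEn (V : R * R -> R) : measurable_fun setT V -> measurable_fun setT (fun a => En al s (fun x => V (a, x))).
  move=> mV; apply: (measurable_tonelli mu2 (f := fun a (p : R * R) => ((V (a, p.1) - V (a, p.2)) ^+ 2 * hp al s p.1 p.2)%:E)).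
    by meas.
  by move=> a p; rewrite lee_fin mulr_ge0 ?sqr_ge0 ?hp_ge0.
rewrite -ge0_integralZl_EFin//; last first.
  move=> a _; apply: integral_ge0 => xi _; rewrite lee_fin.
  have N0 := NH_ge0 al h1 h2 xi; have P0 := NH_ge0 al phi1 phi2 (xi / a).
  by have := v0 xi; move: (NH _ _ _ _) (NH _ _ _ _) N0 P0 (1 - _) => N P N0 P0 v' v'0; pos.
apply: eq_integral_nua.
- by apply: emeasurable_funD; exact: mEn.
- exact: emeasurable_funM.
move=> a a_gt0; rewrite -(energy_W al_gt k L1 L2 H1 H2 a_gt0 s0).
by congr (_ + _)%E; apply: eq_integral => p _; rewrite /V1 /V2/= a_gt0.
Qed.

Definition tru h n x : R := if x <= n%:R then h x else 0.

(** [tru] cuts on the right only; vanishing on [x <= 0] ensures that truncations live on a bounded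
    interval and so belong to [L12]. *)
Definition L2f h := [/\ measurable_fun setT h, (forall x, x <= 0 -> h x = 0) &
  mu.-integrable setT (EFin \o (fun x => h x ^+ 2))].

Lemma measurable_tru h n : measurable_fun setT h -> measurable_fun setT (tru h n).
Proof. by move=> mh; rewrite /tru; meas. Qed.

Lemma tru_le h n x : `|tru h n x| <= `|h x|.
Proof. by rewrite /tru; case: ifP => // _; rewrite normr0. Qed.

Lemma tru_sqr_le h n x : tru h n x ^+ 2 <= h x ^+ 2.
Proof. by rewrite /tru; case: ifP => // _; rewrite expr0n sqr_ge0. Qed.

Lemma L12_tru h n : L2f h -> L12 al (tru h n).
Proof.
move=> [mh h0 h2]; have mt := measurable_tru n mh; split.
  pose g x : R := if 0 < x < n.+1%:R then 1 else 0.
  have mg : measurable_fun setT g by rewrite /g; meas.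
  have ig : mu.-integrable setT (EFin \o g).
    apply: (@integrable_supported _ _ al_gt g 1 n.+1%:R) => //.
      by move=> x; rewrite /g; case: ifP => _; rewrite ?normr1// normr0.
    by move=> x /negbTE; rewrite /g => ->.
  apply: (@le_integrable _ _ _ mu _ measurableT _ _ _ _ (integrable_add ig h2)); first by meas.
  move=> x _; rewrite lee_fin [leRHS]ger0_norm; last first.
    by rewrite addr_ge0 ?sqr_ge0// /g; case: ifP.
  rewrite /tru /g; case: ifP => xn; last first.
    by rewrite normr0 addr_ge0 ?sqr_ge0//; case: ifP.
  have [x0|x0] := leP x 0; first by rewrite h0// normr0 expr0n/= addr0.
  rewrite (le_lt_trans xn) ?ltr_nat//= -(real_normK (num_real (h x))).
  by have := sqr_ge0 (`|h x| - 1); have := normr_ge0 (h x); nra.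
apply: (@le_integrable _ _ _ mu _ measurableT _ _ _ _ h2); first by meas.
by move=> x _; rewrite lee_fin !ger0_norm ?sqr_ge0// tru_sqr_le.
Qed.

Lemma tru_cvg h x : (fun n => tru h n x) @ \oo --> h x.
Proof.
apply: cvg_near_cst; have H := @nbhs_infty_ger R x.
by apply: filterS H => n xn; rewrite /tru xn.
Qed.

(** Pointwise at every [(a, x)], by dominated convergence: [h] and the translate of the dilated
    [phi] are both square integrable, so their product is a majorant. Fatou's lemma on the product
    space relies on this. *)
Lemma wt_cvg phi h a x : 0 < a -> L12 al phi -> L2f h ->
  (fun n => wt al phi (tru h n) (a, x)) @ \oo --> wt al phi h (a, x).
Proof.
move=> a_gt0 Lp [mh h0 h2]; have [p1 p2] := L12_dl al_gt a_gt0 Lp; have mp := integrable_meas p1.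
have ih := integrable_h_tr al_gt x mp mh p2 h2.
apply: (proj2 (@Rint_dct _ _ _ mu (fun n t => tru h n t * tr al (dl al a phi) x t) _ _ _ _ (integrable_absr ih) _)).
- move=> n; have mt := measurable_tru n mh; have mtr := measurable_tr1 al x mp; meas.
- by move=> t; apply: cvgMl; exact: tru_cvg.
- by move=> n t; rewrite !normrM ler_wpM2r// tru_le.
Qed.

Lemma V_cvg h1 h2 p : L2f h1 -> L2f h2 ->
  (fun n => V1 (tru h1 n) (tru h2 n) p) @ \oo --> V1 h1 h2 p /\
  (fun n => V2 (tru h1 n) (tru h2 n) p) @ \oo --> V2 h1 h2 p.
Proof.
move=> H1 H2; rewrite /V1 /V2; case: ifP => p0; last by split; exact: cvg_cst.
by split; apply: cvgMr; [apply: cvgD|apply: cvgB]; exact: wt_cvg.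
Qed.

Lemma L2f_meas h : L2f h -> measurable_fun setT h. Proof. by case. Qed.

Lemma TT_le h1 h2 : L2f h1 -> L2f h2 -> (TT (fun=> 1%R) h1 h2 <= nrm2 h1 h2)%E.
Proof.
move=> H1 H2; have m1 := L2f_meas H1; have m2 := L2f_meas H2.
apply: (@fatou_le _ _ _ (nu \x mu)%E (fun n p => 1 * (V1 (tru h1 n) (tru h2 n) p ^+ 2 + V2 (tru h1 n) (tru h2 n) p ^+ 2)) _ _ 0%N).
- move=> n; have [mV1 mV2] := measurable_V (measurable_tru n m1) (measurable_tru n m2).
  by move: (V1 _ _) (V2 _ _) mV1 mV2 => A B mV1 mV2; meas.
- by move=> n p; rewrite mul1r addr_ge0 ?sqr_ge0.
- move=> p; have [c1 c2] := V_cvg p H1 H2.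
  by apply: cvgMr; apply: cvgD; [exact: (cvgM c1 c1)|exact: (cvgM c2 c2)].
move=> n _; rewrite -[leLHS]/(TT (fun=> 1) (tru h1 n) (tru h2 n)).
rewrite (TT_L12 (L12_tru n H1) (L12_tru n H2)); have t1 := measurable_tru n m1; have t2 := measurable_tru n m2.
apply: ge0_le_integral => //.
- by move=> x _; rewrite lee_fin addr_ge0 ?sqr_ge0.
- by meas.
- by meas.
- by move=> x _; rewrite lee_fin lerD// tru_sqr_le.
Qed.

End isometry.

(** * The isometry for square integrable functions and the spectral bound on the energy *)

Section uncertainty.
Context {R : realType}.
Variable al : R.
Hypothesis al_gt : - 2^-1 < al.
Variables (phi1 phi2 : R -> R) (k : R).
Hypotheses (L1 : L12 al phi1) (L2 : L12 al phi2).
Hypothesis Hc : ((k ^+ 2)%:E * \int[lebR]_a (if (0 < a)%R then (a^-1)%:E * (NH al phi1 phi2 a)%:E else 0) = 1)%E.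
Implicit Types x y z s t u xi B c r e a lam eps : R.
Implicit Types F G g h f v : R -> R.

Local Notation mu := (hmu al).
Local Notation nu := (nua al).
Local Notation b := (al + 1).
Local Notation U1 := (V1 al phi1 phi2 k).
Local Notation U2 := (V2 al phi1 phi2 k).
Local Notation TTk := (TT al phi1 phi2 k).
Local Notation EE := (EE al phi1 phi2 k).
Local Notation nrm2 := (nrm2 al).
Local Notation L2f := (L2f al).

Let b0 : 0 < b. Proof. exact: al1_gt0. Qed.

(** The reflection equals [h] up to [n] and [- h] beyond, hence has the same square. *)
Lemma L2f_reflect h n : L2f h -> L2f (fun x => 2 * tru h n x - h x).
Proof.
move=> [mh h0 h2]; have mt := measurable_tru n mh.
have E x : (2 * tru h n x - h x) ^+ 2 = h x ^+ 2.
  by rewrite /tru; case: ifP => _; ring.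
split.
- by meas.
- by move=> x x0; rewrite /tru h0//; case: ifP => _; ring.
- by rewrite (_ : EFin \o _ = EFin \o (fun x => h x ^+ 2))//; apply/funext => x /=; rewrite E.
Qed.

Lemma wt_reflect phi h n a x : 0 < a -> L12 al phi -> L2f h ->
  wt al phi (fun x => 2 * tru h n x - h x) (a, x) = 2 * wt al phi (tru h n) (a, x) - wt al phi h (a, x).
Proof.
move=> a_gt0 Lp H; have [mh h0 h2] := H; have [p1 p2] := L12_dl al_gt a_gt0 Lp; have mp := integrable_meas p1.
have ih := integrable_h_tr al_gt x mp mh p2 h2.
have [t1 t2] := L12_tru al_gt n H.
have it := integrable_h_tr al_gt x mp (integrable_meas t1) p2 t2.
have i2 : mu.-integrable setT (EFin \o (fun t => 2 * (tru h n t * tr al (dl al a phi) x t))) := integrableZl measurableT 2 it.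
rewrite /wt /cw/= -(RintegralZl _ measurableT it) -(RintegralB measurableT i2 ih).
by apply: eq_Rintegral => t _; ring.
Qed.

Lemma V_reflect h1 h2 n p : L2f h1 -> L2f h2 ->
  U1 (fun x => 2 * tru h1 n x - h1 x) (fun x => 2 * tru h2 n x - h2 x) p = 2 * U1 (tru h1 n) (tru h2 n) p - U1 h1 h2 p /\
  U2 (fun x => 2 * tru h1 n x - h1 x) (fun x => 2 * tru h2 n x - h2 x) p = 2 * U2 (tru h1 n) (tru h2 n) p - U2 h1 h2 p.
Proof.
move=> H1 H2; rewrite /V1 /V2; case: ifP => p0; last by split; ring.
rewrite /W1 /W2 !wt_reflect//; split.
  move: (wt _ _ _ _) (wt _ _ _ _) (wt _ _ _ _) (wt _ _ _ _) => A B C D; ring.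
move: (wt _ _ _ _) (wt _ _ _ _) (wt _ _ _ _) (wt _ _ _ _) => A B C D; ring.
Qed.

Lemma nrm2_fin h1 h2 : L2f h1 -> L2f h2 ->
  mu.-integrable setT (EFin \o (fun x => h1 x ^+ 2 + h2 x ^+ 2)).
Proof. by move=> [_ _ i1] [_ _ i2]; exact: integrable_add. Qed.

Lemma nrm2_tru_cvg h1 h2 : L2f h1 -> L2f h2 ->
  (fun n => \int[mu]_x (tru h1 n x ^+ 2 + tru h2 n x ^+ 2)) @ \oo --> \int[mu]_x (h1 x ^+ 2 + h2 x ^+ 2).
Proof.
move=> H1 H2; have [m1 _ _] := H1; have [m2 _ _] := H2.
apply: (proj2 (@Rint_dct _ _ _ mu (fun n x => tru h1 n x ^+ 2 + tru h2 n x ^+ 2) _ _ _ _ (nrm2_fin H1 H2) _)).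
- by move=> n; have t1 := measurable_tru n m1; have t2 := measurable_tru n m2; meas.
- move=> x; have c1 := @tru_cvg _ h1 x; have c2 := @tru_cvg _ h2 x.
  by apply: cvgD; [exact: (cvgM c1 c1)|exact: (cvgM c2 c2)].
- by move=> n x; rewrite ger0_norm ?addr_ge0 ?sqr_ge0// lerD// tru_sqr_le.
Qed.

Lemma TT_sqr_ge0 v h1 h2 : (forall x, 0 <= v x) -> (0 <= TTk v h1 h2)%E.
Proof. by move=> v0; apply: integral_ge0 => p _; rewrite lee_fin mulr_ge0// addr_ge0 ?sqr_ge0. Qed.

Lemma measurable_TT v h1 h2 : measurable_fun setT v -> L2f h1 -> L2f h2 ->
  measurable_fun setT (fun p : R * R => v p.2 * (U1 h1 h2 p ^+ 2 + U2 h1 h2 p ^+ 2)).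
Proof.
move=> mv H1 H2; have [mV1 mV2] := measurable_V k L1 L2 (L2f_meas H1) (L2f_meas H2).
by move: (U1 _ _) (U2 _ _) mV1 mV2 => A B mV1 mV2; meas.
Qed.

Lemma L2f_tru h n : L2f h -> L2f (tru h n).
Proof.
move=> H; have [mh h0 _] := H; have [_ t2] := L12_tru al_gt n H; split => //.
  exact: measurable_tru.
by move=> x x0; rewrite /tru h0//; case: ifP.
Qed.

Lemma TT_parallelogram h1 h2 n : L2f h1 -> L2f h2 ->
  (2%:E * TTk (fun=> 1%R) (tru h1 n) (tru h2 n) <=
   TTk (fun=> 1%R) h1 h2 + TTk (fun=> 1%R) (fun x => 2 * tru h1 n x - h1 x)%R (fun x => 2 * tru h2 n x - h2 x)%R)%E.
Proof.
move=> H1 H2; have m1c : measurable_fun [set: R] (fun=> 1 : R) by exact: measurable_cst.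
have M1 := measurable_TT m1c H1 H2.
have M2 := measurable_TT m1c (L2f_tru n H1) (L2f_tru n H2).
have M3 := measurable_TT m1c (L2f_reflect n H1) (L2f_reflect n H2).
have g (A B : R * R -> R) p : (0 <= (1 * (A p ^+ 2 + B p ^+ 2))%:E)%E.
  by rewrite lee_fin mul1r addr_ge0 ?sqr_ge0.
have e1 := proj2 (measurable_EFinP _ _) M1; have e3 := proj2 (measurable_EFinP _ _) M3.
rewrite /TT -ge0_integralZl_EFin//; last exact/measurable_EFinP.
rewrite -(ge0_integralD (nu \x mu)%E measurableT (fun p _ => g _ _ p) e1 (fun p _ => g _ _ p) e3).
apply: ge0_le_integral => //.
- by move=> p _; rewrite mule_ge0.
- by apply: emeasurable_funM; [exact: measurable_cst|exact/measurable_EFinP].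
- exact: emeasurable_funD.
move=> p _; have [-> ->] := V_reflect n p H1 H2.
rewrite -EFinM -EFinD lee_fin.
move: (U1 h1 h2 p) (U2 h1 h2 p) (U1 (tru h1 n) (tru h2 n) p) (U2 (tru h1 n) (tru h2 n) p) => A B C D.
have := sqr_ge0 (A - C); have := sqr_ge0 (B - D); nra.
Qed.

(* The reverse of [TT_le]: apply [TT_le] to the reflection [2 f_n - f] of [f] in its
   truncation [f_n], for which the isometry is known, and use the parallelogram law. *)
Lemma TT_eq h1 h2 : L2f h1 -> L2f h2 -> TTk (fun=> 1%R) h1 h2 = nrm2 h1 h2.
Proof.
move=> H1 H2; have le1 := TT_le al_gt L1 L2 Hc H1 H2.
have iN := nrm2_fin H1 H2.
have NE : nrm2 h1 h2 = (\int[mu]_x (h1 x ^+ 2 + h2 x ^+ 2))%:E by exact: integral_EFin.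
apply/eqP; rewrite eq_le le1/=; apply/lee_addgt0Pr => e e0.
have e20 : 0 < e / 2 by rewrite divr_gt0.
have /cvgrPdist_le /(_ _ e20) [n _ /(_ n (leqnn n))] := nrm2_tru_cvg H1 H2.
move=> /(le_trans (ler_norm _)) hn.
have P := TT_parallelogram n H1 H2.
have le2 := TT_le al_gt L1 L2 Hc (L2f_reflect n H1) (L2f_reflect n H2).
have NR : nrm2 (fun x => 2 * tru h1 n x - h1 x) (fun x => 2 * tru h2 n x - h2 x) = nrm2 h1 h2.
  apply: eq_integral => x _; congr (_ + _)%:E; rewrite /tru; case: ifP => _; ring.
rewrite (TT_L12 al_gt L1 L2 Hc (L12_tru al_gt n H1) (L12_tru al_gt n H2)) in P.
have NnE : nrm2 (tru h1 n) (tru h2 n) = (\int[mu]_x (tru h1 n x ^+ 2 + tru h2 n x ^+ 2))%:E.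
  by apply: integral_EFin; exact: (nrm2_fin (L2f_tru n H1) (L2f_tru n H2)).
have {}P := le_trans P (leeD2l _ le2).
rewrite NR NnE NE in P; rewrite NE in le1 *.
have T0 := @TT_sqr_ge0 (fun=> 1) h1 h2 (fun=> ler01).
have Tf : TTk (fun=> 1) h1 h2 \is a fin_num by rewrite ge0_fin_numE//; exact: le_lt_trans le1 (ltry _).
rewrite -(fineK Tf) -EFinM -EFinD lee_fin in P; rewrite -(fineK Tf) -EFinD lee_fin.
move: hn P; move: (\int[mu]_x (h1 x ^+ 2 + h2 x ^+ 2)) (\int[mu]_x (tru h1 n x ^+ 2 + tru h2 n x ^+ 2)) (fine _) => A B C hn P.
by lra.
Qed.

(** The transform of the truncation is split as [g] plus an error, by Young's inequality with
    parameter [e]. The multiplier [1 - expR (- (s * xi^2))] is bounded by [s * xi^2] on [g] and by 1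
    on the error, so that the error enters through its L2 norm, the only one known to tend to 0. *)
Lemma EE_tru_le g1 g2 h1 h2 s e n : 0 < s -> 0 < e -> L2f h1 -> L2f h2 ->
  measurable_fun setT g1 -> measurable_fun setT g2 ->
  (EE s (tru h1 n) (tru h2 n) <= (2 * (1 + e) * s)%:E * (\int[mu]_xi (xi ^+ 2 * (g1 xi ^+ 2 + g2 xi ^+ 2))%:E)
    + (2 * (1 + e^-1))%:E * (\int[mu]_xi ((Hk al (tru h1 n) xi - g1 xi) ^+ 2 + (Hk al (tru h2 n) xi - g2 xi) ^+ 2)%:E))%E.
Proof.
move=> s0 e0 H1 H2 mg1 mg2; have T1 := L12_tru al_gt n H1; have T2 := L12_tru al_gt n H2.
rewrite (EE_L12 al_gt L1 L2 Hc s0 T1 T2).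
have k1 := measurable_Hk al_gt (L12_meas T1); have k2 := measurable_Hk al_gt (L12_meas T2).
have c1 : 0 <= 2 * (1 + e) * s by rewrite !mulr_ge0 ?addr_ge0// ltW.
have c2 : 0 <= 2 * (1 + e^-1) by rewrite mulr_ge0// addr_ge0// invr_ge0 ltW.
rewrite /NH; move: (Hk al (tru h1 n)) (Hk al (tru h2 n)) k1 k2 => K1 K2 k1 k2.
have v1 xi : 0 <= 1 - expR (- (s * xi ^+ 2)).
  by rewrite subr_ge0 -[leRHS]expR0 ler_expR oppr_le0 mulr_ge0 ?sqr_ge0// ltW.
rewrite -!ge0_integralZl_EFin//; try by [meas|move=> xi _; rewrite lee_fin mulr_ge0 ?addr_ge0 ?sqr_ge0|move=> xi _; pos].
have m1 : measurable_fun setT (fun xi => (2 * (1 + e) * s)%:E * (xi ^+ 2 * (g1 xi ^+ 2 + g2 xi ^+ 2))%:E)%E.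
  by apply: emeasurable_funM; meas.
have m2 : measurable_fun setT (fun xi => (2 * (1 + e^-1))%:E * ((K1 xi - g1 xi) ^+ 2 + (K2 xi - g2 xi) ^+ 2)%:E)%E.
  by apply: emeasurable_funM; meas.
have q1 (xi : R) : (0 <= (2 * (1 + e) * s)%:E * (xi ^+ 2 * (g1 xi ^+ 2 + g2 xi ^+ 2))%:E)%E by pos.
have q2 (xi : R) : (0 <= (2 * (1 + e^-1))%:E * ((K1 xi - g1 xi) ^+ 2 + (K2 xi - g2 xi) ^+ 2)%:E)%E by pos.
rewrite -(ge0_integralD mu measurableT (fun p _ => q1 p) m1 (fun p _ => q2 p) m2).
apply: ge0_le_integral => //.
- by move=> xi _; have := v1 xi; move: (1 - _) => v v0; pos.
- by apply: emeasurable_funM; meas.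
- exact: emeasurable_funD.
move=> xi _; rewrite -!EFinM -EFinD lee_fin.
have w1 : 1 - expR (- (s * xi ^+ 2)) <= 1 by rewrite lerBlDr lerDl expR_ge0.
have w2 : 1 - expR (- (s * xi ^+ 2)) <= s * xi ^+ 2 by have := expR_ge1Dx (- (s * xi ^+ 2)); lra.
have w0 := v1 xi; move: (1 - _) w0 w1 w2 => v w0 w1 w2.
have sq (A B : R) : A ^+ 2 <= (1 + e) * B ^+ 2 + (1 + e^-1) * (A - B) ^+ 2.
  rewrite -subr_ge0 (_ : _ - _ = e^-1 * (A - (1 + e) * B) ^+ 2); last by field; rewrite gt_eqF.
  by rewrite mulr_ge0 ?sqr_ge0// invr_ge0 ltW.
have s1 := sq (K1 xi) (g1 xi); have s2 := sq (K2 xi) (g2 xi).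
set D := (K1 xi - g1 xi) ^+ 2 + (K2 xi - g2 xi) ^+ 2.
set G := g1 xi ^+ 2 + g2 xi ^+ 2.
set K := K1 xi ^+ 2 + K2 xi ^+ 2.
have KD : K <= (1 + e) * G + (1 + e^-1) * D by rewrite /K /G /D; lra.
have D0 : 0 <= (1 + e^-1) * D by rewrite /D; pos.
have G0 : 0 <= (1 + e) * G by rewrite /G; pos.
have h1' : v * K <= v * ((1 + e) * G + (1 + e^-1) * D) by rewrite ler_wpM2l.
have h2' : v * ((1 + e) * G) <= s * xi ^+ 2 * ((1 + e) * G) by rewrite ler_wpM2r.
have h3' : v * ((1 + e^-1) * D) <= (1 + e^-1) * D by rewrite ler_piMl.
rewrite [leRHS]mulrDr in h1'.
have -> : 2 * (1 + e) * s * (xi ^+ 2 * G) + 2 * (1 + e^-1) * D =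
    2 * (s * xi ^+ 2 * ((1 + e) * G) + (1 + e^-1) * D) by ring.
by rewrite ler_wpM2l//; lra.
by move=> xi _; rewrite lee_fin mulr_ge0 ?v1 ?addr_ge0 ?sqr_ge0.
Qed.

Lemma EE_le g1 g2 h1 h2 s : 0 < s -> L2f h1 -> L2f h2 ->
  measurable_fun setT g1 -> measurable_fun setT g2 ->
  (fun n => \int[mu]_xi ((Hk al (tru h1 n) xi - g1 xi) ^+ 2 + (Hk al (tru h2 n) xi - g2 xi) ^+ 2)%:E)%E @ \oo --> 0%E ->
  (EE s h1 h2 <= (2 * s)%:E * \int[mu]_xi (xi ^+ 2 * (g1 xi ^+ 2 + g2 xi ^+ 2))%:E)%E.
Proof.
move=> s0 H1 H2 mg1 mg2 cv.
set nH := (\int[mu]_xi (xi ^+ 2 * (g1 xi ^+ 2 + g2 xi ^+ 2))%:E)%E.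
have nH0 : (0 <= nH)%E by apply: integral_ge0 => xi _; pos.
have [fH|] := boolP (nH < +oo)%E; last first.
  by rewrite -leNgt leye_eq => /eqP ->; rewrite gt0_muley ?leey// lte_fin mulr_gt0.
have nHE : nH = (fine nH)%:E by rewrite fineK// ge0_fin_numE.
have H0 : 0 <= fine nH by exact: fine_ge0.
rewrite nHE -EFinM; apply/lee_addgt0Pr => e e0.
set H := fine nH in nHE H0 *.
(* The Young parameter: [d * s * H] is at most [e / 4], so the excess over [2 * s * H] costs at most
   [e / 2]; the other [e / 2] goes to the error term once [n] is large. *)
pose d := e / (4 * (s * H + 1)).
have sH : 0 < s * H + 1 by rewrite ltr_wpDl// mulr_ge0// ltW.
have d0 : 0 < d by rewrite divr_gt0// mulr_gt0.
have q0 : 0 < 1 + d^-1 by rewrite addr_gt0// invr_gt0.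
have r0 : 0 < e / (4 * (1 + d^-1)) by rewrite divr_gt0// mulr_gt0.
move/fine_cvgP : cv => [[N1 _ f1] /cvgrPdist_le /(_ _ r0)[N2 _ f2]].
have mp := measurable_hp al s.
have mp2 : measurable_fun setT (fun q : R * (R * R) => hp al s q.2.1 q.2.2) := measurableT_comp mp measurable_snd.
apply: (@fatou_le _ _ _ (nu \x hmu2 al)%E (fun n q =>
   ((U1 (tru h1 n) (tru h2 n) (q.1, q.2.1) - U1 (tru h1 n) (tru h2 n) (q.1, q.2.2)) ^+ 2 +
     (U2 (tru h1 n) (tru h2 n) (q.1, q.2.1) - U2 (tru h1 n) (tru h2 n) (q.1, q.2.2)) ^+ 2) * hp al s q.2.1 q.2.2) _ _ (maxn N1 N2)).
- move=> n; have [mV1 mV2] := measurable_V k L1 L2 (measurable_tru n (L2f_meas H1)) (measurable_tru n (L2f_meas H2)).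
  by move: (U1 _ _) (U2 _ _) mV1 mV2 => A B mV1 mV2; meas.
- by move=> n q; pos.
- move=> q; apply: cvgMl.
  have [a1 a2] := V_cvg al_gt k L1 L2 (q.1, q.2.1) H1 H2.
  have [c1 c2] := V_cvg al_gt k L1 L2 (q.1, q.2.2) H1 H2.
  have cB (u v : nat -> R) (l m : R) : u @ \oo --> l -> v @ \oo --> m ->
      (fun n => (u n - v n) ^+ 2) @ \oo --> (l - m) ^+ 2.
    by move=> ul vm; have e1 : (fun n => u n - v n) @ \oo --> l - m by [exact: cvgB]; exact: cvgM.
  by apply: cvgD; exact: cB.
move=> n; rewrite geq_max => /andP[n1 n2].
rewrite -[leLHS]/(EE s (tru h1 n) (tru h2 n)).
apply: le_trans (EE_tru_le n s0 d0 H1 H2 mg1 mg2) _.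
rewrite -/nH nHE.
have := f1 n n1; have := f2 n n2; rewrite /= sub0r normrN => /(le_trans (ler_norm _)) hn fn.
rewrite -(fineK fn) -!EFinM -!EFinD lee_fin.
set D := fine _ in hn *.
have hD : (1 + d^-1) * D <= e / 4.
  apply: (@le_trans _ _ ((1 + d^-1) * (e / (4 * (1 + d^-1))))); first by rewrite ler_wpM2l// ltW.
  rewrite le_eqVlt; apply/orP; left; apply/eqP; field; rewrite ?gt_eqF//.
  by rewrite addr_gt0.
have hd : d * (s * H + 1) = e / 4 by rewrite /d; field; rewrite gt_eqF.
have : d * (s * H) <= d * (s * H + 1) by rewrite ler_wpM2l ?(ltW d0)// lerDl.
by rewrite -mulrA mulrDr; nra.
Qed.

End uncertainty.

(** * The uncertainty inequality *)

Section final_bound.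
Context {R : realType}.
Variable al : R.
Hypothesis al_gt : - 2^-1 < al.
Variables (phi1 phi2 : R -> R) (k : R).
Hypotheses (L1 : L12 al phi1) (L2 : L12 al phi2).
Hypothesis Hc : ((k ^+ 2)%:E * \int[lebR]_a (if (0 < a)%R then (a^-1)%:E * (NH al phi1 phi2 a)%:E else 0) = 1)%E.
Implicit Types x y z s t u xi B c r e a lam eps : R.
Implicit Types F G g h f v : R -> R.

Local Notation mu := (hmu al).
Local Notation nu := (nua al).
Local Notation b := (al + 1).
Local Notation V1 := (V1 al phi1 phi2 k).
Local Notation V2 := (V2 al phi1 phi2 k).
Local Notation TT := (TT al phi1 phi2 k).
Local Notation EE := (EE al phi1 phi2 k).
Local Notation nrm2 := (nrm2 al).
Local Notation L2f := (L2f al).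

Let b0 : 0 < b. Proof. exact: al1_gt0. Qed.

(** The remainder coefficient of [hp_gs_ratio]; being quadratic in [s], it still vanishes after
    division by [s]. *)
Definition gs_const lam s eps : R := (b + b ^+ 2 + 64) * (2 * lam * s) ^+ 2 / eps.

Definition A2 v F G : \bar R := (\int[mu]_x (v x * (F x ^+ 2 + G x ^+ 2))%:E)%E.

Lemma A2D v F G : measurable_fun setT v -> (forall x, 0 <= v x) ->
  measurable_fun setT F -> measurable_fun setT G ->
  A2 v F G = (\int[mu]_x (F x ^+ 2 * v x)%:E + \int[mu]_x (G x ^+ 2 * v x)%:E)%E.
Proof.
move=> mv v0 mF mG; rewrite -ge0_integralD//; last 4 first.
- by move=> x _; rewrite lee_fin mulr_ge0 ?sqr_ge0.
- by meas.
- by move=> x _; rewrite lee_fin mulr_ge0 ?sqr_ge0.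
- by meas.
by apply: eq_integral => x _; rewrite -EFinD -mulrDl mulrC.
Qed.

Lemma ground_state_pair lam s eps F G : 0 < lam -> 0 < s -> 2 * lam * s <= 1 -> 0 < eps ->
  measurable_fun setT F -> measurable_fun setT G ->
  (2%:E * A2 (fun=> 1%R) F G + (4 * lam * b * s)%:E * A2 (gsw lam eps) F G <=
   (En al s F + En al s G) + 2%:E * A2 (fun=> 1%R) F G + (2 * s * lam ^+ 2)%:E * A2 (fun x => x ^+ 2)%R F G
   + (2 * gs_const lam s eps)%:E * A2 (fun=> 1%R) F G)%E.
Proof.
move=> l0 s0 ls1 e0 mF mG.
have gw0 x : 0 <= gsw lam eps x by rewrite divr_ge0 ?addr_ge0 ?(ltW e0) ?(ltW (gs_gt0 _ _)).
have mgw : measurable_fun setT (gsw lam eps) by rewrite /gsw /gs; meas.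
have mc : measurable_fun [set: R] (fun=> 1 : R) by exact: measurable_cst.
have mx : measurable_fun [set: R] (fun x : R => x ^+ 2) by meas.
have x0 (x : R) : 0 <= x ^+ 2 by exact: sqr_ge0.
rewrite (A2D mc (fun=> ler01) mF mG) (A2D mgw gw0 mF mG) (A2D mx x0 mF mG).
have one H : (\int[mu]_x (H x ^+ 2 * 1)%:E = \int[mu]_x (H x ^+ 2)%:E)%E.
  by apply: eq_integral => x _; rewrite mulr1.
have xx H : (\int[mu]_x (H x ^+ 2 * x ^+ 2)%:E = \int[mu]_x (x ^+ 2 * H x ^+ 2)%:E)%E.
  by apply: eq_integral => x _; rewrite mulrC.
rewrite !one !xx.
have g1 := ground_state al_gt l0 s0 ls1 e0 mF; have g2 := ground_state al_gt l0 s0 ls1 e0 mG.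
rewrite -/(gs_const lam s eps) in g1 g2.
have p1 H : (0 <= \int[mu]_x (H x ^+ 2)%:E)%E by apply: integral_ge0 => x _; rewrite lee_fin sqr_ge0.
have p2 H : (0 <= \int[mu]_x (H x ^+ 2 * gsw lam eps x)%:E)%E by apply: integral_ge0 => x _; rewrite lee_fin mulr_ge0 ?sqr_ge0.
have p3 H : (0 <= \int[mu]_x (x ^+ 2 * H x ^+ 2)%:E)%E by apply: integral_ge0 => x _; rewrite lee_fin mulr_ge0 ?sqr_ge0.
move: g1 g2 (p1 F) (p1 G) (p2 F) (p2 G) (p3 F) (p3 G).
move: (\int[mu]_x (F x ^+ 2)%:E)%E (\int[mu]_x (G x ^+ 2)%:E)%E => I1 J1.
move: (\int[mu]_x (F x ^+ 2 * gsw lam eps x)%:E)%E (\int[mu]_x (G x ^+ 2 * gsw lam eps x)%:E)%E => I2 J2.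
move: (\int[mu]_x (x ^+ 2 * F x ^+ 2)%:E)%E (\int[mu]_x (x ^+ 2 * G x ^+ 2)%:E)%E => I3 J3.
move: (En al s F) (En al s G) => I4 J4 g1 g2 i1 j1 i2 j2 i3 j3.
rewrite !ge0_muleDr//.
apply: (@le_trans _ _ ((2%:E * I1 + (4 * lam * b * s)%:E * I2) + (2%:E * J1 + (4 * lam * b * s)%:E * J2))%E).
  by rewrite addeACA.
by apply: le_trans (leeD g1 g2) _; rewrite addeACA leeD2r// addeACA leeD2r// addeACA.
Qed.

Definition Tg v h1 h2 a : \bar R := A2 v (fun x => V1 h1 h2 (a, x)) (fun x => V2 h1 h2 (a, x)).

Lemma measurable_Va h1 h2 a : L2f h1 -> L2f h2 ->
  measurable_fun setT (fun x => V1 h1 h2 (a, x)) /\ measurable_fun setT (fun x => V2 h1 h2 (a, x)).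
Proof.
move=> H1 H2; have [mV1 mV2] := measurable_V k L1 L2 (L2f_meas H1) (L2f_meas H2).
split; [exact: (measurableT_comp mV1 (measurable_pair1 a))|exact: (measurableT_comp mV2 (measurable_pair1 a))].
Qed.

Lemma measurable_Tg v h1 h2 : measurable_fun setT v -> (forall x, 0 <= v x) ->
  L2f h1 -> L2f h2 -> measurable_fun setT (Tg v h1 h2).
Proof.
move=> mv v0 H1 H2.
apply: (@measurable_integral_nua _ al (fun p => (v p.2 * (V1 h1 h2 p ^+ 2 + V2 h1 h2 p ^+ 2))%:E)).
  by apply/measurable_EFinP; exact: measurable_TT.
by move=> p; rewrite lee_fin mulr_ge0// addr_ge0 ?sqr_ge0.
Qed.

Lemma Tg_ge0 v h1 h2 a : (forall x, 0 <= v x) -> (0 <= Tg v h1 h2 a)%E.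
Proof. by move=> v0; apply: integral_ge0 => x _; rewrite lee_fin mulr_ge0// addr_ge0 ?sqr_ge0. Qed.

Lemma TT_Tg v h1 h2 : measurable_fun setT v -> (forall x, 0 <= v x) ->
  L2f h1 -> L2f h2 -> TT v h1 h2 = (\int[nu]_a Tg v h1 h2 a)%E.
Proof.
move=> mv v0 H1 H2.
by rewrite (TT_fubini k L1 L2 (L2f_meas H1) (L2f_meas H2) mv v0).
Qed.

Lemma ground_state_TT lam s eps h1 h2 : 0 < lam -> 0 < s -> 2 * lam * s <= 1 -> 0 < eps ->
  L2f h1 -> L2f h2 ->
  (2%:E * TT (fun=> 1%R) h1 h2 + (4 * lam * b * s)%:E * TT (gsw lam eps) h1 h2 <=
   EE s h1 h2 + 2%:E * TT (fun=> 1%R) h1 h2 + (2 * s * lam ^+ 2)%:E * TT (fun x => x ^+ 2)%R h1 h2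
   + (2 * gs_const lam s eps)%:E * TT (fun=> 1%R) h1 h2)%E.
Proof.
move=> l0 s0 ls1 e0 H1 H2.
have gw0 x : 0 <= gsw lam eps x by rewrite divr_ge0 ?addr_ge0 ?(ltW e0) ?(ltW (gs_gt0 _ _)).
have mgw : measurable_fun setT (gsw lam eps) by rewrite /gsw /gs; meas.
have mc : measurable_fun [set: R] (fun=> 1 : R) by exact: measurable_cst.
have mx : measurable_fun [set: R] (fun x : R => x ^+ 2) by meas.
have x0 (x : R) : 0 <= x ^+ 2 by exact: sqr_ge0.
rewrite (TT_Tg mc (fun=> ler01) H1 H2) (TT_Tg mgw gw0 H1 H2) (TT_Tg mx x0 H1 H2).
rewrite (EE_fubini k L1 L2 s (L2f_meas H1) (L2f_meas H2)).
have t1 := Tg_ge0 h1 h2 ^~ (fun=> ler01); have m1 := measurable_Tg mc (fun=> ler01) H1 H2.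
have t2 a := Tg_ge0 h1 h2 a gw0; have m2 := measurable_Tg mgw gw0 H1 H2.
have t3 a := Tg_ge0 h1 h2 a x0; have m3 := measurable_Tg mx x0 H1 H2.
have c1 : 0 <= 4 * lam * b * s by have := b0 => b0'; pos.
have c2 : 0 <= 2 * s * lam ^+ 2 by pos.
have c3 : 0 <= 2 * gs_const lam s eps by have := b0 => b0'; rewrite /gs_const; pos.
pose E a : \bar R := (En al s (fun x => V1 h1 h2 (a, x)) + En al s (fun x => V2 h1 h2 (a, x)))%E.
have E0 a : (0 <= E a)%E.
  by apply: adde_ge0; apply: integral_ge0 => p _; rewrite lee_fin mulr_ge0 ?sqr_ge0 ?hp_ge0.
have mE : measurable_fun setT E.
  have [mV1 mV2] := measurable_V k L1 L2 (L2f_meas H1) (L2f_meas H2).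
  have mp := measurable_hp al s.
  have mp2 : measurable_fun setT (fun q : R * (R * R) => hp al s q.2.1 q.2.2) := measurableT_comp mp measurable_snd.
  have mEn (V : R * R -> R) : measurable_fun setT V -> measurable_fun setT (fun a => En al s (fun x => V (a, x))).
    move=> mV; apply: (measurable_tonelli (hmu2 al) (f := fun a (p : R * R) => ((V (a, p.1) - V (a, p.2)) ^+ 2 * hp al s p.1 p.2)%:E)).
      by meas.
    by move=> a p; rewrite lee_fin mulr_ge0 ?sqr_ge0 ?hp_ge0.
  by apply: emeasurable_funD; exact: mEn.
have q1 a : (0 <= 2%:E * Tg (fun=> 1%R) h1 h2 a)%E by rewrite mule_ge0// t1.
have q2 a : (0 <= (4 * lam * b * s)%:E * Tg (gsw lam eps) h1 h2 a)%E by rewrite mule_ge0.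
have q3 a : (0 <= (2 * s * lam ^+ 2)%:E * Tg (fun x => x ^+ 2)%R h1 h2 a)%E by rewrite mule_ge0.
have q4 a : (0 <= (2 * gs_const lam s eps)%:E * Tg (fun=> 1%R) h1 h2 a)%E by rewrite mule_ge0// t1.
have n1 : measurable_fun setT (fun a => 2%:E * Tg (fun=> 1%R) h1 h2 a)%E by apply: emeasurable_funM => //; exact: measurable_cst.
have n2 : measurable_fun setT (fun a => (4 * lam * b * s)%:E * Tg (gsw lam eps) h1 h2 a)%E by apply: emeasurable_funM => //; exact: measurable_cst.
have n3 : measurable_fun setT (fun a => (2 * s * lam ^+ 2)%:E * Tg (fun x => x ^+ 2)%R h1 h2 a)%E by apply: emeasurable_funM => //; exact: measurable_cst.
have n4 : measurable_fun setT (fun a => (2 * gs_const lam s eps)%:E * Tg (fun=> 1%R) h1 h2 a)%E by apply: emeasurable_funM => //; exact: measurable_cst.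
have n01 := emeasurable_funD mE n1; have n013 := emeasurable_funD n01 n3.
have q01 a := adde_ge0 (E0 a) (q1 a); have q013 a := adde_ge0 (q01 a) (q3 a).
have H (c : R) (f : R -> \bar R) : 0 <= c -> measurable_fun setT f -> (forall a, 0 <= f a)%E ->
    (c%:E * \int[nu]_a f a = \int[nu]_a (c%:E * f a))%E.
  by move=> c0 mf f0; rewrite ge0_integralZl_EFin.
rewrite (H 2 _ (ler0n _ _) m1 t1) (H _ _ c1 m2 t2) (H _ _ c2 m3 t3) (H _ _ c3 m1 t1).
rewrite -(ge0_integralD nu measurableT (fun p _ => q1 p) n1 (fun p _ => q2 p) n2).
rewrite -(ge0_integralD nu measurableT (fun p _ => E0 p) mE (fun p _ => q1 p) n1).
rewrite -(ge0_integralD nu measurableT (fun p _ => q01 p) n01 (fun p _ => q3 p) n3).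
rewrite -(ge0_integralD nu measurableT (fun p _ => q013 p) n013 (fun p _ => q4 p) n4).
apply: ge0_le_integral => //.
- by move=> a _; exact: adde_ge0.
- exact: emeasurable_funD.
- exact: emeasurable_funD.
move=> a _; have [ma1 ma2] := measurable_Va a H1 H2.
exact: (ground_state_pair l0 s0 ls1 e0 ma1 ma2).
Qed.

(** The norm being finite, it cancels from both sides of the integrated inequality; division by
    [2 * s] and [s -> 0] at fixed [eps] remove the remainder. *)
Lemma weighted_bound lam eps h1 h2 (N H W t : R) : 0 < lam -> 0 < eps ->
  L2f h1 -> L2f h2 -> TT (fun=> 1%R) h1 h2 = N%:E -> TT (fun x => x ^+ 2)%R h1 h2 = W%:E ->
  TT (gsw lam eps) h1 h2 = t%:E ->
  (forall s, 0 < s -> (EE s h1 h2 <= (2 * s * H)%:E)%E) ->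
  2 * lam * b * t <= H + lam ^+ 2 * W.
Proof.
move=> l0 e0 H1 H2 EN EW Et EH; apply/ler_addgt0Pr => e e_gt0.
have N0 : 0 <= N by rewrite -lee_fin -EN; apply: TT_sqr_ge0 => x; exact: ler01.
pose C := (b + b ^+ 2 + 64) * (4 * lam ^+ 2) / eps * N.
have C0 : 0 <= C by have := b0 => b0'; rewrite /C; pos.
(* The first bound is the smallness that the ground state inequality requires; the second gives
   [C * s <= e], where [2 * s * (C * s)] is the remainder. The denominator [C + 1] covers
   [C = 0]. *)
pose s := Num.min (2 * lam)^-1 (e / (C + 1)).
have C1 : 0 < C + 1 by rewrite ltr_wpDl.
have s0 : 0 < s by rewrite lt_min !divr_gt0 ?invr_gt0 ?mulr_gt0.
have s1 : 2 * lam * s <= 1.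
  have : s <= (2 * lam)^-1 by rewrite ge_min lexx.
  by rewrite -ler_pdivlMl ?mulr_gt0// mulr1.
have s2 : C * s <= e.
  have : s <= e / (C + 1) by rewrite ge_min lexx orbT.
  rewrite ler_pdivlMr// => h; apply: le_trans h.
  by rewrite mulrC ler_wpM2l ?(ltW s0)// lerDl.
have G := ground_state_TT l0 s0 s1 e0 H1 H2.
rewrite EN EW Et in G.
have {}G := le_trans G (leeD2r _ (leeD2r _ (leeD2r _ (EH s s0)))).
rewrite -!EFinM -!EFinD lee_fin in G.
have E1 : 2 * gs_const lam s eps * N = 2 * s * (C * s) by rewrite /gs_const /C; field; rewrite gt_eqF.
rewrite E1 in G.
have : 2 * s * (2 * lam * b * t) <= 2 * s * (H + lam ^+ 2 * W + C * s) by lra.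
rewrite ler_pM2l ?mulr_gt0// => h; apply: le_trans h _; lra.
Qed.

(** If either moment is infinite the right side is infinite. Otherwise [weighted_bound] holds for
    every [eps], and Fatou along [eps = 1/(n + 1)] restores the full norm on the left. *)
Lemma uncertainty lam h1 h2 g1 g2 : 0 < lam -> L2f h1 -> L2f h2 ->
  measurable_fun setT g1 -> measurable_fun setT g2 ->
  (fun n => \int[mu]_xi ((Hk al (tru h1 n) xi - g1 xi) ^+ 2 + (Hk al (tru h2 n) xi - g2 xi) ^+ 2)%:E)%E @ \oo --> 0%E ->
  ((2 * lam * b)%:E * nrm2 h1 h2 <=
   (\int[mu]_xi (xi ^+ 2 * (g1 xi ^+ 2 + g2 xi ^+ 2))%:E) + (lam ^+ 2)%:E * TT (fun x => x ^+ 2)%R h1 h2)%E.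
Proof.
move=> l0 H1 H2 mg1 mg2 cv.
set nH := (\int[mu]_xi (xi ^+ 2 * (g1 xi ^+ 2 + g2 xi ^+ 2))%:E)%E.
set nW := TT _ h1 h2.
have nH0 : (0 <= nH)%E by apply: integral_ge0 => xi _; pos.
have nW0 : (0 <= nW)%E by apply: TT_sqr_ge0 => x; exact: sqr_ge0.
have [fH|] := boolP (nH < +oo)%E; last first.
  by rewrite -leNgt leye_eq => /eqP ->; rewrite addye ?leey// gt_eqF// (@lt_le_trans _ _ 0%E)// mule_ge0// lee_fin sqr_ge0.
have [fW|] := boolP (nW < +oo)%E; last first.
  by rewrite -leNgt leye_eq => /eqP ->; rewrite gt0_muley ?lte_fin ?exprn_gt0// addey ?leey// gt_eqF// (@lt_le_trans _ _ 0%E).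
have HE : nH = (fine nH)%:E by rewrite fineK// ge0_fin_numE.
have WE : nW = (fine nW)%:E by rewrite fineK// ge0_fin_numE.
have NE : nrm2 h1 h2 = (\int[mu]_x (h1 x ^+ 2 + h2 x ^+ 2))%:E by exact: (integral_EFin (nrm2_fin H1 H2)).
have TE := TT_eq al_gt L1 L2 Hc H1 H2.
have EH s : 0 < s -> (EE s h1 h2 <= (2 * s * fine nH)%:E)%E.
  by move=> s0; rewrite EFinM -HE; exact: EE_le.
rewrite -TE HE WE -EFinM -EFinD.
have l2b : 0 < 2 * lam * b by have := b0 => b0'; rewrite !mulr_gt0.
(* Dividing by [2 * lam * b] isolates an integral of the transform bounded by a constant, the shape
   in which Fatou applies. *)
suff : (TT (fun=> 1%R) h1 h2 <= ((fine nH + lam ^+ 2 * fine nW) / (2 * lam * b))%:E)%E.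
  rewrite TE NE -EFinM !lee_fin => h.
  by rewrite mulrC -ler_pdivlMr.
have mc : measurable_fun [set: R] (fun=> 1 : R) by exact: measurable_cst.
have gw0 eps x : 0 < eps -> 0 <= gsw lam eps x.
  by move=> e0; rewrite divr_ge0 ?addr_ge0 ?(ltW e0) ?(ltW (gs_gt0 _ _)).
have gw1 eps x : 0 < eps -> gsw lam eps x <= 1.
  move=> e0; have g0 := gs_gt0 lam x.
  by rewrite ler_pdivrMr ?addr_gt0// mul1r lerDl ltW.
have mgw eps : measurable_fun setT (gsw lam eps) by rewrite /gsw /gs; meas.
apply: (@fatou_le _ _ _ (nu \x mu)%E (fun n p => gsw lam (harmonic n) p.2 * (V1 h1 h2 p ^+ 2 + V2 h1 h2 p ^+ 2)) _ _ 0%N).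
- by move=> n; exact: measurable_TT.
- by move=> n p; rewrite mulr_ge0 ?addr_ge0 ?sqr_ge0// gw0// harmonic_gt0.
- move=> p; apply: cvgMl.
  have g0 := gs_gt0 lam p.2.
  rewrite -[X in _ --> X](@divff _ (gs lam p.2)) ?gt_eqF//.
  apply: cvgMr; rewrite -[X in X^-1]addr0.
  apply: cvgV; first by rewrite addr0 gt_eqF.
  by apply: cvgD; [exact: cvg_cst|exact: cvg_harmonic].
move=> n _; have hn := @harmonic_gt0 R n.
rewrite -[leLHS]/(TT (gsw lam (harmonic n)) h1 h2).
have T0 : (0 <= TT (gsw lam (harmonic n)) h1 h2)%E by apply: TT_sqr_ge0 => x; exact: gw0.
have T1 : (TT (gsw lam (harmonic n)) h1 h2 <= TT (fun=> 1%R) h1 h2)%E.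
  apply: ge0_le_integral => //.
  - by move=> p _; rewrite lee_fin mulr_ge0 ?addr_ge0 ?sqr_ge0// gw0.
  - by apply/measurable_EFinP; exact: measurable_TT.
  - by apply/measurable_EFinP; exact: (measurable_TT k L1 L2 mc H1 H2).
  - by move=> p _; rewrite lee_fin ler_wpM2r ?addr_ge0 ?sqr_ge0// gw1.
have Tf : (TT (gsw lam (harmonic n)) h1 h2 < +oo)%E by apply: le_lt_trans T1 _; rewrite TE NE ltry.
have TgE : TT (gsw lam (harmonic n)) h1 h2 = (fine (TT (gsw lam (harmonic n)) h1 h2))%:E by rewrite fineK// ge0_fin_numE.
have := weighted_bound l0 hn H1 H2 (etrans TE NE) WE TgE EH.
by rewrite TgE lee_fin ler_pdivlMr// mulrC.
Qed.

End final_bound.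

(** * From the family of sums to the product inequality *)

Section product_bound.
Context {R : realType}.
Variable al : R.
Hypothesis al_gt : - 2^-1 < al.
Variables (phi1 phi2 : R -> R) (k : R).
Hypotheses (L1 : L12 al phi1) (L2 : L12 al phi2).
Hypothesis Hc : ((k ^+ 2)%:E * \int[lebR]_a (if (0 < a)%R then (a^-1)%:E * (NH al phi1 phi2 a)%:E else 0) = 1)%E.
Implicit Types x y z s t u xi B c r e a lam eps : R.
Implicit Types F G g h f v : R -> R.

Local Notation mu := (hmu al).
Local Notation nu := (nua al).
Local Notation b := (al + 1).
Local Notation TT := (TT al phi1 phi2 k).
Local Notation nrm2 := (nrm2 al).
Local Notation L2f := (L2f al).
Local Notation A2 := (A2 al).

Lemma A2_sqr_eq0 F G : measurable_fun setT F -> measurable_fun setT G ->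
  A2 (fun x => x ^+ 2) F G = 0%E -> A2 (fun=> 1%R) F G = 0%E.
Proof.
move=> mF mG A0.
have m1 : measurable_fun setT (fun x => (x ^+ 2 * (F x ^+ 2 + G x ^+ 2))%:E) by meas.
have m2 : measurable_fun setT (fun x => (1 * (F x ^+ 2 + G x ^+ 2))%:E) by meas.
have /(ae_eq_integral_abs mu measurableT m1) H : (\int[mu]_x `|(x ^+ 2 * (F x ^+ 2 + G x ^+ 2))%:E| = 0)%E.
  rewrite -[RHS]A0; apply: eq_integral => x _.
  by rewrite gee0_abs// lee_fin mulr_ge0 ?addr_ge0 ?sqr_ge0.
rewrite /A2 (@ae_eq_integral _ _ _ mu _ (cst 0%E) _ measurableT m2 (measurable_cst _)).
  by rewrite integral0.
have := hmu_ae_pos al; apply: filterS2 H => x /(_ I) /= [] /eqP + x0 _.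
by rewrite mulf_eq0 sqrf_eq0 gt_eqF//= mul1r => /eqP ->.
Qed.

(** A zero moment makes the right side of the product inequality 0, even when the other factor is
    infinite; the norm must then be 0. The transform vanishes almost everywhere on almost every
    scale, and the isometry concludes. *)
Lemma TT_sqr_eq0 h1 h2 : L2f h1 -> L2f h2 ->
  TT (fun x => x ^+ 2)%R h1 h2 = 0%E -> nrm2 h1 h2 = 0%E.
Proof.
move=> H1 H2.
have mc : measurable_fun [set: R] (fun=> 1 : R) by exact: measurable_cst.
have mx : measurable_fun [set: R] (fun x : R => x ^+ 2) by meas.
have x0 (x : R) : 0 <= x ^+ 2 by exact: sqr_ge0.
rewrite -(TT_eq al_gt L1 L2 Hc H1 H2) (TT_Tg k L1 L2 mx x0 H1 H2) (TT_Tg k L1 L2 mc (fun=> ler01) H1 H2).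
have m1 := measurable_Tg k L1 L2 mx x0 H1 H2; have m2 := measurable_Tg k L1 L2 mc (fun=> ler01) H1 H2.
have Ta a : Tg al phi1 phi2 k (fun x => x ^+ 2)%R h1 h2 a = 0%E -> Tg al phi1 phi2 k (fun=> 1%R) h1 h2 a = 0%E.
  by have [ma mb] := measurable_Va k L1 L2 a H1 H2; exact: A2_sqr_eq0.
have T0 a : (0 <= Tg al phi1 phi2 k (fun x => x ^+ 2)%R h1 h2 a)%E by exact: Tg_ge0.
move: (Tg _ _ _ _ _ _ _) (Tg _ _ _ _ _ _ _) m1 m2 Ta T0 => B A mA mB AB A0 EA.
have /(ae_eq_integral_abs nu measurableT mA) H : (\int[nu]_a `|A a| = 0)%E.
  by rewrite -[RHS]EA; apply: eq_integral => a _; rewrite gee0_abs.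
rewrite (@ae_eq_integral _ _ _ nu _ (cst 0%E) _ measurableT mB (measurable_cst _)).
  by rewrite integral0.
by apply: filterS H => a /(_ I) /= Aa _; exact: AB.
Qed.

(** The counterpart in frequency: [g] vanishes almost everywhere, so the transforms of the
    truncations tend to 0 in L2, hence so do the truncations by Plancherel's theorem, and Fatou
    passes to the limit. *)
Lemma transform_sqr_eq0 h1 h2 g1 g2 : L2f h1 -> L2f h2 ->
  measurable_fun setT g1 -> measurable_fun setT g2 ->
  (fun n => \int[mu]_xi ((Hk al (tru h1 n) xi - g1 xi) ^+ 2 + (Hk al (tru h2 n) xi - g2 xi) ^+ 2)%:E)%E @ \oo --> 0%E ->
  A2 (fun x => x ^+ 2)%R g1 g2 = 0%E -> nrm2 h1 h2 = 0%E.
Proof.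
move=> H1 H2 mg1 mg2 cv /(A2_sqr_eq0 mg1 mg2) g0.
have n0 : (0 <= nrm2 h1 h2)%E by apply: integral_ge0 => x _; rewrite lee_fin addr_ge0 ?sqr_ge0.
apply/eqP; rewrite eq_le n0 andbT; apply/lee_addgt0Pr => e e0; rewrite add0e.
have e20 : 0 < e / 2 by rewrite divr_gt0.
move/fine_cvgP : cv => [[N1 _ f1] /cvgrPdist_le /(_ _ e20)[N2 _ f2]].
apply: (@fatou_le _ _ _ mu (fun n x => tru h1 n x ^+ 2 + tru h2 n x ^+ 2) _ _ (maxn N1 N2)).
- move=> n; have := measurable_tru n (L2f_meas H1); have := measurable_tru n (L2f_meas H2).
  by move: (tru h1 n) (tru h2 n) => A B mA mB; meas.
- by move=> n x; rewrite addr_ge0 ?sqr_ge0.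
- move=> x; apply: cvg_near_cst; exists (Num.truncn `|x|).+1 => // n /= xn.
  rewrite /tru; have -> : x <= n%:R; last by [].
  apply: le_trans (ler_norm _) (ltW (lt_le_trans (truncnS_gt _) _)).
  by rewrite ler_nat.
move=> n; rewrite geq_max => /andP[n1 n2].
have [i1 j1] := L12_tru al_gt n H1; have [i2 j2] := L12_tru al_gt n H2.
have mK1 := measurable_Hk al_gt (measurable_tru n (L2f_meas H1)).
have mK2 := measurable_Hk al_gt (measurable_tru n (L2f_meas H2)).
have := f1 n n1; have := f2 n n2; rewrite /= sub0r normrN => /(le_trans (ler_norm _)) hn fn.
have E : (\int[mu]_x (tru h1 n x ^+ 2 + tru h2 n x ^+ 2)%:E =
   \int[mu]_x (Hk al (tru h1 n) x ^+ 2 + Hk al (tru h2 n) x ^+ 2)%:E)%E.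
  have D f g : measurable_fun setT f -> measurable_fun setT g ->
      (\int[mu]_x (f x ^+ 2 + g x ^+ 2)%:E = \int[mu]_x (f x ^+ 2)%:E + \int[mu]_x (g x ^+ 2)%:E)%E.
    by move=> mf mg; rewrite -ge0_integralD//; try by [meas|move=> x _; rewrite lee_fin sqr_ge0].
  rewrite (D _ _ (measurable_tru n (L2f_meas H1)) (measurable_tru n (L2f_meas H2))) (D _ _ mK1 mK2).
  by rewrite -(plancherel al_gt i1 j1) -(plancherel al_gt i2 j2).
rewrite E.
set D := fun xi => ((Hk al (tru h1 n) xi - g1 xi) ^+ 2 + (Hk al (tru h2 n) xi - g2 xi) ^+ 2).
move: (Hk _ _) (Hk _ _) mK1 mK2 @D hn fn => K2 K1 mK1 mK2 D hn fn.
have mD : measurable_fun setT (fun x => (2 * D x)%:E) by rewrite /D; meas.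
have mG : measurable_fun setT (fun x => (2 * (1 * (g1 x ^+ 2 + g2 x ^+ 2)))%:E) by meas.
apply: (@le_trans _ _ (\int[mu]_x ((2 * D x)%:E + (2 * (1 * (g1 x ^+ 2 + g2 x ^+ 2)))%:E))%E).
  apply: ge0_le_integral => //.
  - by move=> x _; rewrite lee_fin addr_ge0 ?sqr_ge0.
  - by meas.
  - exact: emeasurable_funD.
  move=> x _; rewrite -EFinD lee_fin /D.
  (* [2 * (K - g)^2 + 2 * g^2 - K^2] is the square of [K - 2 * g]. *)
  by have := sqr_ge0 (K1 x - 2 * g1 x); have := sqr_ge0 (K2 x - 2 * g2 x); nra.
rewrite ge0_integralD//; first last.
- by move=> x _; rewrite lee_fin !mulr_ge0 ?addr_ge0 ?sqr_ge0.
- by move=> x _; rewrite lee_fin mulr_ge0 ?addr_ge0 ?sqr_ge0.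
have Z (f : R -> R) : measurable_fun setT f -> (forall x, 0 <= f x) ->
    (\int[mu]_x (2 * f x)%:E = 2%:E * \int[mu]_x (f x)%:E)%E.
  move=> mf f0; under eq_integral do rewrite EFinM.
  by rewrite ge0_integralZl_EFin//; [move=> x _; rewrite lee_fin|apply/measurable_EFinP].
rewrite (Z D); last 2 first.
- by rewrite /D; meas.
- by move=> x; rewrite addr_ge0 ?sqr_ge0.
rewrite (Z (fun x => 1 * (g1 x ^+ 2 + g2 x ^+ 2))); last 2 first.
- by meas.
- by move=> x; rewrite mulr_ge0 ?addr_ge0 ?sqr_ge0.
rewrite -/(A2 (fun=> 1%R) g1 g2) g0 mule0 adde0.
by rewrite -(fineK fn) -EFinM lee_fin; lra.
Qed.

(** The zero cases come first, then the infinite ones: an infinite factor gives an infinite product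
    only because the other is positive. What remains is the minimisation over [lam] for real [A] and
    [B]. *)
Lemma product_of_sums (N A B : \bar R) (c : R) : 0 < c -> N \is a fin_num -> (0 <= N)%E -> (0 <= A)%E -> (0 <= B)%E ->
  (A = 0 -> N = 0)%E -> (B = 0 -> N = 0)%E ->
  (forall lam, 0 < lam -> ((2 * lam * c)%:E * N <= B + (lam ^+ 2)%:E * A)%E) ->
  (c%:E * N <= sqrte A * sqrte B)%E.
Proof.
move=> c0 Nf N0 A0 B0 AN BN H.
have [/eqP A1|A1] := boolP (A == 0%E); first by rewrite (AN A1) mule0 mule_ge0 ?sqrte_ge0.
have [/eqP B1|B1] := boolP (B == 0%E); first by rewrite (BN B1) mule0 mule_ge0 ?sqrte_ge0.
have {}A1 : (0 < A)%E by rewrite lt0e A1.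
have {}B1 : (0 < B)%E by rewrite lt0e B1.
have sq X : (0 < X -> 0 < sqrte X)%E.
  by case: X => [r| |]//=; rewrite !lte_fin sqrtr_gt0.
case: A A0 A1 AN H => [A| |]// A0 A1 AN H; last by rewrite /= gt0_mulye ?leey ?sq.
case: B B0 B1 BN H => [B| |]// B0 B1 BN H; last by rewrite /= gt0_muley ?leey// lte_fin sqrtr_gt0.
case: N Nf N0 AN BN H => [N| |]// _ N0 _ _ H.
rewrite !lte_fin in A1 B1; rewrite /= -!EFinM lee_fin.
have a0 : 0 < Num.sqrt A by rewrite sqrtr_gt0.
have b0 : 0 < Num.sqrt B by rewrite sqrtr_gt0.
(* The minimising [lam], at which the two summands on the right are equal. *)
have := H (Num.sqrt B / Num.sqrt A) (divr_gt0 b0 a0).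
rewrite -!EFinM -!EFinD lee_fin; move: (sqr_sqrtr (ltW A1)) (sqr_sqrtr (ltW B1)).
move: (Num.sqrt A) (Num.sqrt B) a0 b0 => p q p0 q0 <- <-.
have -> : q ^+ 2 + (q / p) ^+ 2 * p ^+ 2 = 2 * (q / p) * (p * q) by field; rewrite gt_eqF.
by rewrite -(mulrA (2 * (q / p)) c N) ler_pM2l// mulr_gt0// divr_gt0.
Qed.

Lemma uncertainty_pair h1 h2 g1 g2 : L2f h1 -> L2f h2 ->
  measurable_fun setT g1 -> measurable_fun setT g2 ->
  (fun n => \int[mu]_xi ((Hk al (tru h1 n) xi - g1 xi) ^+ 2 + (Hk al (tru h2 n) xi - g2 xi) ^+ 2)%:E)%E @ \oo --> 0%E ->
  let nW := TT (fun x => x ^+ 2)%R h1 h2 in let nH := A2 (fun x => x ^+ 2)%R g1 g2 in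
  ((2 * al + 2)%:E * nrm2 h1 h2 <= nW + nH)%E /\
  ((al + 1)%:E * nrm2 h1 h2 <= sqrte nW * sqrte nH)%E.
Proof.
move=> H1 H2 mg1 mg2 cv nW nH.
have U lam (l0 : 0 < lam) := uncertainty al_gt L1 L2 Hc l0 H1 H2 mg1 mg2 cv.
split.
  have := U 1 ltr01; rewrite expr1n mul1e addeC.
  by have -> : 2 * 1 * (al + 1) = 2 * al + 2 by ring.
apply: product_of_sums.
- exact: al1_gt0.
- by apply: integrable_fin_num => //; exact: (nrm2_fin H1 H2).
- by apply: integral_ge0 => x _; rewrite lee_fin addr_ge0 ?sqr_ge0.
- by apply: TT_sqr_ge0 => x; exact: sqr_ge0.
- by apply: integral_ge0 => x _; rewrite lee_fin mulr_ge0 ?addr_ge0 ?sqr_ge0.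
- exact: TT_sqr_eq0.
- exact: transform_sqr_eq0 cv.
exact: U.
Qed.

End product_bound.

(** * Complex functions on the half line as pairs of real functions *)

Section half_line.
Context {R : realType}.
Variable al : R.
Hypothesis al_gt : - 2^-1 < al.
Implicit Types x y z s t u xi a : R.
Implicit Types F G g h f v : R -> R.
Implicit Types psi : R -> cplx R.

Local Notation mu := (hmu al).
Local Notation leb := (@lebesgue_measure R).

(** A representative that is measurable on the whole line and that agrees with [f] wherever [hmu]
    has mass; what [f] does at negative points is arbitrary. *)
Definition pos_part f x : R := if 0 < x then f x else 0.

Lemma measurable_pos_part f : measurable_fun (@Rp R) f -> measurable_fun setT (pos_part f).
Proof.
move=> mf.
have mP : measurable (@Rpos R) by exact: measurable_itv.
have -> : pos_part f = f \_ (@Rpos R).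
  by apply/funext => x; rewrite patchE /pos_part mem_setE in_itv/= andbT.
apply/(measurable_restrictT f mP); apply: measurable_funS mf => //.
- exact: measurable_itv.
- by move=> x; rewrite /Rp /Rpos /= !in_itv/= !andbT => /ltW.
Qed.

Lemma wmu0 : wmu al 0 = 0.
Proof. have p0 : 0 < 2 * al + 1 by move: al_gt; lra.
by rewrite /wmu powR0 ?mul0r// gt_eqF. Qed.

(** The endpoint 0 of [Rp], where [F] and [G] may differ, contributes nothing: [2 * al + 1 > 0]
    makes the density vanish there. *)
Lemma intmuE (F G : R -> \bar R) : measurable_fun setT G ->
  (forall x, 0 < x -> F x = G x) -> intmu al F = (\int[mu]_x G x)%E.
Proof.
move=> mG FG; rewrite (integral_hmu al_gt mG) integral_lebR; last first.
  by apply: emeasurable_funM => //; apply/measurable_EFinP; exact: measurable_dmu.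
rewrite /intmu /intmuD integral_mkcond; apply: eq_integral => x _.
rewrite patchE /Rp mem_setE in_itv/= andbT /dmu.
have [x0|x0|<-] := ltgtP 0 x; first by rewrite FG.
- by rewrite mul0e.
- by rewrite wmu0 !mul0e.
Qed.

Lemma RintmuE g h : measurable_fun setT h ->
  (forall x, 0 < x -> g x = h x) -> Rintmu al g = \int[mu]_x h x.
Proof.
move=> mh gh.
have mE : measurable_fun setT (EFin \o h) by apply/measurable_EFinP.
rewrite /Rintegral /Rintmu /Rintegral; congr fine.
rewrite -(intmuE mE (F := EFin \o g)); last by move=> x x0 /=; rewrite gh.
by apply: eq_integral => x _; rewrite EFinM.
Qed.

Lemma L2f_pos_part (f : R -> R) (F : R -> R) : measurable_fun (@Rp R) f -> measurable_fun (@Rp R) F ->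
  (forall x, f x ^+ 2 <= F x) -> (intmu al (fun x => (F x)%:E) < +oo)%E -> L2f al (pos_part f).
Proof.
move=> mf mF fF iF; split.
- exact: measurable_pos_part.
- by move=> x x0; rewrite /pos_part ltNge x0.
have mp := measurable_pos_part mf; have mP := measurable_pos_part mF.
apply/integrableP; split; first by apply/measurable_EFinP; meas.
apply: le_lt_trans iF.
rewrite (intmuE (G := EFin \o pos_part F)); last 2 first.
- exact/measurable_EFinP.
- by move=> x x0; rewrite /= /pos_part x0.
apply: ge0_le_integral => //.
- by apply/measurable_EFinP; apply: measurableT_comp => //; meas.
- exact/measurable_EFinP.
move=> x _; rewrite /= lee_fin ger0_norm ?sqr_ge0// /pos_part.
by case: ifP => // _; rewrite expr0n.
Qed.

Lemma measurable_csq (psi : R -> cplx R) (D : set R) : measurable D -> cmeasurable D psi ->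
  measurable_fun D (fun x => csq (psi x)).
Proof.
by move=> mD [m1 m2]; apply: measurable_funD; exact: measurable_funX.
Qed.

Lemma measurable_cabs (psi : R -> cplx R) (D : set R) : measurable D -> cmeasurable D psi ->
  measurable_fun D (fun x => cabs (psi x)).
Proof.
move=> mD cm; have m := measurable_csq mD cm.
by apply: measurableT_comp m; exact: (@measurable_sqrt R).
Qed.

Lemma L2a_pos_part psi : L2a al psi ->
  L2f al (pos_part (fun x => (psi x).1)) /\ L2f al (pos_part (fun x => (psi x).2)).
Proof.
move=> [cm i]; have [m1 m2] := cm.
have mq := measurable_csq (measurable_itv _) cm.
by split; apply: (L2f_pos_part _ mq) => // x; rewrite /csq ?lerDl ?lerDr ?sqr_ge0.
Qed.

(** Square integrability comes from interpolation: almost everywhere the square of [|psi|] is at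
    most [|M|] times [|psi|]. *)
Lemma L12_pos_part psi (f : R -> R) : L1a al psi -> Linfa al psi ->
  measurable_fun (@Rp R) f -> (forall x, f x ^+ 2 <= csq (psi x)) -> L12 al (pos_part f).
Proof.
move=> [cm i1] [_ [M iM]] mf fp.
have mRp : measurable (@Rp R) by exact: measurable_itv.
have ma := measurable_cabs mRp cm.
have mp := measurable_pos_part mf; have mA := measurable_pos_part ma.
have A0 x : 0 <= pos_part (fun x => cabs (psi x)) x by rewrite /pos_part; case: ifP => // _; exact: sqrtr_ge0.
have fA x : `|pos_part f x| <= pos_part (fun x => cabs (psi x)) x.
  rewrite /pos_part; case: ifP; rewrite ?normr0// => _.
  by rewrite -sqrtr_sqr ler_sqrt ?fp// (le_trans (sqr_ge0 _) (fp x)).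
set A := pos_part (fun x => cabs (psi x)) in mA A0 fA *.
have iA : (\int[mu]_x (A x)%:E < +oo)%E.
  apply: le_lt_trans i1; rewrite (intmuE (G := EFin \o A)) //; first exact/measurable_EFinP.
  by move=> x x0; rewrite /= /A /pos_part x0.
split.
  apply/integrableP; split; first exact/measurable_EFinP.
  apply: le_lt_trans iA; apply: ge0_le_integral => //.
  - by apply/measurable_EFinP; exact: measurableT_comp.
  - exact/measurable_EFinP.
  - by move=> x _; rewrite /= lee_fin.
have MA : \forall x \ae mu, A x <= M.
  (* The essential bound is given as a weighted integral of 1 over the exceptional set; the
     indicator [I] converts it into a statement about [hmu]-null sets. *)
  pose I x : R := if (0 < x) && (M < A x) then 1 else 0.
  have mI : measurable_fun setT I.
    apply: measurable_fun_if => //.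
    by apply: measurable_and; apply: measurable_fun_ltr => //; meas.
  have mIE : measurable_fun setT (EFin \o I) by exact/measurable_EFinP.
  have I0 x : 0 <= I x by rewrite /I; case: ifP.
  have EI : (\int[mu]_x (I x)%:E = 0)%E.
    rewrite -[RHS]iM -(intmuE (F := fun x => if (M < cabs (psi x))%R then 1%E else 0%E) mIE); last first.
      by move=> x x0; rewrite /= /I /A /pos_part x0/=; case: ifP.
    rewrite /intmu /intmuD integral_mkcond; apply/esym; rewrite [LHS]integral_mkcond; apply: eq_integral => x _.
    rewrite !patchE in_setI (_ : (x \in [set y | M < cabs (psi y)]) = (M < cabs (psi x))); last first.
      by apply/idP/idP; rewrite inE.
    by case: (x \in _) => //=; case: (M < _); rewrite ?mule0.
  have /(ae_eq_integral_abs mu measurableT mIE) : (\int[mu]_x `|(EFin \o I) x| = 0)%E.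
    by rewrite -[RHS]EI; apply: eq_integral => x _; rewrite /= ger0_norm.
  have := hmu_ae_pos al; apply: filterS2 => x x0 /(_ Logic.I) /= [] /eqP.
  by rewrite /I x0/= leNgt; case: ifP => // _; rewrite oner_eq0.
apply/integrableP; split; first by apply/measurable_EFinP; meas.
apply: (@le_lt_trans _ _ (\int[mu]_x (`|M|%:E * (A x)%:E))%E); last first.
  rewrite ge0_integralZl_EFin//; last exact/measurable_EFinP.
  - by rewrite lte_mul_pinfty// lee_fin.
  - by move=> x _; rewrite lee_fin.
apply: ae_ge0_le_integral => //.
- by apply/measurable_EFinP; apply: measurableT_comp => //; meas.
- by move=> x _; rewrite -EFinM lee_fin mulr_ge0.
- by apply: emeasurable_funM; [exact: measurable_cst|exact/measurable_EFinP].
apply: filterS MA => x AM _; rewrite /= -EFinM lee_fin ger0_norm ?sqr_ge0//.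
rewrite -real_normK ?num_real// expr2; apply: ler_pM => //.
by rewrite (le_trans (fA x))// (le_trans AM)// ler_norm.
Qed.

Lemma hankelE psi xi : cmeasurable (@Rp R) psi ->
  hankel al psi xi = (Hk al (pos_part (fun x => (psi x).1)) xi, Hk al (pos_part (fun x => (psi x).2)) xi).
Proof.
move=> [m1 m2]; rewrite /hankel /Cintmu /Hk.
have E f : measurable_fun (@Rp R) f ->
    Rintmu al (fun x => jal al (x * xi) * f x) = \int[mu]_x (pos_part f x * jal al (x * xi)).
  move=> /measurable_pos_part mf; apply: RintmuE => [|x x0]; last by rewrite /pos_part x0 mulrC.
  have mj := measurable_jal al_gt.
  by apply: measurable_funM => //; apply: (measurableT_comp mj); meas.
by rewrite (E (fun x => (psi x).1))// (E (fun x => (psi x).2)).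
Qed.

Lemma hankel_truncE psi n xi : cmeasurable (@Rp R) psi ->
  hankel al (trunc psi n) xi =
  (Hk al (tru (pos_part (fun x => (psi x).1)) n) xi, Hk al (tru (pos_part (fun x => (psi x).2)) n) xi).
Proof.
move=> [m1 m2].
have mt f : measurable_fun (@Rp R) f -> measurable_fun (@Rp R) (fun x => if x <= n%:R then f x else 0).
  move=> mf; apply: measurable_fun_if => //.
  - exact: measurable_itv.
  - by apply: measurable_fun_ler => //; exact: measurable_id.
  - by apply: measurable_funS mf => //; exact: measurable_itv.
have E1 : (fun x => (trunc psi n x).1) = (fun x => if x <= n%:R then (psi x).1 else 0).
  by apply/funext => x; rewrite /trunc; case: ifP.
have E2 : (fun x => (trunc psi n x).2) = (fun x => if x <= n%:R then (psi x).2 else 0).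
  by apply/funext => x; rewrite /trunc; case: ifP.
have T f : pos_part (fun x => if x <= n%:R then f x else 0) = tru (pos_part f) n.
  by apply/funext => x; rewrite /pos_part /tru; do 2 case: ifP.
rewrite hankelE ?E1 ?E2 ?T//.
by split; rewrite ?E1 ?E2; exact: mt.
Qed.

End half_line.

(** * The complex wavelet transform and its constants in real form *)

Section wavelet_transform.
Context {R : realType}.
Variable al : R.
Hypothesis al_gt : - 2^-1 < al.
Implicit Types x y z s t u th xi a c : R.
Implicit Types F G g h v : R -> R.
Implicit Types psi f : R -> cplx R.

Local Notation mu := (hmu al).
Local Notation leb := (@lebesgue_measure R).

Lemma muleBr_EFin c (x y : \bar R) : 0 < c -> (c%:E * (x - y) = c%:E * x - c%:E * y)%E.
Proof.
move=> c0; case: x => [x| |]; case: y => [y| |] //=;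
  rewrite ?(gt0_muley, gt0_muleNy, lte_fin)//= ?(gt0_muley, gt0_muleNy, lte_fin)//=.
by rewrite -!EFinM -EFinB mulrBr.
Qed.

(* No integrability is assumed: for a positive scalar the formula also holds
   with the junk values of the integral. *)
Lemma RintegralZl_gt0 d (T : measurableType d) (m : {measure set T -> \bar R}) (D : set T) c (g : T -> R) :
  0 < c -> measurable D -> measurable_fun D g ->
  Rintegral m D (fun w => c * g w) = c * Rintegral m D g.
Proof.
move=> c0 mD mf.
have mfE : measurable_fun D (EFin \o g) by exact/measurable_EFinP.
have -> : Rintegral m D (fun w => c * g w) = fine (c%:E * \int[m]_(w in D) (g w)%:E)%E.
  rewrite /Rintegral; congr fine.
  rewrite integralE [in RHS]integralE muleBr_EFin//.
  rewrite -!ge0_integralZl_EFin ?ltW//; [|exact: measurable_funeneg|exact: measurable_funepos].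
  congr (_ - _)%E; apply: eq_integral => x _.
    by rewrite !funeposE maxe_pMr ?lee_fin ?ltW// mule0.
  by rewrite !funenegE EFinM -muleN maxe_pMr ?lee_fin ?ltW// mule0.
rewrite /Rintegral; case: (integral _ _ _) => [r| |] /=; first by [].
  by rewrite gt0_muley ?lte_fin//= mulr0.
by rewrite gt0_muleNy ?lte_fin//= mulr0.
Qed.

(** At interior angles the radius is positive, so replacing a function by its [pos_part] does not
    affect the integrand of its translate. *)
Lemma rr_gt0 x t th : 0 < t -> 0 < th < pi -> 0 < rr x t th.
Proof.
move=> t0 th0; rewrite sqrtr_gt0.
have s0 : 0 < sin th by apply: sin_gt0_pi; case/andP: th0 => -> ->.
have -> : x ^+ 2 + t ^+ 2 + 2 * x * t * cos th = (x + t * cos th) ^+ 2 + (t * sin th) ^+ 2.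
  rewrite sqrrD !exprMn -addrA; have := cos2Dsin2 th; move: (cos th) (sin th) => p q h.
  have -> : p ^+ 2 = 1 - q ^+ 2 by rewrite -h addrK.
  ring.
by rewrite ltr_wpDl ?sqr_ge0// exprn_gt0// mulr_gt0.
Qed.

Lemma htrans_component F a x t : measurable_fun (@Rp R) F -> 0 < a -> 0 < t ->
  Gamma (al + 1) / (Gamma (2^-1) * Gamma (al + 2^-1)) *
    Rintegral leb `[0, pi]%classic (fun th => a `^ (al + 1) *
       F (a * Num.sqrt (x ^+ 2 + t ^+ 2 + 2 * x * t * cos th)) * (sin th) `^ (2 * al)) =
  tr al (dl al a (pos_part F)) x t.
Proof.
move=> mF a0 t0.
have mP := measurable_pos_part mF.
have md := measurable_dl al a mP.
have mr : measurable_fun setT (fun th => dl al a (pos_part F) (rr x t th)).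
  by apply: (measurableT_comp md); apply: measurable_fun_rr; meas.
set D := dl al a (pos_part F) in md mr *.
pose K th : R := D (rr x t th) * sin th `^ (2 * al).
have mK : measurable_fun setT K.
  apply: measurable_funM => //; apply: (measurableT_comp (measurable_powR _)).
  exact: measurable_sin.
have mO : measurable (`]0, pi[%classic : set R) by exact: measurable_itv.
have EK : {in (`]0, pi[%classic : set R), (fun th => a `^ (al + 1) *
       F (a * Num.sqrt (x ^+ 2 + t ^+ 2 + 2 * x * t * cos th)) * (sin th) `^ (2 * al)) =1 K}.
  move=> th; rewrite inE /= in_itv/= => th0.
  have r0 := rr_gt0 x t0 th0.
  by rewrite /K /D /dl /pos_part mulr_gt0.
set L := (fun th => a `^ _ * _ * _) in EK *.
have mKO : measurable_fun (`]0, pi[%classic : set R) (EFin \o K).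
  by apply/measurable_EFinP; apply: measurable_funS mK.
have mLO : measurable_fun (`]0, pi[%classic : set R) (EFin \o L).
  by apply: eq_measurable_fun mKO => th th0 /=; rewrite -EK.
(* The endpoints are dropped as a null set: at [th = pi] the radius vanishes when [x = t], and there
   [F] may differ from its [pos_part]. *)
have -> : Rintegral leb `[0, pi]%classic L = Rintegral leb `]0, pi[%classic K.
  rewrite /Rintegral; congr fine.
  have mLc : measurable_fun (`[0, pi[%classic : set R) (EFin \o L).
    by apply/emeasurable_fun_itv_obnd_cbndP.
  rewrite -integral_itv_bndo_bndc// -integral_itv_obnd_cbnd//.
  by apply: eq_integral => th th0; rewrite -EK.
rewrite -[Gamma _ / _]/(csig al) -RintegralZl_gt0//; last 2 first.
- exact: csig_gt0.
- by apply: measurable_funS mK.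
rewrite /tr /Rintegral; congr fine.
rewrite (integral_hsig al_gt); last exact/measurable_EFinP.
rewrite integral_lebR; last first.
  by apply: emeasurable_funM; apply/measurable_EFinP => //; exact: measurable_dsig.
rewrite integral_mkcond; apply: eq_integral => th _.
rewrite patchE mem_setE in_itv/= /dsig; case: ifP => _; last by rewrite mul0e.
rewrite -EFinM /K; congr _%:E.
by move: (csig al) (D _) (_ `^ _) => u v w; ring.
Qed.

Lemma hwtE psi f a x : cmeasurable (@Rp R) psi -> cmeasurable (@Rp R) f ->
  let phi1 := pos_part (fun y => (psi y).1) in let phi2 := pos_part (fun y => (psi y).2) in
  let h1 := pos_part (fun y => (f y).1) in let h2 := pos_part (fun y => (f y).2) in
  let k := (Num.sqrt (fine (cpsi al psi)))^-1 in
  L12 al phi1 -> L12 al phi2 -> L2f al h1 -> L2f al h2 -> 0 < a ->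
  hwt al psi f (a, x) = (W1 al phi1 phi2 k h1 h2 a x, W2 al phi1 phi2 k h1 h2 a x).
Proof.
move=> [p1 p2] [f1 f2] phi1 phi2 h1 h2 k L1 L2 H1 H2 a0.
have g1 t : 0 < t -> (htrans al x (dil al a psi) t).1 = tr al (dl al a phi1) x t.
  by move=> t0; exact: (htrans_component x p1 a0 t0).
have g2 t : 0 < t -> (htrans al x (dil al a psi) t).2 = tr al (dl al a phi2) x t.
  by move=> t0; exact: (htrans_component x p2 a0 t0).
have [i1 j1] := L12_dl al_gt a0 L1; have [i2 j2] := L12_dl al_gt a0 L2.
have [m1 _ q1] := H1; have [m2 _ q2] := H2.
have I11 := integrable_h_tr al_gt x (integrable_meas i1) m1 j1 q1.
have I22 := integrable_h_tr al_gt x (integrable_meas i2) m2 j2 q2.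
have I12 := integrable_h_tr al_gt x (integrable_meas i1) m2 j1 q2.
have I21 := integrable_h_tr al_gt x (integrable_meas i2) m1 j2 q1.
rewrite /hwt /W1 /W2 /wt /cw; congr (_ * _, _ * _).
  rewrite -(RintegralD measurableT I11 I22); apply: (RintmuE al_gt).
    by apply: measurable_funD; [exact: (integrable_meas I11)|exact: (integrable_meas I22)].
  by move=> t t0; rewrite (g1 t t0) (g2 t t0) /h1 /h2 /pos_part t0.
rewrite -(RintegralB measurableT I12 I21); apply: (RintmuE al_gt).
  by apply: measurable_funB; [exact: (integrable_meas I12)|exact: (integrable_meas I21)].
by move=> t t0; rewrite (g1 t t0) (g2 t t0) /h1 /h2 /pos_part t0.
Qed.

Lemma cpsiE psi : cmeasurable (@Rp R) psi ->
  let phi1 := pos_part (fun y => (psi y).1) in let phi2 := pos_part (fun y => (psi y).2) in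
  (cpsi al psi = \int[lebR]_a (if (0 < a)%R then (a^-1)%:E * (NH al phi1 phi2 a)%:E else 0))%E.
Proof.
move=> cm phi1 phi2; have [m1 m2] := cm.
have mN : measurable_fun setT (NH al phi1 phi2).
  by apply: (measurable_NH al_gt); exact: measurable_pos_part.
rewrite integral_lebR; last first.
  move: (NH _ _ _) mN => N mN; have minv := @measurable_inv R.
  apply: measurable_fun_if => //.
  - by apply: measurable_fun_ltr => //; exact: measurable_cst.
  - apply: (measurable_funS measurableT) => //.
    by apply: emeasurable_funM; apply/measurable_EFinP.
rewrite /cpsi integral_mkcond; apply: eq_integral => a _.
rewrite patchE /Rpos mem_setE in_itv/= andbT; case: ifP => // _.
by rewrite -EFinM (hankelE al_gt _ cm) /csq /NH mulrC.
Qed.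

Lemma intnuE (F : R * R -> \bar R) (G : R * R -> R) : measurable_fun setT G -> (forall p, 0 <= G p) ->
  (forall a x, 0 < a -> 0 < x -> F (a, x) = (G (a, x))%:E) ->
  intnu al F = (\int[nua al]_a \int[mu]_x (G (a, x))%:E)%E.
Proof.
move=> mG G0 FG.
pose K (p : R * R) := ((ada al p.1 * dmu al p.2)%:E * (G p)%:E)%E.
have mK : measurable_fun setT K.
  have ma := measurable_ada al; have md := measurable_dmu al.
  rewrite /K; move: (ada al) (dmu al) ma md => A D ma md.
  by apply: emeasurable_funM; apply/measurable_EFinP => //; meas.
have K0 p : (0 <= K p)%E by rewrite mule_ge0 ?lee_fin// mulr_ge0 ?ada_ge0 ?dmu_ge0.
have mid : measurable_fun [set: measurableTypeR R] (idfun : measurableTypeR R -> R).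
  by move=> _ Y mY; rewrite setTI; exact: mY.
have mK' : measurable_fun [set: measurableTypeR R * measurableTypeR R] K.
  have mp : measurable_fun [set: measurableTypeR R * measurableTypeR R]
      (fun p : measurableTypeR R * measurableTypeR R => (p.1 : R, p.2 : R)).
    by apply: measurable_fun_pair; [exact: (measurableT_comp mid measurable_fst)|exact: (measurableT_comp mid measurable_snd)].
  rewrite (_ : K = K \o (fun p : measurableTypeR R * measurableTypeR R => (p.1 : R, p.2 : R))); last first.
    by apply/funext => -[].
  exact: (measurableT_comp mK mp).
(* Outside [calR] the masked densities vanish, and on the edge [x = 0] the density [wmu] is 0 as
   well. *)
have -> : intnu al F = (\int[(leb \x leb)%E]_p K p)%E.
  rewrite /intnu integral_mkcond; apply: eq_integral => -[a x] _.
  rewrite patchE /calR in_setX /Rpos /Rp /= !mem_setE !in_itv/= !andbT /K /ada /dmu /=.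
  case: (ltP 0 a) => a0 /=; last by rewrite mul0r mul0e.
  have [x0|x0|<-] := ltgtP 0 x; first by rewrite FG.
  - by rewrite mulr0 mul0e.
  - by rewrite (wmu0 al_gt) mulr0 !mul0e.
rewrite (fubini_tonelli1 (m1 := leb) (m2 := leb) K mK' K0) /fubini_F.
have mKa a : measurable_fun setT (fun x => K (a, x)) := measurableT_comp mK (measurable_pair1 a).
have mI : measurable_fun setT (fun a => \int[mu]_x (G (a, x))%:E)%E.
  apply: (measurable_tonelli mu (f := fun a x => (G (a, x))%:E)).
    by apply/measurable_EFinP; rewrite (_ : (fun p => G (p.1, p.2)) = G)//; apply/funext => -[].
  by move=> a x; rewrite lee_fin.
have EI a : (\int[leb]_x K (a, x) = (ada al a)%:E * \int[mu]_x (G (a, x))%:E)%E.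
  have mGa : measurable_fun setT (fun x => (G (a, x))%:E).
    by apply/measurable_EFinP; exact: (measurableT_comp mG (measurable_pair1 a)).
  have mDG : measurable_fun setT (fun x => ((dmu al x)%:E * (G (a, x))%:E)%E).
    by apply: emeasurable_funM => //; apply/measurable_EFinP; exact: measurable_dmu.
  rewrite (integral_hmu al_gt mGa) -integral_lebR// -ge0_integralZl_EFin//; last 2 first.
  - by move=> x _; rewrite mule_ge0 ?lee_fin ?dmu_ge0.
  - exact: ada_ge0.
  by apply: eq_integral => x _; rewrite /K /= EFinM muleA.
rewrite (integral_nua al mI) integral_lebR; last first.
  by apply: emeasurable_funM => //; apply/measurable_EFinP; exact: measurable_ada.
by apply: eq_integral => a _; rewrite EI.
Qed.

End wavelet_transform.

Theorem mainTheorem4 (R : realType) (al : R) (psi f g : R -> cplx R) :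
  - 2^-1 < al ->
  admissible al psi ->
  L2a al f ->
  hankelL2 al f g ->
  let nW := intnu al (fun p => (p.2 ^+ 2 * csq (hwt al psi f p))%:E) in
  let nH := intmu al (fun xi => (xi ^+ 2 * csq (g xi))%:E) in
  ((2 * al + 2)%:E * norm2mu al f <= nW + nH)%E /\
  ((al + 1)%:E * norm2mu al f <= sqrte nW * sqrte nH)%E.
Proof.
move=> al_gt [psi1 psioo _ /andP[c0 coo]] f2 [g2 cv] nW nH.
have [cmp _] := psi1; have [mp1 mp2] := cmp.
have [cmf _] := f2; have [cmg _] := g2; have [mg1 mg2] := cmg.
have L1 : L12 al (pos_part (fun y => (psi y).1)).
  by apply: (L12_pos_part al_gt psi1 psioo mp1) => x; rewrite lerDl sqr_ge0.
have L2 : L12 al (pos_part (fun y => (psi y).2)).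
  by apply: (L12_pos_part al_gt psi1 psioo mp2) => x; rewrite lerDr sqr_ge0.
have [H1 H2] := L2a_pos_part al_gt f2.
have EW a x (a0 : 0 < a) := hwtE al_gt x cmp cmf L1 L2 H1 H2 a0.
have Hc := cpsiE al_gt cmp.
set k := (Num.sqrt _)^-1 in EW.
have {}Hc : ((k ^+ 2)%:E * cpsi al psi = 1)%E.
  have cE : cpsi al psi = (fine (cpsi al psi))%:E by rewrite fineK// ge0_fin_numE// ltW.
  have c1 : 0 < fine (cpsi al psi) by rewrite fine_gt0// c0 coo.
  by rewrite cE -EFinM exprVn sqr_sqrtr ?ltW// mulVf// gt_eqF.
rewrite (cpsiE al_gt cmp) in Hc.
set phi1 := pos_part (fun y => (psi y).1) in L1 EW Hc.
set phi2 := pos_part (fun y => (psi y).2) in L2 EW Hc.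
set h1 := pos_part (fun y => (f y).1) in H1 EW.
set h2 := pos_part (fun y => (f y).2) in H2 EW.
pose G1 := pos_part (fun y => (g y).1); pose G2 := pos_part (fun y => (g y).2).
have mG1 : measurable_fun setT G1 by exact: measurable_pos_part.
have mG2 : measurable_fun setT G2 by exact: measurable_pos_part.
have mh1 := L2f_meas H1; have mh2 := L2f_meas H2.
have NE : norm2mu al f = nrm2 al h1 h2.
  apply: (intmuE al_gt); last by move=> x x0; rewrite /h1 /h2 /pos_part x0.
  by clearbody h1 h2; meas.
have HE : nH = A2 al (fun x => x ^+ 2) G1 G2.
  apply: (intmuE al_gt); last by move=> x x0; rewrite /G1 /G2 /pos_part x0.
  by clearbody G1 G2; meas.
have WE : nW = TT al phi1 phi2 k (fun x => x ^+ 2) h1 h2.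
  have mx : measurable_fun [set: R] (fun x : R => x ^+ 2) by meas.
  have x0 (x : R) : 0 <= x ^+ 2 by exact: sqr_ge0.
  rewrite (TT_fubini k L1 L2 mh1 mh2 mx x0).
  apply: (intnuE al_gt (G := fun p => p.2 ^+ 2 * (V1 al phi1 phi2 k h1 h2 p ^+ 2 + V2 al phi1 phi2 k h1 h2 p ^+ 2))).
  - exact: (measurable_TT k L1 L2 mx H1 H2).
  - by move=> p; rewrite mulr_ge0 ?addr_ge0 ?sqr_ge0.
  - by move=> a x a0 _; rewrite (EW a x a0) /csq /V1 /V2 /= a0.
rewrite NE HE WE; apply: (uncertainty_pair al_gt L1 L2 Hc H1 H2 mG1 mG2).
(* The convergence contained in [hankelL2], read on positive parts, is the one that
   [uncertainty_pair] requires. *)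
rewrite (_ : (fun n => _) = (fun n : nat => norm2mu al (fun xi =>
       ((hankel al (trunc f n) xi).1 - (g xi).1,
        (hankel al (trunc f n) xi).2 - (g xi).2)))) //; apply/funext => n.
have mK1 := measurable_Hk al_gt (measurable_tru n mh1).
have mK2 := measurable_Hk al_gt (measurable_tru n mh2).
apply/esym/(intmuE al_gt).
  by clearbody G1 G2; move: (Hk _ _) (Hk _ _) mK1 mK2 => A B mA mB; meas.
by move=> x x0; rewrite !(hankel_truncE al_gt _ _ cmf) /csq /G1 /G2 /pos_part x0.
Qed.
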